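(* Let $H=\bigoplus_{n\ge 0}H(n)$ be a finite-dimensional coradically graded Hopf algebra whose coradical $H_0$ is the Kac–Paljutkin Hopf algebra $\mathcal{KP}$. Then for every Loewy-graded AM-exact $H$-comodule algebra $B$, the ${}_H\mathcal{M}$-module category ${}_B\mathcal{M}$ is equivalent (as an ${}_H\mathcal{M}$-module category) to ${}_A\mathcal{M}$ for some homogeneous left coideal subalgebra $A\subseteq H$.
   Context: Throughout, $\Bbbk$ is an algebraically closed field of characteristic zero; Hopf algebras, modules, comodules and comodule algebras are finite-dimensional over $\Bbbk$. For an algebra $A$, ${}_A\mathcal{M}$ is the category of finite-dimensional left $A$-modules. $\mathcal{KP}$ is the 8-dimensional Hopf algebra generated by $x,y,z$ with relations $x^2=y^2=1$, $xy=yx$, $yz=zx$, $xz=zy$, $z^2=\tfrac12(1+x+y-xy)$; $x,y$ are grouplike, $\Delta(z)=\tfrac12\big((1+y)z\otimes z+(1-y)z\otimes xz\big)$, $\epsilon(z)=1$, $S(z)=z$. Coradically graded: $H=\bigoplus_{n\ge0}H(n)$ is a graded Hopf algebra whose coradical filtration is $H_n=\bigoplus_{i=0}^nH(i)$; so $H_0=H(0)$. $H$-comodule algebra: an algebra $B$ with a left coaction $\lambda:B\to H\otimes B$, $\lambda(b)=b_{(-1)}\otimes b_{(0)}$, that is an algebra morphism. $B$ is AM-exact if $B^{\mathrm{co}H}=\{b:\lambda(b)=1\otimes b\}$ is one-dimensional and $B$ has no right ideals $J$ with $\lambda(J)\subseteq H\otimes J$ other than $0$ and $B$. A left coideal subalgebra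 of $H$ is a subalgebra $A\subseteq H$ with $\Delta(A)\subseteq H\otimes A$, viewed as an $H$-comodule algebra via $\Delta$; it is homogeneous if $A=\bigoplus_n(A\cap H(n))$. Loewy-graded: an $H$-comodule algebra $B$ with an algebra grading $B=\bigoplus_{n\ge0}B(n)$ such that $\lambda^{-1}(H_n\otimes B)=\bigoplus_{i=0}^nB(i)$ and $\lambda(B(n))\subseteq\bigoplus_{i=0}^nH(i)\otimes B(n-i)$ for all $n$. For an $H$-comodule algebra $B$, ${}_B\mathcal{M}$ is a left ${}_H\mathcal{M}$-module category: for $X\in{}_H\mathcal{M}$, $M\in{}_B\mathcal{M}$, the object $X\otimes_\Bbbk M$ has action $b\cdot(x\otimes m)=b_{(-1)}x\otimes b_{(0)}m$. *)

(* Defs.v *)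
From HB Require Import structures.
From mathcomp Require Import all_boot all_algebra falgebra.
From Stdlib Require Import FunctionalExtensionality.

Set Implicit Arguments.
Unset Strict Implicit.
Unset Printing Implicit Defensive.

Import GRing.Theory.
Import VectorInternalTheory.
Local Open Scope ring_scope.

Reserved Notation "u \ot v" (at level 40, left associativity).

Section Tensor.
Variable k : fieldType.
Implicit Types R S T U V W : vectType k.

(* Tensor products in coordinates: u (x) v is the matrix (u_i v_j).  That this
   is a tensor product is the content of [tliftE] and [tensor_ext] below. *)
Definition tensor U V : vectType k := 'M[k]_(dim U, dim V).

Definition tpure U V (u : U) (v : V) : tensor U V :=
  ((v2r u)^T *m v2r v : 'M[k]_(dim U, dim V)).

Definition basis_vec U (i : 'I_(dim U)) : U := r2v (delta_mx 0 i).

Definition tlift_fun U V W (f : U -> V -> W) (t : tensor U V) : W :=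
  \sum_i \sum_j (t : 'M[k]_(dim U, dim V)) i j *: f (basis_vec i) (basis_vec j).

(* The linear map U (x) V -> W induced by a bilinear map f; the definition is
   total and meaningless when f is not bilinear. *)
Definition tlift U V W (f : U -> V -> W) : 'Hom(tensor U V, W) :=
  linfun (tlift_fun f).

Definition bilin U V W (f : U -> V -> W) : Prop :=
  (forall v, linear (f^~ v)) /\ (forall u, linear (f u)).

Definition tmap U V U' V' (f : 'Hom(U, U')) (g : 'Hom(V, V')) :
    'Hom(tensor U V, tensor U' V') :=
  tlift (fun u v => tpure (f u) (g v)).

Definition tassoc U V W :
    'Hom(tensor (tensor U V) W, tensor U (tensor V W)) :=
  tlift (fun t w => tlift (fun u v => tpure u (tpure v w)) t).

Definition tmul (A B : falgType k) (s t : tensor A B) : tensor A B :=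
  tlift (fun a b => tlift (fun a' b' => tpure (a * a') (b * b')) t) s.

(* The action of S (x) T on U (x) V induced by actions of S on U and T on V. *)
Definition tend S T U V (f : 'Hom(S, 'End(U))) (g : 'Hom(T, 'End(V))) :
    'Hom(tensor S T, 'End(tensor U V)) :=
  tlift (fun s t => tmap (f s) (g t)).

(* The subspace P (x) Q of U (x) V. *)
Definition tensv U V (P : {vspace U}) (Q : {vspace V}) : {vspace tensor U V} :=
  <<[seq tpure u v | u <- vbasis P, v <- vbasis Q]>>%VS.

End Tensor.

Notation "u \ot v" := (tpure u v) : ring_scope.

Section TensorTheory.
Variable k : fieldType.
Implicit Types R S T U V W : vectType k.

Lemma tpure_bilin U V : bilin (@tpure k U V).
Proof.
split=> [v a u u' | u a v v']; rewrite /tpure linearP /=.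
  by rewrite linearP /= mulmxDl scalemxAl.
by rewrite mulmxDr scalemxAr.
Qed.

Lemma tpureDl U V a (u u' : U) (v : V) :
  (a *: u + u') \ot v = a *: (u \ot v) + u' \ot v.
Proof. exact: (tpure_bilin U V).1. Qed.

Lemma tpureDr U V a (u : U) (v v' : V) :
  u \ot (a *: v + v') = a *: (u \ot v) + u \ot v'.
Proof. exact: (tpure_bilin U V).2. Qed.

Lemma tlift_fun_linear U V W (f : U -> V -> W) : linear (tlift_fun f).
Proof.
move=> a s t; rewrite /tlift_fun scaler_sumr -big_split; apply: eq_bigr => i _.
rewrite scaler_sumr -big_split; apply: eq_bigr => j _ /=.
by rewrite !mxE scalerDl scalerA.
Qed.

Lemma tlift_coordE U V W (f : U -> V -> W) t : tlift f t = tlift_fun f t.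
Proof.
pose L := GRing.isLinear.Build k (tensor U V) W _ (tlift_fun f)
            (tlift_fun_linear f).
pose g : {linear tensor U V -> W} := HB.pack (tlift_fun f) L.
exact: (lfunE g).
Qed.

Lemma basis_vec_sum U (u : U) : u = \sum_i v2r u 0 i *: basis_vec i.
Proof.
rewrite -[LHS]v2rK [v2r u in LHS]row_sum_delta linear_sum; apply: eq_bigr=> i _.
by rewrite linearZ.
Qed.

Lemma linear_fun_sum U W (f : U -> W) (I : Type) (r : seq I) (c : I -> k)
    (u : I -> U) :
  linear f -> f (\sum_(i <- r) c i *: u i) = \sum_(i <- r) c i *: f (u i).
Proof.
move=> fL.
pose g : {linear U -> W} := HB.pack f (GRing.isLinear.Build k U W _ f fL).
have -> : f = g by [].
by rewrite linear_sum; apply: eq_bigr=> i _; rewrite linearZ.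
Qed.

Lemma tliftE U V W (f : U -> V -> W) u v : bilin f -> tlift f (u \ot v) = f u v.
Proof.
case=> fl fr; rewrite tlift_coordE /tlift_fun.
rewrite [u in RHS]basis_vec_sum (linear_fun_sum _ _ _ (fl v)).
apply: eq_bigr=> i _; rewrite [v in RHS]basis_vec_sum.
rewrite (linear_fun_sum _ _ _ (fr _)) scaler_sumr; apply: eq_bigr=> j _.
by rewrite scalerA /tpure !mxE big_ord1 !mxE.
Qed.

Lemma tensor_sum U V (t : tensor U V) :
  t = \sum_i \sum_j (t : 'M[k]_(dim U, dim V)) i j
                      *: (basis_vec i \ot basis_vec j).
Proof.
rewrite [LHS]matrix_sum_delta; apply: eq_bigr=> i _; apply: eq_bigr=> j _.
congr (_ *: _); rewrite /tpure /basis_vec !r2vK trmx_delta.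
by rewrite mul_delta_mx.
Qed.

Lemma tensor_ind U V (P : tensor U V -> Prop) :
  (forall u v, P (u \ot v)) ->
  (forall a s t, P s -> P t -> P (a *: s + t)) -> forall t, P t.
Proof.
move=> Pp PL; have P0 : P 0.
  by have := PL (-1) _ _ (Pp 0 0) (Pp 0 0); rewrite scaleN1r addNr.
have PZ a s : P s -> P (a *: s) by move=> Ps; rewrite -[_ *: _]addr0; apply: PL.
have PD s t : P s -> P t -> P (s + t).
  by move=> Ps Pt; rewrite -[s]scale1r; apply: PL.
move=> t; rewrite [t]tensor_sum; elim/big_ind: _ => // i _.
by elim/big_ind: _ => // j _; apply: PZ.
Qed.

Lemma tensor_ext U V W (f g : 'Hom(tensor U V, W)) :
  (forall u v, f (u \ot v) = g (u \ot v)) -> f = g.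
Proof.
move=> fg; apply/lfunP; apply: tensor_ind=> // a s t fs ft.
by rewrite !linearP /= fs ft.
Qed.

Lemma tmapE U V U' V' (f : 'Hom(U, U')) (g : 'Hom(V, V')) u v :
  tmap f g (u \ot v) = f u \ot g v.
Proof.
rewrite tliftE //; split=> [w a x y|w a x y] /=; rewrite linearP /=.
  exact: tpureDl.
exact: tpureDr.
Qed.

Lemma tlift_ext_linear U V W (f g h : U -> V -> W) a :
  (forall u v, h u v = a *: f u v + g u v) ->
  forall t, tlift h t = a *: tlift f t + tlift g t.
Proof.
move=> hE t; rewrite !tlift_coordE /tlift_fun scaler_sumr -big_split.
apply: eq_bigr=> i _; rewrite scaler_sumr -big_split; apply: eq_bigr=> j _ /=.
by rewrite hE scalerDr !scalerA mulrC.
Qed.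

Lemma tassocE U V W (u : U) (v : V) (w : W) :
  tassoc U V W ((u \ot v) \ot w) = u \ot (v \ot w).
Proof.
have bil w' : bilin (fun (u : U) (v : V) => u \ot (v \ot (w' : W))).
  split=> x a y z /=; first exact: tpureDl.
  by rewrite tpureDl tpureDr.
rewrite tliftE ?tliftE //; split=> [x a y z|x a y z] /=; first exact: linearP.
by apply: tlift_ext_linear=> *; rewrite !tpureDr.
Qed.

Lemma tmul_bilin (A B : falgType k) : bilin (@tmul k A B).
Proof.
split=> [v a s t|v a s t]; first by rewrite /tmul linearP.
by apply: tlift_ext_linear=> u w; rewrite linearP.
Qed.

Lemma tmulE (A B : falgType k) (a a' : A) (b b' : B) :
  tmul (a \ot b) (a' \ot b') = (a * a') \ot (b * b').
Proof.
have bil c d : bilin (fun (a' : A) (b' : B) => (c * a') \ot (d * b')).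
  split=> x e y z /=; first by rewrite mulrDr -scalerAr tpureDl.
  by rewrite mulrDr -scalerAr tpureDr.
rewrite /tmul tliftE ?tliftE //; split=> [x c y z|x c y z] /=.
  by apply: tlift_ext_linear=> u v; rewrite mulrDl -scalerAl tpureDl.
by apply: tlift_ext_linear=> u v; rewrite mulrDl -scalerAl tpureDr.
Qed.

Lemma memv_tensv U V (P : {vspace U}) (Q : {vspace V}) u v :
  u \in P -> v \in Q -> u \ot v \in tensv P Q.
Proof.
move=> /coord_vbasis-> /coord_vbasis->.
rewrite (linear_fun_sum _ _ _ ((tpure_bilin U V).1 _)).
apply: memv_suml=> i _; apply: memvZ.
rewrite (linear_fun_sum _ _ _ ((tpure_bilin U V).2 _)).
apply: memv_suml=> j _; apply/memvZ/memv_span/allpairs_f;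
  by apply: mem_nth; rewrite size_tuple.
Qed.

Lemma tensv_subP U V (P : {vspace U}) (Q : {vspace V}) (T : {vspace tensor U V}) :
  (forall u v, u \in P -> v \in Q -> u \ot v \in T) -> (tensv P Q <= T)%VS.
Proof.
move=> PQT; apply/span_subvP=> _ /allpairsP[[u v] /= [uP vQ ->]].
by apply: PQT; apply: vbasis_mem.
Qed.

Lemma tmap_comp U V U' V' U'' V'' (f' : 'Hom(U', U'')) (g' : 'Hom(V', V''))
    (f : 'Hom(U, U')) (g : 'Hom(V, V')) t :
  tmap f' g' (tmap f g t) = tmap (f' \o f)%VF (g' \o g)%VF t.
Proof.
by elim/tensor_ind: t => [u v|a s t IHs IHt];
  rewrite ?tmapE ?comp_lfunE // !linearP /= IHs IHt.
Qed.

Lemma tmap_id U V (t : tensor U V) : tmap \1%VF \1%VF t = t.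
Proof.
by elim/tensor_ind: t => [u v|a s t IHs IHt];
  rewrite ?tmapE ?id_lfunE // !linearP /= IHs IHt.
Qed.

Lemma tmap_linear_l U V U' V' (g : 'Hom(V, V')) t :
  linear (fun f : 'Hom(U, U') => tmap f g t).
Proof.
by move=> a f f'; apply: tlift_ext_linear=> u v; rewrite !lfunE /= lfunE tpureDl.
Qed.

Lemma tmap_linear_r U V U' V' (f : 'Hom(U, U')) t :
  linear (fun g : 'Hom(V, V') => tmap f g t).
Proof.
by move=> a g g'; apply: tlift_ext_linear=> u v; rewrite !lfunE /= lfunE tpureDr.
Qed.

Lemma tassoc_nat U V W U' V' W' (f : 'Hom(U, U')) (g : 'Hom(V, V'))
    (h : 'Hom(W, W')) t :
  tassoc U' V' W' (tmap (tmap f g) h t) = tmap f (tmap g h) (tassoc U V W t).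
Proof.
elim/tensor_ind: t => [s w|a s t IHs IHt]; last by rewrite !linearP /= IHs IHt.
elim/tensor_ind: s => [u v|a s t IHs IHt].
  by rewrite !(tmapE, tassocE).
by rewrite tpureDl !linearP /= IHs IHt.
Qed.

Lemma tendE S T U V (f : 'Hom(S, 'End(U))) (g : 'Hom(T, 'End(V))) s t :
  tend f g (s \ot t) = tmap (f s) (g t).
Proof.
rewrite /tend tliftE //; split=> [x a u v|x a u v]; apply/lfunP=> w.
  by rewrite linearP tmap_linear_l !lfunE /= lfunE.
by rewrite linearP tmap_linear_r !lfunE /= lfunE.
Qed.

Lemma tend_tmap S T S' T' U V (f : 'Hom(S', 'End(U))) (g : 'Hom(T', 'End(V)))
    (p : 'Hom(S, S')) (q : 'Hom(T, T')) r :
  tend f g (tmap p q r) = tend (f \o p)%VF (g \o q)%VF r.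
Proof.
elim/tensor_ind: r => [s t|a s t IHs IHt]; last by rewrite !linearP /= IHs IHt.
by rewrite tmapE !tendE !comp_lfunE.
Qed.

Lemma tend_assoc R S T U V W (f : 'Hom(R, 'End(U))) (g : 'Hom(S, 'End(V)))
    (h : 'Hom(T, 'End(W))) r x :
  tassoc U V W (tend (tend f g) h r x)
  = tend f (tend g h) (tassoc R S T r) (tassoc U V W x).
Proof.
elim/tensor_ind: r => [p t|a p q IHp IHq]; last first.
  by rewrite !linearP /= !add_lfunE !scale_lfunE linearP /= IHp IHq.
elim/tensor_ind: p => [r s|a p q IHp IHq].
  by rewrite tassocE !tendE tassoc_nat.
rewrite tpureDl !linearP /= !add_lfunE !scale_lfunE !linearP /=.
by rewrite IHp IHq.
Qed.

Lemma comp_tlift U V W W' (g : 'Hom(W, W')) (f : U -> V -> W) t :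
  g (tlift f t) = tlift (fun u v => g (f u v)) t.
Proof.
rewrite !tlift_coordE /tlift_fun linear_sum; apply: eq_bigr=> i _.
by rewrite linear_sum; apply: eq_bigr=> j _; rewrite linearZ.
Qed.

Lemma eq_tlift U V W (f g : U -> V -> W) t :
  (forall u v, f u v = g u v) -> tlift f t = tlift g t.
Proof.
move=> fg; rewrite !tlift_coordE /tlift_fun.
by apply: eq_bigr=> i _; apply: eq_bigr=> j _; rewrite fg.
Qed.

Lemma tlift_tmap U V U' V' W (F : U' -> V' -> W) (f : 'Hom(U, U'))
    (g : 'Hom(V, V')) t :
  bilin F -> tlift F (tmap f g t) = tlift (fun u v => F (f u) (g v)) t.
Proof.
move=> FB; rewrite [tmap f g]/tmap comp_tlift; apply: eq_tlift=> u v.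
exact: tliftE.
Qed.

Lemma tmap_tmul (A B A' B' : falgType k) (f : 'Hom(A, A')) (g : 'Hom(B, B'))
    s t :
  {morph f : x y / x * y} -> {morph g : x y / x * y} ->
  tmap f g (tmul s t) = tmul (tmap f g s) (tmap f g t).
Proof.
move=> fM gM; elim/tensor_ind: s => [a b|c s s' IHs IHs'].
  elim/tensor_ind: t => [a' b'|c t t' IHt IHt'].
    by rewrite !(tmulE, tmapE) fM gM.
  by rewrite (tmul_bilin A B).2 !linearP /= (tmul_bilin A' B').2 IHt IHt'.
by rewrite (tmul_bilin A B).1 !linearP /= (tmul_bilin A' B').1 IHs IHs'.
Qed.

End TensorTheory.

Section Gradings.
Variables (k : fieldType) (V : vectType k).

(* W is the internal direct sum of the family (G n); all spaces being
   finite-dimensional, the partial sums are eventually constant. *)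
Definition is_direct_decomposition (G : nat -> {vspace V}) (W : {vspace V}) :=
  (forall m, directv (\sum_(n < m) G n)) /\
  (exists N, forall m, (N <= m)%N -> (\sum_(n < m) G n)%VS = W).

End Gradings.

Definition is_graded_algebra (k : fieldType) (A : falgType k)
    (G : nat -> {vspace A}) : Prop :=
  [/\ is_direct_decomposition G fullv,
      1 \in G 0%N
    & forall m n, (G m * G n <= G (m + n)%N)%VS].

Section HopfAlgebras.
Variable k : fieldType.

Record hopfAlgebra := HopfAlgebra {
  hopf_sort :> falgType k;
  comul : 'Hom(hopf_sort, tensor hopf_sort hopf_sort);
  counit : 'Hom(hopf_sort, k^o);
  antipode : 'End(hopf_sort);
  comul_coassoc : forall h,
    tassoc _ _ _ (tmap comul \1%VF (comul h)) = tmap \1%VF comul (comul h);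
  counit_left : forall h,
    tlift (fun g h => (counit g : k) *: h) (comul h) = h;
  counit_right : forall h,
    tlift (fun g h => (counit h : k) *: g) (comul h) = h;
  comul_one : comul 1 = 1 \ot 1;
  comul_mul : forall g h, comul (g * h) = tmul (comul g) (comul h);
  counit_one : counit 1 = 1;
  counit_mul : forall g h, counit (g * h) = counit g * counit h;
  antipode_left : forall h,
    tlift (fun g h => antipode g * h) (comul h) = (counit h : k)%:A;
  antipode_right : forall h,
    tlift (fun g h => g * antipode h) (comul h) = (counit h : k)%:A
}.

Variable H : hopfAlgebra.

Definition subcoalgebra (C : {vspace H}) : Prop :=
  (comul H @: C <= tensv C C)%VS.

Definition simple_subcoalgebra (C : {vspace H}) : Prop :=
  [/\ subcoalgebra C, C != 0%VS
    & forall D, subcoalgebra D -> (D <= C)%VS -> D = 0%VS \/ D = C].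

(* The coradical is the sum, i.e. the least upper bound in the lattice of
   subspaces, of all simple subcoalgebras. *)
Definition is_coradical (C : {vspace H}) : Prop :=
  (forall D, simple_subcoalgebra D -> (D <= C)%VS) /\
  (forall U : {vspace H},
     (forall D, simple_subcoalgebra D -> (D <= U)%VS) -> (C <= U)%VS).

Definition is_coradical_filtration (F : nat -> {vspace H}) : Prop :=
  is_coradical (F 0%N) /\
  forall n, F n.+1 = (comul H @^-1: (tensv fullv (F n) + tensv (F 0%N) fullv))%VS.

Definition is_graded_hopf (G : nat -> {vspace H}) : Prop :=
  [/\ is_graded_algebra G,
      forall n, (comul H @: G n <= \sum_(i < n.+1) tensv (G i) (G (n - i)%N))%VS,
      forall n, (0 < n)%N -> (G n <= lker (counit H))%VS
    & forall n, (antipode H @: G n <= G n)%VS].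

Definition is_coradically_graded (G : nat -> {vspace H}) : Prop :=
  is_graded_hopf G /\
  is_coradical_filtration (fun n => \sum_(i < n.+1) G i)%VS.

Definition grouplike (g : H) : Prop := g != 0 /\ comul H g = g \ot g.

(* The subspace K is a Hopf subalgebra which is the Kac-Paljutkin algebra.  The
   relations allow one to write every element of the algebra generated by
   x, y, z as a combination of the eight words x^a y^b z^c with a, b, c < 2, so
   together with \dim K = 8 they are a presentation of K. *)
Definition is_kac_paljutkin (K : {vspace H}) : Prop :=
  exists x y z : H,
    [/\ (K = <<1 & [:: x; y; z]>>)%VS /\ \dim K = 8%N,
        [/\ x ^+ 2 = 1, y ^+ 2 = 1 & x * y = y * x],
        [/\ y * z = z * x, x * z = z * y
          & z ^+ 2 = 2%:R^-1 *: (1 + x + y - x * y)],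
        [/\ grouplike x, grouplike y
          & comul H z = 2%:R^-1 *: (((1 + y) * z) \ot z
                                    + ((1 - y) * z) \ot (x * z))]
      & counit H z = 1 /\ antipode H z = z].

Record comodAlgebra := ComodAlgebra {
  comod_sort :> falgType k;
  coact : 'Hom(comod_sort, tensor H comod_sort);
  coact_coassoc : forall b,
    tassoc _ _ _ (tmap (comul H) \1%VF (coact b)) = tmap \1%VF coact (coact b);
  coact_counit : forall b,
    tlift (fun h b => (counit H h : k) *: b) (coact b) = b;
  coact_one : coact 1 = 1 \ot 1;
  coact_mul : forall a b, coact (a * b) = tmul (coact a) (coact b)
}.

Definition regular_comodAlgebra : comodAlgebra :=
  ComodAlgebra (@comul_coassoc H) (@counit_left H) (@comul_one H) (@comul_mul H).

Definition coinvariants (B : comodAlgebra) : {vspace B} :=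
  lker (coact B - linfun (fun b => 1 \ot b)).

Lemma coinvariantsP (B : comodAlgebra) (b : B) :
  reflect (coact B b = 1 \ot b) (b \in coinvariants B).
Proof.
pose f (b : B) : tensor H B := 1 \ot b.
have fL : linear f by move=> a u v; apply: tpureDr.
pose g : {linear B -> tensor H B} :=
  HB.pack f (GRing.isLinear.Build k B (tensor H B) _ f fL).
rewrite memv_ker add_lfunE opp_lfunE (lfunE g) subr_eq0; exact: eqP.
Qed.

Definition AM_exact (B : comodAlgebra) : Prop :=
  \dim (coinvariants B) = 1%N /\
  forall J : {vspace B},
    (J * fullv <= J)%VS -> (coact B @: J <= tensv fullv J)%VS ->
    J = 0%VS \/ J = fullv.

(* G is the grading of H; the coradical filtration is H_n = G 0 + ... + G n. *)
Definition is_loewy_graded (G : nat -> {vspace H}) (B : comodAlgebra)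
    (GB : nat -> {vspace B}) : Prop :=
  [/\ is_graded_algebra GB,
      forall n, (coact B @^-1: tensv (\sum_(i < n.+1) G i) fullv)%VS
                = (\sum_(i < n.+1) GB i)%VS
    & forall n, (coact B @: GB n
                 <= \sum_(i < n.+1) tensv (G i) (GB (n - i)%N))%VS].

(* An {aspace H} may have a unit other than 1, so 1 \in A is required. *)
Definition left_coideal_subalgebra (A : {aspace H}) : Prop :=
  1 \in A /\ (comul H @: A <= tensv fullv A)%VS.

Definition is_homogeneous (G : nat -> {vspace H}) (A : {vspace H}) : Prop :=
  is_direct_decomposition (fun n => A :&: G n)%VS A.

Section CoidealComodAlgebra.
Variables (A : {aspace H}) (Acoideal : left_coideal_subalgebra A).

(* The corestriction of the comultiplication to A -> H (x) A. *)
Definition coideal_coact : 'Hom(subvs_of A, tensor H (subvs_of A)) :=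
  (tmap \1%VF (linfun (vsproj A)) \o comul H \o linfun vsval)%VF.

Let incl : 'Hom(tensor H (subvs_of A), tensor H H) := tmap \1%VF (linfun vsval).
Let proj : 'Hom(tensor H H, tensor H (subvs_of A)) :=
  tmap \1%VF (linfun (vsproj A)).

Lemma proj_incl : (proj \o incl)%VF = \1%VF.
Proof.
apply: tensor_ext=> u v; rewrite comp_lfunE !tmapE !id_lfunE !lfunE /=.
by rewrite vsvalK.
Qed.

Lemma incl_inj : injective incl.
Proof. by apply: (can_inj (g := proj)) => t; rewrite -comp_lfunE proj_incl lfunE. Qed.

Lemma coideal_coactE a : incl (coideal_coact a) = comul H (vsval a).
Proof.
rewrite /coideal_coact !comp_lfunE [linfun vsval a]lfunE /= -/proj.
have: comul H (vsval a) \in tensv fullv A.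
  by apply: (subvP Acoideal.2); apply/memv_img/subvsP.
have eqon : (tensv fullv A <= lker ((incl \o proj)%VF - \1%VF))%VS.
  apply: tensv_subP=> u v _ vA; rewrite memv_ker add_lfunE opp_lfunE comp_lfunE.
  by rewrite id_lfunE subr_eq0 !tmapE !id_lfunE !lfunE /= vsprojK.
move/(subvP eqon); rewrite memv_ker add_lfunE opp_lfunE comp_lfunE id_lfunE.
by rewrite subr_eq0 => /eqP.
Qed.

Lemma vsval_one : vsval (1 : subvs_of A) = 1.
Proof. by apply/eqP; rewrite /= algid_eq1 Acoideal.1. Qed.

Lemma coideal_coassoc a :
  tassoc _ _ _ (tmap (comul H) \1%VF (coideal_coact a))
  = tmap \1%VF coideal_coact (coideal_coact a).
Proof.
apply: (can_inj (f := tmap \1%VF incl) (g := tmap \1%VF proj)) => [t|].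
  by rewrite tmap_comp proj_incl [(_ \o _)%VF]comp_lfun1l tmap_id.
rewrite -tassoc_nat !tmap_comp.
have -> : (tmap \1%VF \1%VF \o comul H)%VF = (comul H \o \1%VF)%VF.
  by apply/lfunP=> h; rewrite !comp_lfunE tmap_id id_lfunE.
have -> : (incl \o coideal_coact)%VF = (comul H \o linfun vsval)%VF.
  by apply/lfunP=> c; rewrite [LHS]comp_lfunE coideal_coactE comp_lfunE lfunE.
have -> : (linfun vsval \o \1)%VF = (\1 \o linfun vsval)%VF :> 'Hom(subvs_of A, H).
  by rewrite comp_lfun1l comp_lfun1r.
by rewrite -!tmap_comp coideal_coactE comul_coassoc.
Qed.

Lemma coideal_counit a :
  tlift (fun h b => (counit H h : k) *: b) (coideal_coact a) = a.
Proof.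
apply: val_inj; rewrite /= -[RHS]counit_left -coideal_coactE tlift_tmap; last first.
  split=> u c x y /=; first by rewrite linearP scalerDl scalerA.
  by rewrite scalerDr !scalerA mulrC.
rewrite -[vsval _](lfunE vsval) comp_tlift; apply: eq_tlift=> u v.
by rewrite id_lfunE linearZ.
Qed.

Lemma coideal_one : coideal_coact 1 = 1 \ot 1.
Proof.
apply: incl_inj; rewrite coideal_coactE tmapE id_lfunE.
rewrite [linfun _ _]lfunE vsval_one comul_one.
by congr (_ \ot _); apply/esym/vsval_one.
Qed.

Lemma coideal_mul a b :
  coideal_coact (a * b) = tmul (coideal_coact a) (coideal_coact b).
Proof.
apply: incl_inj; rewrite tmap_tmul; first by rewrite !coideal_coactE comul_mul.
  by move=> x y; rewrite !id_lfunE.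
by move=> x y; rewrite !lfunE.
Qed.

Definition coideal_comodAlgebra : comodAlgebra :=
  ComodAlgebra coideal_coassoc coideal_counit coideal_one coideal_mul.

End CoidealComodAlgebra.

End HopfAlgebras.

Section Modules.
Variables (k : fieldType) (A : falgType k).

Record fdmodule := FdModule {
  fdmod_sort :> vectType k;
  act : 'Hom(A, 'End(fdmod_sort));
  act_one : act 1 = \1%VF;
  act_mul : forall a b, act (a * b) = (act a \o act b)%VF
}.

Record modhom (M N : fdmodule) := ModHom {
  modhom_val :> 'Hom(M, N);
  modhom_comm : forall a m, modhom_val (act M a m) = act N a (modhom_val m)
}.

Lemma modhom_inj (M N : fdmodule) (f g : modhom M N) :
  (f : 'Hom(M, N)) = g -> f = g.
Proof.
case: f g => [f fP] [g gP] /= fg; case: g / fg gP => gP; congr ModHom.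
apply: functional_extensionality_dep=> a.
by apply: functional_extensionality_dep=> m; apply: eq_irrelevance.
Qed.

Lemma modhom_id_subproof (M : fdmodule) a m :
  (\1%VF : 'End(M)) (act M a m) = act M a ((\1%VF : 'End(M)) m).
Proof. by rewrite !id_lfunE. Qed.

Definition modhom_id M : modhom M M := ModHom (@modhom_id_subproof M).

Lemma modhom_comp_subproof (M N P : fdmodule) (g : modhom N P) (f : modhom M N)
    a m : (g \o f)%VF (act M a m) = act P a ((g \o f)%VF m).
Proof. by rewrite !comp_lfunE !modhom_comm. Qed.

Definition modhom_comp M N P (g : modhom N P) (f : modhom M N) : modhom M P :=
  ModHom (modhom_comp_subproof g f).

Lemma modhom_lin_subproof (M N : fdmodule) c (f g : modhom M N) a m :
  (c *: (f : 'Hom(M, N)) + g) (act M a m)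
  = act N a ((c *: (f : 'Hom(M, N)) + g) m).
Proof. by rewrite !add_lfunE !scale_lfunE !modhom_comm linearP. Qed.

Definition modhom_lin M N c (f g : modhom M N) : modhom M N :=
  ModHom (modhom_lin_subproof c f g).

Definition modhom_isiso M N (f : modhom M N) : Prop :=
  exists g : modhom N M,
    modhom_comp g f = modhom_id M /\ modhom_comp f g = modhom_id N.

End Modules.

Section Functors.
Variable k : fieldType.
Implicit Types A B C : falgType k.

Record linear_functor A B := LinearFunctor {
  fobj :> fdmodule A -> fdmodule B;
  fmap : forall M N, modhom M N -> modhom (fobj M) (fobj N);
  fmap_id : forall M, fmap (modhom_id M) = modhom_id (fobj M);
  fmap_comp : forall M N P (g : modhom N P) (f : modhom M N),
    fmap (modhom_comp g f) = modhom_comp (fmap g) (fmap f);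
  fmap_lin : forall M N c (f g : modhom M N),
    fmap (modhom_lin c f g) = modhom_lin c (fmap f) (fmap g)
}.

Definition functor_id A : linear_functor A A :=
  @LinearFunctor A A (fun M => M) (fun M N f => f)
    (fun M => erefl) (fun M N P g f => erefl) (fun M N c f g => erefl).

Section Comp.
Variables (A B C : falgType k).
Variables (G : linear_functor B C) (F : linear_functor A B).

Let gf M N (f : modhom M N) : modhom (G (F M)) (G (F N)) := fmap G (fmap F f).

Lemma functor_comp_id M : gf (modhom_id M) = modhom_id (G (F M)).
Proof. by rewrite /gf !fmap_id. Qed.

Lemma functor_comp_comp M N P (g : modhom N P) (f : modhom M N) :
  gf (modhom_comp g f) = modhom_comp (gf g) (gf f).
Proof. by rewrite /gf !fmap_comp. Qed.

Lemma functor_comp_lin M N c (f g : modhom M N) :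
  gf (modhom_lin c f g) = modhom_lin c (gf f) (gf g).
Proof. by rewrite /gf !fmap_lin. Qed.

Definition functor_comp : linear_functor A C :=
  LinearFunctor functor_comp_id functor_comp_comp functor_comp_lin.
End Comp.

Definition naturally_isomorphic A B (F G : linear_functor A B) : Prop :=
  exists eta : forall M, modhom (F M) (G M),
    (forall M N (f : modhom M N),
       modhom_comp (eta N) (fmap F f) = modhom_comp (fmap G f) (eta M)) /\
    (forall M, modhom_isiso (eta M)).

Definition is_equivalence A B (F : linear_functor A B) : Prop :=
  exists G : linear_functor B A,
    naturally_isomorphic (functor_comp G F) (functor_id A) /\
    naturally_isomorphic (functor_comp F G) (functor_id B).

End Functors.

Section ModuleCategories.
Variables (k : fieldType) (H : hopfAlgebra k).

Section Tensor.
Variable B : comodAlgebra H.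
Variables (X : fdmodule H) (M : fdmodule B).

(* b acts on X (x) M as the sum of the b_(-1) (x) b_(0) *)
Definition tensor_act : 'Hom(B, 'End(tensor X M)) :=
  (tend (act X) (act M) \o coact B)%VF.

Lemma tend_mul s t :
  tend (act X) (act M) (tmul s t)
  = (tend (act X) (act M) s \o tend (act X) (act M) t)%VF.
Proof.
elim/tensor_ind: s => [h b|c s s' IHs IHs']; last first.
  rewrite (tmul_bilin H B).1 !linearP /= IHs IHs'.
  by rewrite comp_lfunDl comp_lfunZl.
elim/tensor_ind: t => [h' b'|c t t' IHt IHt']; last first.
  rewrite (tmul_bilin H B).2 !linearP /= IHt IHt'.
  by rewrite comp_lfunDr comp_lfunZr.
rewrite tmulE !tendE !act_mul; apply/lfunP=> t.
by rewrite comp_lfunE tmap_comp.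
Qed.

Lemma tensor_act_one : tensor_act 1 = \1%VF.
Proof.
rewrite /tensor_act comp_lfunE coact_one tendE !act_one.
by apply/lfunP=> t; rewrite tmap_id id_lfunE.
Qed.

Lemma tensor_act_mul a b : tensor_act (a * b) = (tensor_act a \o tensor_act b)%VF.
Proof. by rewrite /tensor_act !comp_lfunE coact_mul tend_mul. Qed.

Definition tensor_module : fdmodule B :=
  FdModule tensor_act_one tensor_act_mul.

End Tensor.

(* The tensor product of the category of H-modules is the action of H-modules on
   modules over the regular comodule algebra, whose underlying algebra is H. *)
Definition tensor_Hmodule (X Y : fdmodule H) : fdmodule H :=
  @tensor_module (regular_comodAlgebra H) X Y.

Definition unit_act : 'Hom(H, 'End(k^o)) :=
  linfun (fun h => (counit H h : k) *: (\1%VF : 'End(k^o))).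

Lemma unit_actE h : unit_act h = (counit H h : k) *: \1%VF.
Proof.
pose f h : 'End(k^o) := (counit H h : k) *: \1%VF.
have fL : linear f by move=> a u v; rewrite /f linearP scalerDl scalerA.
pose g : {linear H -> 'End(k^o)} :=
  HB.pack f (GRing.isLinear.Build k H 'End(k^o) _ f fL).
exact: (lfunE g).
Qed.

Lemma unit_act_one : unit_act 1 = \1%VF.
Proof. by rewrite unit_actE counit_one scale1r. Qed.

Lemma unit_act_mul g h : unit_act (g * h) = (unit_act g \o unit_act h)%VF.
Proof.
rewrite !unit_actE counit_mul -comp_lfunZl -comp_lfunZr comp_lfun1l scalerA.
by [].
Qed.

Definition unit_module : fdmodule H := FdModule unit_act_one unit_act_mul.

Section Structure.
Variable B : comodAlgebra H.
Implicit Types (X Y : fdmodule H) (M N : fdmodule B).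

Lemma tensor_hom_subproof X Y M N (f : modhom X Y) (g : modhom M N) a t :
  tmap f g (act (tensor_module X M) a t)
  = act (tensor_module Y N) a (tmap f g t).
Proof.
rewrite /= /tensor_act !comp_lfunE.
elim/tensor_ind: (coact B a) => [h b|c s s' IHs IHs'].
  rewrite !tendE !tmap_comp; congr (tmap _ _ t).
    by apply/lfunP=> x; rewrite !comp_lfunE modhom_comm.
  by apply/lfunP=> x; rewrite !comp_lfunE modhom_comm.
by rewrite !linearP /= !add_lfunE !scale_lfunE linearP /= IHs IHs'.
Qed.

Definition tensor_hom X Y M N (f : modhom X Y) (g : modhom M N) :
    modhom (tensor_module X M) (tensor_module Y N) :=
  @ModHom _ _ (tensor_module X M) (tensor_module Y N) _
    (tensor_hom_subproof f g).

Lemma assoc_hom_subproof X Y M a t :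
  tassoc X Y M (act (tensor_module (tensor_Hmodule X Y) M) a t)
  = act (tensor_module X (tensor_module Y M)) a (tassoc X Y M t).
Proof.
rewrite /= /tensor_act !comp_lfunE.
have -> : tend (act X) (tend (act Y) (act M) \o coact B)%VF (coact B a)
    = tend (act X) (tend (act Y) (act M))
        (tassoc _ _ _ (tmap (comul H) \1%VF (coact B a))).
  by rewrite coact_coassoc tend_tmap comp_lfun1r.
by rewrite -tend_assoc tend_tmap comp_lfun1r.
Qed.

Definition assoc_hom X Y M :
    modhom (tensor_module (tensor_Hmodule X Y) M)
           (tensor_module X (tensor_module Y M)) :=
  @ModHom _ _ (tensor_module (tensor_Hmodule X Y) M)
    (tensor_module X (tensor_module Y M)) _ (@assoc_hom_subproof X Y M).

Definition unit_map M : 'Hom(tensor k^o M, M) :=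
  tlift (fun (c : k^o) m => (c : k) *: m).

Lemma unit_mapE M c m : unit_map M (c \ot m) = (c : k) *: m.
Proof.
rewrite tliftE //; split=> u a x y /=; first by rewrite scalerDl scalerA.
by rewrite scalerDr !scalerA mulrC.
Qed.

Lemma unit_hom_subproof M a t :
  unit_map M (act (tensor_module unit_module M) a t) = act M a (unit_map M t).
Proof.
rewrite /= /tensor_act comp_lfunE.
have {2}-> : a = tlift (fun h b => (counit H h : k) *: b) (coact B a).
  by rewrite coact_counit.
elim/tensor_ind: (coact B a) => [h b|c s s' IHs IHs']; last first.
  by rewrite !linearP /= !add_lfunE !scale_lfunE linearP /= IHs IHs'.
rewrite tendE tliftE; last first.
  split=> u c x y /=; first by rewrite linearP scalerDl scalerA.
  by rewrite scalerDr !scalerA mulrC.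
elim/tensor_ind: t => [c m|c s s' IHs IHs']; last by rewrite !linearP /= IHs IHs'.
rewrite tmapE !unit_mapE unit_actE.
by rewrite scale_lfunE id_lfunE !linearZ /= scale_lfunE scalerA mulrC.
Qed.

Definition unit_hom M : modhom (tensor_module unit_module M) M :=
  @ModHom _ _ (tensor_module unit_module M) M _ (@unit_hom_subproof M).

End Structure.

Section ModuleFunctors.
Variables A B : comodAlgebra H.

(* s makes the functor F a module functor: a natural isomorphism
   F(X (x) M) -> X (x) F(M) satisfying the pentagon and triangle axioms. *)
Definition is_module_functor (F : linear_functor A B)
    (s : forall (X : fdmodule H) (M : fdmodule A),
       modhom (F (tensor_module X M)) (tensor_module X (F M))) : Prop :=
  [/\ forall X Y M N (f : modhom X Y) (g : modhom M N),
        modhom_comp (s Y N) (fmap F (tensor_hom f g))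
        = modhom_comp (tensor_hom f (fmap F g)) (s X M),
      forall X M, modhom_isiso (s X M),
      forall X Y M,
        modhom_comp (tensor_hom (modhom_id X) (s Y M))
          (modhom_comp (s X (tensor_module Y M)) (fmap F (assoc_hom X Y M)))
        = modhom_comp (assoc_hom X Y (F M)) (s (tensor_Hmodule X Y) M)
    & forall M,
        modhom_comp (unit_hom (F M)) (s unit_module M) = fmap F (unit_hom M)].

Definition module_equivalent : Prop :=
  exists (F : linear_functor A B)
         (s : forall X M, modhom (F (tensor_module X M)) (tensor_module X (F M))),
    is_module_functor s /\ is_equivalence F.

End ModuleFunctors.

End ModuleCategories.

(* Main.v *)
(* Since H(0) = KP, the subalgebra B(0) is a KP-comodule algebra, again simple
   with scalar coinvariants.  Decompose it under the four group-likes
   1, x, y, xy of KP and the 2-dimensional comodule V.  Right multiplication by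
   the group-like components of B acts irreducibly on the multiplicity space of
   V, and comparing it with left multiplication leaves two possibilities: either
   B(0) has a one-dimensional module, spanned by a vector Om of B(0), or
   B(0) = End(V) is spanned by 1, X, Y, XY with X^2 = Y^2 = 1 and YX = -XY.
   In the first case put e = 1, in the second let e be the rank one idempotent
   (1 + Y)/2.  As B(0) e is a comodule (trivial, resp. V), the category of
   B-modules is equivalent, through M |-> eM, to the modules over eBe equipped
   with the coaction b |-> S coact(b) T twisted by an element T of H (x) Be
   and its inverse S.  Composing the twisted coaction with the character
   eBe -> eB(0)e -> k gives a graded comodule algebra map eBe -> H; it is
   injective because its kernel generates a proper costable ideal of B, and its
   image is the coideal subalgebra A. *)
From HB Require Import structures.
Require Import Defs.
From mathcomp Require Import all_boot all_algebra falgebra ring.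
From Stdlib Require Import Classical.

Set Implicit Arguments.
Unset Strict Implicit.
Unset Printing Implicit Defensive.

Import GRing.Theory.
Local Open Scope ring_scope.

(** * Linear maps and tensor products *)

(** A left coideal subalgebra has a character, the restricted counit, and conversely a character of
    a comodule algebra gives a comodule algebra map to [H]; the question is where a character comes
    from. If B(0) is a 2 x 2 matrix algebra there is none, which is why a corner [e B e] is needed.
    Its idempotent is not coinvariant, so the coaction of [B] does not restrict to the corner.
    Instead [T] makes [B e] an equivariant [B]-module, with coaction sending [b e] to [coact(b) T],
    and conjugation gives its endomorphism algebra [e B e] (up to opposite) a coaction. The analysis
    of B(0) rests on signs. For a copy [w, w'] of V, a component of degree [x] changes the sign of
    [w'] when multiplied on the right and swaps [w] and [w'] when multiplied on the left; for [y]
    the roles are exchanged. Left and right multiplication by the same component therefore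
    anticommute, which restricts the components that can coexist with V. Positive degrees enter only
    through the projection onto B(0): being an algebra map, it carries identities of [B] into B(0)
    and extends a character by zero. *)

Lemma linfun_linearE (k : fieldType) (U V : vectType k) (f : U -> V) :
  linear f -> linfun f =1 f.
Proof.
move=> fL; pose g : {linear U -> V} :=
  HB.pack f (GRing.isLinear.Build k U V _ f fL).
exact: (lfunE g).
Qed.

Lemma lfun_combE (k : fieldType) (U V : vectType k) (f : 'Hom(U, V)) c u v :
  f (c *: u + v) = c *: f u + f v.
Proof. exact: linearP. Qed.

Lemma lfun_addE (k : fieldType) (U V : vectType k) (f : 'Hom(U, V)) u v :
  f (u + v) = f u + f v.
Proof. exact: linearD. Qed.

Lemma lfun_scaleE (k : fieldType) (U V : vectType k) (f : 'Hom(U, V)) c u :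
  f (c *: u) = c *: f u.
Proof. exact: linearZ. Qed.

Lemma lfun_oppE (k : fieldType) (U V : vectType k) (f : 'Hom(U, V)) u :
  f (- u) = - f u.
Proof. exact: linearN. Qed.

Definition lfun_linE := (lfun_addE, lfun_scaleE, lfun_oppE).

Lemma lfun_sumE (k : fieldType) (U V : vectType k) (f : 'Hom(U, V)) (I : Type)
    (q : seq I) (P : pred I) (u : I -> U) :
  f (\sum_(i <- q | P i) u i) = \sum_(i <- q | P i) f (u i).
Proof. exact: linear_sum. Qed.

Section TensorProductAlgebra.
Variables (k : fieldType) (A B : falgType k).
Implicit Types s t u : tensor A B.

Lemma tmulDl c s t u : tmul (c *: s + t) u = c *: tmul s u + tmul t u.
Proof. exact: (tmul_bilin A B).1. Qed.

Lemma tmulDr c s t u : tmul u (c *: s + t) = c *: tmul u s + tmul u t.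
Proof. exact: (tmul_bilin A B).2. Qed.

Lemma tmul_addl s t u : tmul (s + t) u = tmul s u + tmul t u.
Proof. by rewrite -{1}[s]scale1r tmulDl scale1r. Qed.

Lemma tmul_addr s t u : tmul u (s + t) = tmul u s + tmul u t.
Proof. by rewrite -{1}[s]scale1r tmulDr scale1r. Qed.

Lemma tmul_linear_l u : linear (fun s => tmul s u).
Proof. by move=> c s t; exact: tmulDl. Qed.

Lemma tmul_linear_r u : linear (tmul u).
Proof. by move=> c s t; exact: tmulDr. Qed.

Lemma tmulNl s u : tmul (- s) u = - tmul s u.
Proof. by have L := linfun_linearE (tmul_linear_l u); rewrite -!L linearN. Qed.

Lemma tmulNr s u : tmul u (- s) = - tmul u s.
Proof. by have L := linfun_linearE (tmul_linear_r u); rewrite -!L linearN. Qed.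

Lemma tmulZl c s u : tmul (c *: s) u = c *: tmul s u.
Proof. by have L := linfun_linearE (tmul_linear_l u); rewrite -!L linearZ. Qed.

Lemma tmulZr c s u : tmul u (c *: s) = c *: tmul u s.
Proof. by have L := linfun_linearE (tmul_linear_r u); rewrite -!L linearZ. Qed.

Lemma tmul0l u : tmul 0 u = 0.
Proof. by have L := linfun_linearE (tmul_linear_l u); rewrite -[LHS]L linear0. Qed.

Lemma tmul0r u : tmul u 0 = 0.
Proof. by have L := linfun_linearE (tmul_linear_r u); rewrite -[LHS]L linear0. Qed.

Lemma tmulA s t u : tmul s (tmul t u) = tmul (tmul s t) u.
Proof.
elim/tensor_ind: s => [a b|c s s' IHs IHs']; last by rewrite !tmulDl IHs IHs'.
elim/tensor_ind: t => [a' b'|c t t' IHt IHt']; last first.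
  by rewrite tmulDl !tmulDr IHt IHt' tmulDl.
elim/tensor_ind: u => [a'' b''|c u u' IHu IHu']; last first.
  by rewrite !tmulDr IHu IHu'.
by rewrite !tmulE !mulrA.
Qed.

Lemma tmul1l t : tmul (1 \ot 1) t = t.
Proof.
by elim/tensor_ind: t => [a b|c s t IHs IHt];
  rewrite ?tmulE ?mul1r // tmulDr IHs IHt.
Qed.

Lemma tmul1r t : tmul t (1 \ot 1) = t.
Proof.
by elim/tensor_ind: t => [a b|c s t IHs IHt];
  rewrite ?tmulE ?mulr1 // tmulDl IHs IHt.
Qed.

End TensorProductAlgebra.

Definition tmul_expandE :=
  (tmul_addl, tmul_addr, tmulNl, tmulNr, tmulZl, tmulZr, tmulE).

Section ModuleHomomorphisms.
Variables (k : fieldType) (C : falgType k).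
Implicit Types M N P : fdmodule C.

Lemma modhom_eq M N (f g : modhom M N) : (forall m, f m = g m) -> f = g.
Proof. by move=> fg; apply/modhom_inj/lfunP. Qed.

Lemma modhom_idE M m : modhom_id M m = m.
Proof. exact: id_lfunE. Qed.

Lemma modhom_compE M N P (g : modhom N P) (f : modhom M N) m :
  modhom_comp g f m = g (f m).
Proof. exact: comp_lfunE. Qed.

Lemma modhom_linE M N c (f g : modhom M N) m :
  modhom_lin c f g m = c *: f m + g m.
Proof. by rewrite add_lfunE scale_lfunE. Qed.

Lemma act_mulE M a b m : act M (a * b) m = act M a (act M b m).
Proof. by rewrite act_mul comp_lfunE. Qed.

Lemma act_oneE M m : act M 1 m = m.
Proof. by rewrite act_one id_lfunE. Qed.

Lemma modhom_isiso_can M N (f : modhom M N) (g : 'Hom(N, M)) :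
  cancel f g -> cancel g f -> modhom_isiso f.
Proof.
move=> fK gK; have gP a m : g (act N a m) = act M a (g m).
  by rewrite -{1}[m]gK -modhom_comm fK.
by exists (ModHom gP); split; apply: modhom_eq=> m;
  rewrite modhom_compE modhom_idE /= ?fK ?gK.
Qed.

End ModuleHomomorphisms.

Section TensorActions.
Variables (k : fieldType) (H : hopfAlgebra k) (B : comodAlgebra H).
Variables (X : fdmodule H) (M : fdmodule B).

Lemma tensor_moduleE a t :
  act (tensor_module X M) a t = tend (act X) (act M) (coact B a) t.
Proof. by rewrite /= comp_lfunE. Qed.

Lemma tend_mulE s t u :
  tend (act X) (act M) (tmul s t) u
  = tend (act X) (act M) s (tend (act X) (act M) t u).
Proof. by rewrite tend_mul comp_lfunE. Qed.

Lemma tend_id_r b t :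
  tend (act X) (act M) (1 \ot b) t = tmap \1%VF (act M b) t.
Proof. by rewrite tendE act_one. Qed.

End TensorActions.

(** * Equivalence with a twisted corner *)

(* A is the corner eBe through psi, with the coaction of B conjugated by S and
   T; the units r i, l j identify B with the n x n matrices over eBe.  The
   functor M |-> eM is a module functor because S maps e(X (x) M) to X (x) eM,
   with inverse T. *)
Section ModuleEquivalence.
Variables (k : fieldType) (H : hopfAlgebra k) (A B : comodAlgebra H).
Variables (e : B) (S T : tensor H B) (psi : 'Hom(A, B)) (kap : 'Hom(B, A)).
Variables (n : nat) (r l : 'I_n -> B).

Hypothesis psi_mul : {morph psi : a b / a * b}.
Hypothesis psi_one : psi 1 = e.
Hypothesis psiK : cancel psi kap.
Hypothesis kapK : forall b, psi (kap b) = e * b * e.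
Hypothesis re : forall i, r i * e = r i.
Hypothesis el : forall i, e * l i = l i.
Hypothesis lr : forall i j, l i * r j = (i == j)%:R *: e.
Hypothesis rl : \sum_i r i * l i = 1.
Hypothesis ST : tmul S T = 1 \ot e.
Hypothesis TS : tmul T S = coact B e.
Hypothesis eS : tmul (1 \ot e) S = S.
Hypothesis psi_coact : forall a,
  tmul (tmul S (coact B (psi a))) T = tmap \1%VF psi (coact A a).
Hypothesis S_cocycle :
  tassoc _ _ _ (tmap (comul H) \1%VF S)
  = tmap \1%VF (linfun (fun b => tmul S (coact B b))) S.
Hypothesis S_counit : tlift (fun h b => (counit H h : k) *: b) S = e.

Lemma corner_idem : e * e = e.
Proof. by rewrite -psi_one -psi_mul mulr1. Qed.

Lemma corner_psi a : e * psi a * e = psi a.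
Proof. by rewrite -psi_one -!psi_mul mulr1 mul1r. Qed.

Lemma kap_corner b : kap (e * b * e) = kap b.
Proof. by rewrite -kapK psiK. Qed.

(** [kap] compresses [b] to the corner element [e b e], so it is multiplicative only across an
    inserted [e]. *)
Lemma kap_mul b c : kap (b * e * c) = kap b * kap c.
Proof.
apply: (can_inj psiK); rewrite psi_mul !kapK !mulrA.
by rewrite -[e * b * e * e]mulrA corner_idem.
Qed.

Lemma kap_id : kap e = 1.
Proof. by rewrite -psi_one psiK. Qed.

Lemma kap_one : kap 1 = 1.
Proof. by rewrite -kap_corner mulr1 corner_idem kap_id. Qed.

Section CornerObject.
Variable M : fdmodule B.

(** eM is handled as a retract of M: [corner_incl] has the left inverse [corner_proj], so identities
    in eM are checked in M. *)
Definition corner_space : vectType k := subvs_of (limg (act M e)).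
Definition corner_incl : 'Hom(corner_space, M) := linfun vsval.
Definition corner_proj : 'Hom(M, corner_space) :=
  (linfun (vsproj (limg (act M e))) \o act M e)%VF.

Lemma corner_projK m : corner_incl (corner_proj m) = act M e m.
Proof. by rewrite comp_lfunE !lfunE /= vsprojK // memv_img ?memvf. Qed.

Lemma act_corner_incl v : act M e (corner_incl v) = corner_incl v.
Proof.
rewrite lfunE /=; have /memv_imgP[m _ ->] := subvsP v.
by rewrite -comp_lfunE -act_mul corner_idem.
Qed.

Lemma corner_inclK : cancel corner_incl corner_proj.
Proof.
by move=> v; apply: val_inj; have := act_corner_incl v; rewrite -corner_projK !lfunE.
Qed.

Definition corner_act_fun a : 'End(corner_space) :=
  (corner_proj \o act M (psi a) \o corner_incl)%VF.

Lemma corner_act_linear : linear corner_act_fun.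
Proof.
by move=> c a b; rewrite /corner_act_fun !linearP comp_lfunDr -comp_lfunZr
  comp_lfunDl -comp_lfunZl.
Qed.

Definition corner_act : 'Hom(A, 'End(corner_space)) := linfun corner_act_fun.

Lemma corner_actE a v :
  corner_incl (corner_act a v) = act M (psi a) (corner_incl v).
Proof.
rewrite /corner_act (linfun_linearE corner_act_linear) 2!comp_lfunE corner_projK.
by rewrite -comp_lfunE -act_mul -[psi a]corner_psi !mulrA corner_idem.
Qed.

Lemma corner_act_one : corner_act 1 = \1%VF.
Proof.
apply/lfunP=> v; apply: (can_inj corner_inclK).
by rewrite corner_actE psi_one act_corner_incl id_lfunE.
Qed.

Lemma corner_act_mul a b : corner_act (a * b) = (corner_act a \o corner_act b)%VF.
Proof.
apply/lfunP=> v; apply: (can_inj corner_inclK).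
by rewrite comp_lfunE !corner_actE psi_mul act_mul comp_lfunE.
Qed.

Definition corner_module : fdmodule A := FdModule corner_act_one corner_act_mul.

Lemma corner_moduleE a (v : corner_module) :
  corner_incl (act corner_module a v) = act M (psi a) (corner_incl v).
Proof. exact: corner_actE. Qed.

End CornerObject.

Lemma corner_hom_subproof M N (f : modhom M N) a v :
  (corner_proj N \o f \o corner_incl M)%VF (act (corner_module M) a v)
  = act (corner_module N) a ((corner_proj N \o f \o corner_incl M)%VF v).
Proof.
apply: (can_inj (@corner_inclK N)).
rewrite corner_actE 4!comp_lfunE !corner_projK corner_actE -!modhom_comm.
by rewrite -[act M _ (act M _ _)]comp_lfunE -act_mul act_corner_incl
           -[e * psi a]mulr1 -corner_psi !mulrA corner_idem mulr1.
Qed.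

Definition corner_hom M N (f : modhom M N) :
    modhom (corner_module M) (corner_module N) :=
  @ModHom _ _ (corner_module M) (corner_module N) _ (corner_hom_subproof f).

Lemma corner_homE M N (f : modhom M N) v :
  corner_incl N (corner_hom f v) = f (corner_incl M v).
Proof.
by rewrite /= 2!comp_lfunE corner_projK -modhom_comm act_corner_incl.
Qed.

Lemma corner_hom_id M : corner_hom (modhom_id M) = modhom_id (corner_module M).
Proof.
apply: modhom_eq=> v; apply: (can_inj (@corner_inclK M)).
by rewrite corner_homE !modhom_idE.
Qed.

Lemma corner_hom_comp M N P (g : modhom N P) (f : modhom M N) :
  corner_hom (modhom_comp g f) = modhom_comp (corner_hom g) (corner_hom f).
Proof.
apply: modhom_eq=> v; apply: (can_inj (@corner_inclK P)).
by rewrite modhom_compE !corner_homE modhom_compE.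
Qed.

Lemma corner_hom_lin M N c (f g : modhom M N) :
  corner_hom (modhom_lin c f g) = modhom_lin c (corner_hom f) (corner_hom g).
Proof.
apply: modhom_eq=> v; apply: (can_inj (@corner_inclK N)).
by rewrite modhom_linE lfun_combE !corner_homE modhom_linE.
Qed.

Definition corner_functor : linear_functor B A :=
  LinearFunctor corner_hom_id corner_hom_comp corner_hom_lin.

Section CornerTensor.
Variables (X : fdmodule H) (M : fdmodule B).

Definition corner_incl_r : 'Hom(tensor X (corner_space M), tensor X M) :=
  tmap \1%VF (corner_incl M).

Lemma corner_incl_r_inj : injective corner_incl_r.
Proof.
apply: (can_inj (g := tmap \1%VF (corner_proj M))) => t.
have -> : corner_incl_r = tmap \1%VF (corner_incl M) by [].
rewrite tmap_comp comp_lfun1l; have -> : (corner_proj M \o corner_incl M)%VF = \1%VF.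
  by apply/lfunP=> v; rewrite comp_lfunE corner_inclK id_lfunE.
exact: tmap_id.
Qed.

Lemma tend_corner_act q t :
  corner_incl_r (tend (act X) (act (corner_module M)) q t)
  = tend (act X) (act M) (tmap \1%VF psi q) (corner_incl_r t).
Proof.
elim/tensor_ind: q => [h a|c q q' IHq IHq']; last first.
  by rewrite !lfun_combE !add_lfunE !scale_lfunE lfun_combE IHq IHq'.
rewrite tmapE !tendE id_lfunE.
elim/tensor_ind: t => [x v|c t t' IHt IHt']; last by rewrite !lfun_combE IHt IHt'.
by rewrite /corner_incl_r !tmapE !id_lfunE /= corner_actE.
Qed.

Definition corner_tensor_map :
    'Hom(corner_space (tensor_module X M), tensor X (corner_space M)) :=
  (tmap \1%VF (corner_proj M) \o tend (act X) (act M) S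
     \o corner_incl (tensor_module X M))%VF.

(** By [eS] the values of [S] already lie in X (x) eM, so the projection in the definition loses
    nothing. *)
Lemma corner_tensor_mapE v :
  corner_incl_r (corner_tensor_map v)
  = tend (act X) (act M) S (corner_incl (tensor_module X M) v).
Proof.
rewrite 2!comp_lfunE tmap_comp comp_lfun1l.
have -> : (corner_incl M \o corner_proj M)%VF = act M e.
  by apply/lfunP=> m; rewrite comp_lfunE corner_projK.
by rewrite -tend_id_r -tend_mulE eS.
Qed.

Lemma tend_corner_incl_r t :
  tend (act X) (act M) (1 \ot e) (corner_incl_r t) = corner_incl_r t.
Proof.
rewrite tend_id_r tmap_comp comp_lfun1l; congr (tmap _ _ t).
by apply/lfunP=> v; rewrite comp_lfunE act_corner_incl.
Qed.

(** The two sides differ by the factor [T S = coact e], which acts as the identity on e(X (x) M). *)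
Lemma corner_tensor_comm a v :
  corner_tensor_map (act (corner_module (tensor_module X M)) a v)
  = act (tensor_module X (corner_module M)) a (corner_tensor_map v).
Proof.
apply: corner_incl_r_inj; rewrite tensor_moduleE tend_corner_act.
rewrite !corner_tensor_mapE corner_actE tensor_moduleE -tend_mulE -psi_coact.
rewrite -tend_mulE -tmulA TS [in RHS]tend_mulE -[tend _ _ (coact B e) _]tensor_moduleE.
by rewrite act_corner_incl.
Qed.

Definition corner_tensor :
    modhom (corner_module (tensor_module X M))
           (tensor_module X (corner_module M)) :=
  @ModHom _ _ (corner_module (tensor_module X M))
    (tensor_module X (corner_module M)) _ corner_tensor_comm.

Lemma corner_tensorE v :
  corner_incl_r (corner_tensor v)
  = tend (act X) (act M) S (corner_incl (tensor_module X M) v).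
Proof. exact: corner_tensor_mapE. Qed.

Lemma corner_tensor_isiso : modhom_isiso corner_tensor.
Proof.
pose g : 'Hom(tensor X (corner_space M), corner_space (tensor_module X M)) :=
  (corner_proj (tensor_module X M) \o tend (act X) (act M) T \o corner_incl_r)%VF.
have gE t : corner_incl _ (g t) = tend (act X) (act M) T (corner_incl_r t).
  have -> : g t = corner_proj (tensor_module X M)
      (tend (act X) (act M) T (corner_incl_r t)) by rewrite 2!comp_lfunE.
  rewrite corner_projK tensor_moduleE -TS -!tend_mulE -tmulA ST.
  by rewrite tend_mulE tend_corner_incl_r.
apply: (@modhom_isiso_can _ _ _ _ corner_tensor g) => [v|t].
  apply: (can_inj (@corner_inclK _)); rewrite gE corner_tensorE -tend_mulE TS.
  by rewrite -tensor_moduleE act_corner_incl.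
apply: corner_incl_r_inj; rewrite corner_tensorE gE -tend_mulE ST.
exact: tend_corner_incl_r.
Qed.

End CornerTensor.

Lemma corner_tensor_natural X Y M N (f : modhom X Y) (g : modhom M N) :
  modhom_comp (corner_tensor Y N) (corner_hom (tensor_hom f g))
  = modhom_comp (tensor_hom f (corner_hom g)) (corner_tensor X M).
Proof.
apply: modhom_eq=> v; rewrite !modhom_compE; apply: corner_incl_r_inj.
rewrite corner_tensorE corner_homE.
have -> u : corner_incl_r Y N (tensor_hom f (corner_hom g) u)
    = tmap f g (corner_incl_r X M u).
  rewrite [tensor_hom _ _ u]/= !tmap_comp comp_lfun1l comp_lfun1r.
  congr (tmap _ _ u); apply/lfunP=> w.
  by rewrite [LHS]comp_lfunE [RHS]comp_lfunE corner_homE.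
rewrite corner_tensorE [tensor_hom f g _]/=.
elim/tensor_ind: S => [h b|c q q' IHq IHq']; last first.
  by rewrite !lfun_combE !add_lfunE !scale_lfunE lfun_combE IHq IHq'.
rewrite !tendE !tmap_comp; congr (tmap _ _ _); apply/lfunP=> x;
  by rewrite !comp_lfunE modhom_comm.
Qed.

(** Inside X (x) (Y (x) M) both composites are the action of an element of H (x) H (x) B on the same
    vector, and [S_cocycle] says that these two elements agree. *)
Lemma corner_tensor_assoc X Y M :
  modhom_comp (tensor_hom (modhom_id X) (corner_tensor Y M))
    (modhom_comp (corner_tensor X (tensor_module Y M))
       (corner_hom (assoc_hom X Y M)))
  = modhom_comp (assoc_hom X Y (corner_module M))
      (corner_tensor (tensor_Hmodule X Y) M).
Proof.
apply: modhom_eq=> v; rewrite !modhom_compE.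
apply: (can_inj (g := tmap \1%VF (tmap \1%VF (corner_proj M)))
  (f := tmap \1%VF (tmap \1%VF (corner_incl M)))) => [t|].
  rewrite tmap_comp comp_lfun1l.
  have -> : (tmap \1%VF (corner_proj M) \o tmap \1%VF (corner_incl M))%VF
      = \1%VF :> 'End(tensor Y (corner_space M)).
    apply/lfunP=> u; rewrite comp_lfunE tmap_comp comp_lfun1l id_lfunE.
    have -> : (corner_proj M \o corner_incl M)%VF = \1%VF.
      by apply/lfunP=> w; rewrite comp_lfunE corner_inclK id_lfunE.
    exact: tmap_id.
  exact: tmap_id.
rewrite [assoc_hom _ _ _ _]/= -tassoc_nat.
have -> : tmap \1%VF \1%VF = \1%VF :> 'End(tensor X Y).
  by apply/lfunP=> t; rewrite tmap_id id_lfunE.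
have /= -> := corner_tensorE (X := tensor_Hmodule X Y) v.
set w := corner_incl (tensor_module (tensor_Hmodule X Y) M) v.
have -> : @tensor_act _ _ (regular_comodAlgebra H) X Y = (tend (act X) (act Y) \o comul H)%VF
    :> 'Hom(H, 'End(tensor X Y)) by [].
rewrite -[act M in RHS]comp_lfun1r -tend_tmap tend_assoc S_cocycle tend_tmap.
rewrite comp_lfun1r.
set u := corner_tensor_map _ _ _.
have uE : corner_incl_r X (tensor_module Y M) u
    = tend (act X) (act (tensor_module Y M)) S (tassoc X Y M w).
  rewrite corner_tensor_mapE; congr (tend _ _ _ _).
  exact: (corner_homE (assoc_hom X Y M)).
rewrite tmap_comp comp_lfun1l.
have -> : (tmap \1 (corner_incl M) \o corner_tensor_map Y M)%VF
    = (tend (act Y) (act M) S \o corner_incl (tensor_module Y M))%VF.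
  by apply/lfunP=> t; rewrite comp_lfunE [RHS]comp_lfunE; apply: corner_tensor_mapE.
rewrite -[\1%VF in LHS]comp_lfun1l -tmap_comp.
have /= -> := uE.
(* Only the outer copy of [S] on each side is decomposed; the copies acting on Y (x) M stay
   whole. *)
elim/tensor_ind: {2 4}S => [h b|c q q' IHq IHq']; last first.
  by rewrite !lfun_combE !add_lfunE !scale_lfunE lfun_combE IHq IHq'.
rewrite !tendE tmap_comp comp_lfun1l; congr (tmap _ _ _); rewrite comp_lfunE.
have -> : linfun (fun b => tmul S (coact B b)) b = tmul S (coact B b).
  by apply: linfun_linearE=> c x y /=; rewrite lfun_combE tmulDr.
by apply/lfunP=> t; rewrite tend_mul !comp_lfunE.
Qed.

(** On the trivial module the first leg of [S] acts by the counit, so by [S_counit] the element [S]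
    acts as [e], the identity of eM. *)
Lemma corner_tensor_unit M :
  modhom_comp (unit_hom (corner_module M)) (corner_tensor (unit_module H) M)
  = corner_hom (unit_hom M).
Proof.
apply: modhom_eq=> v; rewrite modhom_compE; apply: (can_inj (@corner_inclK M)).
rewrite corner_homE.
have unit_incl t : corner_incl M (unit_hom (corner_module M) t)
    = unit_hom M (corner_incl_r (unit_module H) M t).
  elim/tensor_ind: t => [c m|c s t IHs IHt]; last by rewrite !lfun_combE IHs IHt.
  by rewrite /corner_incl_r tmapE id_lfunE !unit_mapE linearZ.
rewrite unit_incl corner_tensorE.
have unit_tend q t : unit_hom M (tend (act (unit_module H)) (act M) q t)
    = act M (tlift (fun h b => (counit H h : k) *: b) q) (unit_hom M t).
  elim/tensor_ind: q => [h b|c q q' IHq IHq']; last first.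
    by rewrite !lfun_combE !add_lfunE !scale_lfunE lfun_combE IHq IHq'.
  rewrite tendE tliftE; last first.
    split=> [x c y z|x c y z] /=; first by rewrite linearP scalerDl scalerA.
    by rewrite scalerDr !scalerA mulrC.
  elim/tensor_ind: t => [c m|c s t IHs IHt]; last by rewrite !lfun_combE IHs IHt.
  rewrite tmapE !unit_mapE [act (unit_module H) h]unit_actE scale_lfunE id_lfunE.
  by rewrite !linearZ /= scale_lfunE scalerA mulrC.
rewrite unit_tend S_counit.
by rewrite -modhom_comm act_corner_incl.
Qed.

(** * The inverse functor: columns over the corner *)

Section ColumnObject.
Variable N : fdmodule A.

Definition column_space : vectType k := {ffun 'I_n -> N}.

(** [kap (l i * b * r j)] is the (i, j) entry of [b] as a matrix over [A]. Columns model the tensor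
    product of [B e] with N over [e B e], the [r j] being a basis of [B e]. *)
Definition column_act_fun b (v : column_space) : column_space :=
  [ffun i => \sum_j act N (kap (l i * b * r j)) (v j)].

Lemma column_act_fun_linear b : linear (column_act_fun b).
Proof.
move=> c u v; apply/ffunP=> i; rewrite !ffunE scaler_sumr -big_split.
by apply: eq_bigr=> j _; rewrite !ffunE lfun_combE.
Qed.

Definition column_act_end b : 'End(column_space) := linfun (column_act_fun b).

Lemma column_act_linear : linear column_act_end.
Proof.
move=> c a b; apply/lfunP=> v; rewrite add_lfunE scale_lfunE.
rewrite /column_act_end !(linfun_linearE (column_act_fun_linear _)).
apply/ffunP=> i; rewrite !ffunE scaler_sumr -big_split; apply: eq_bigr=> j _ /=.
rewrite mulrDr mulrDl -scalerAr -scalerAl !lfun_combE.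
by rewrite add_lfunE scale_lfunE.
Qed.

Definition column_act : 'Hom(B, 'End(column_space)) := linfun column_act_end.

Lemma column_actE b v i :
  column_act b v i = \sum_j act N (kap (l i * b * r j)) (v j).
Proof.
rewrite /column_act (linfun_linearE column_act_linear) /column_act_end.
by rewrite (linfun_linearE (column_act_fun_linear _)) ffunE.
Qed.

Lemma kap_lr i j : kap (l i * r j) = (i == j)%:R.
Proof.
by rewrite lr linearZ /= kap_id; case: (i == j); rewrite ?scale1r ?scale0r.
Qed.

Lemma column_act_one : column_act 1 = \1%VF.
Proof.
apply/lfunP=> v; apply/ffunP=> i; rewrite column_actE id_lfunE (bigD1 i) //=.
rewrite mulr1 kap_lr eqxx act_oneE big1 ?addr0 // => j ji.
by rewrite kap_lr eq_sym (negPf ji) linear0 lfunE.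
Qed.

(** This is matrix multiplication: insert [rl] between the factors, then split each term at the [e]
    supplied by [el]. *)
Lemma kap_mul_cols (s t : B) :
  kap (s * t) = \sum_j kap (s * r j) * kap (l j * t).
Proof.
rewrite -[s in LHS]mulr1 -rl mulr_sumr mulr_suml linear_sum; apply: eq_bigr=> j _.
by rewrite -kap_mul -[in RHS]mulrA [e * _]mulrA el !mulrA.
Qed.

Lemma column_act_mul a b : column_act (a * b) = (column_act a \o column_act b)%VF.
Proof.
apply/lfunP=> v; apply/ffunP=> i; rewrite comp_lfunE !column_actE.
under [RHS]eq_bigr do rewrite column_actE linear_sum.
rewrite exchange_big; apply: eq_bigr=> j _ /=.
rewrite -[l i * _ * _]mulrA -mulrA mulrA kap_mul_cols linear_sum sum_lfunE.
by apply: eq_bigr=> p _; rewrite act_mulE !mulrA.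
Qed.

Definition column_module : fdmodule B := FdModule column_act_one column_act_mul.

End ColumnObject.

Section ColumnMap.
Variables (M N : fdmodule A) (f : modhom M N).

Definition column_map_fun (v : column_space M) : column_space N :=
  [ffun i => f (v i)].

Lemma column_map_linear : linear column_map_fun.
Proof. by move=> c u v; apply/ffunP=> i; rewrite !ffunE lfun_combE. Qed.

Definition column_map : 'Hom(column_space M, column_space N) :=
  linfun column_map_fun.

Lemma column_mapE v i : column_map v i = f (v i).
Proof. by rewrite /column_map (linfun_linearE column_map_linear) ffunE. Qed.

Lemma column_hom_subproof b v :
  column_map (act (column_module M) b v) = act (column_module N) b (column_map v).
Proof.
apply/ffunP=> i; rewrite column_mapE !column_actE linear_sum.
by apply: eq_bigr=> j _; rewrite column_mapE /= modhom_comm.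
Qed.

Definition column_hom : modhom (column_module M) (column_module N) :=
  @ModHom _ _ (column_module M) (column_module N) _ column_hom_subproof.

Lemma column_homE (v : column_space M) i : column_hom v i = f (v i).
Proof. exact: column_mapE. Qed.

End ColumnMap.

Lemma column_hom_id M : column_hom (modhom_id M) = modhom_id (column_module M).
Proof.
by apply: modhom_eq=> v; apply/ffunP=> i; rewrite column_homE !modhom_idE.
Qed.

Lemma column_hom_comp M N P (g : modhom N P) (f : modhom M N) :
  column_hom (modhom_comp g f) = modhom_comp (column_hom g) (column_hom f).
Proof.
apply: modhom_eq=> v; apply/ffunP=> i; rewrite column_homE.
by rewrite !modhom_compE !column_homE.
Qed.

Lemma column_hom_lin M N c (f g : modhom M N) :
  column_hom (modhom_lin c f g) = modhom_lin c (column_hom f) (column_hom g).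
Proof.
apply: modhom_eq=> v; apply/ffunP=> i; rewrite column_homE.
by rewrite !modhom_linE !ffunE !column_homE.
Qed.

Definition column_functor : linear_functor A B :=
  LinearFunctor column_hom_id column_hom_comp column_hom_lin.

Section Unit.
Variable M : fdmodule B.

Definition column_corner_fun (v : column_space (corner_module M)) : M :=
  \sum_i act M (r i) (corner_incl M (v i)).

Lemma column_corner_linear : linear column_corner_fun.
Proof.
move=> c u v; rewrite /column_corner_fun scaler_sumr -big_split.
by apply: eq_bigr=> i _; rewrite !ffunE !lfun_combE.
Qed.

Definition column_corner : 'Hom(column_space (corner_module M), M) :=
  linfun column_corner_fun.

Lemma column_cornerE v :
  column_corner v = \sum_i act M (r i) (corner_incl M (v i)).
Proof. exact: (linfun_linearE column_corner_linear). Qed.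

Definition corner_column_fun (m : M) : column_space (corner_module M) :=
  [ffun i => corner_proj M (act M (l i) m)].

Lemma corner_column_linear : linear corner_column_fun.
Proof. by move=> c u v; apply/ffunP=> i; rewrite !ffunE !lfun_combE. Qed.

Definition corner_column : 'Hom(M, column_space (corner_module M)) :=
  linfun corner_column_fun.

Lemma corner_columnE m i : corner_incl M (corner_column m i) = act M (l i) m.
Proof.
rewrite /corner_column (linfun_linearE corner_column_linear) ffunE corner_projK.
by rewrite -act_mulE el.
Qed.

Lemma corner_columnK : cancel corner_column column_corner.
Proof.
move=> m; rewrite column_cornerE; under eq_bigr do rewrite corner_columnE -act_mulE.
by rewrite -[RHS]act_oneE -rl linear_sum sum_lfunE.
Qed.

Lemma column_cornerK : cancel column_corner corner_column.
Proof.
move=> v; apply/ffunP=> i; apply: (can_inj (@corner_inclK M)).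
rewrite corner_columnE column_cornerE linear_sum (bigD1 i) //= -act_mulE lr eqxx.
rewrite scale1r act_corner_incl big1 ?addr0 // => j ji.
by rewrite -act_mulE lr eq_sym (negPf ji) scale0r linear0 lfunE.
Qed.

Lemma column_corner_comm b v :
  column_corner (act (column_module (corner_module M)) b v)
  = act M b (column_corner v).
Proof.
apply: (can_inj corner_columnK); apply/ffunP=> i.
rewrite column_cornerK column_actE; apply: (can_inj (@corner_inclK M)).
rewrite lfun_sumE corner_columnE column_cornerE !lfun_sumE.
apply: eq_bigr=> j _; rewrite corner_moduleE kapK -!act_mulE.
by rewrite !mulrA el -!mulrA re.
Qed.

Definition column_corner_hom : modhom (column_module (corner_module M)) M :=
  @ModHom _ _ (column_module (corner_module M)) M _ column_corner_comm.

Lemma column_corner_homE (v : column_space (corner_module M)) :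
  column_corner_hom v = \sum_i act M (r i) (corner_incl M (v i)).
Proof. exact: column_cornerE. Qed.

Lemma column_corner_isiso : modhom_isiso column_corner_hom.
Proof.
exact: (@modhom_isiso_can _ _ _ _ column_corner_hom corner_column column_cornerK
  corner_columnK).
Qed.

End Unit.

Lemma column_corner_natural M N (f : modhom M N) :
  modhom_comp (column_corner_hom N) (column_hom (corner_hom f))
  = modhom_comp f (column_corner_hom M).
Proof.
apply: modhom_eq=> v; rewrite !modhom_compE !column_corner_homE lfun_sumE.
by apply: eq_bigr=> i _; rewrite column_homE corner_homE modhom_comm.
Qed.

Section Counit.
Variable N : fdmodule A.

(** A column stands for the sum of the [r i (x) v i]; multiplying by [e] moves [e r i] into the
    corner, where it acts on N as [kap (r i)]. *)
Definition corner_of_column_fun (v : corner_space (column_module N)) : N :=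
  \sum_i act N (kap (r i)) ((corner_incl (column_module N) v : column_space N) i).

Lemma corner_of_column_linear : linear corner_of_column_fun.
Proof.
move=> c u v; rewrite /corner_of_column_fun scaler_sumr -big_split.
by apply: eq_bigr=> i _; rewrite lfun_combE !ffunE lfun_combE.
Qed.

Definition corner_of_column : 'Hom(corner_space (column_module N), N) :=
  linfun corner_of_column_fun.

Lemma corner_of_columnE v :
  corner_of_column v
  = \sum_i act N (kap (r i)) ((corner_incl (column_module N) v : column_space N) i).
Proof. exact: (linfun_linearE corner_of_column_linear). Qed.

Definition column_of_fun (m : N) : column_space N :=
  [ffun i => act N (kap (l i)) m].

Lemma column_of_linear : linear column_of_fun.
Proof. by move=> c u v; apply/ffunP=> i; rewrite !ffunE !lfun_combE. Qed.

Definition column_of : 'Hom(N, corner_space (column_module N)) :=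
  (corner_proj (column_module N) \o linfun column_of_fun)%VF.

Lemma kap_l_sum i b : \sum_j kap (l i * b * r j) * kap (l j) = kap (l i * b).
Proof.
rewrite -[in RHS](mulr1 (l i * b)) kap_mul_cols; apply: eq_bigr=> j _.
by rewrite mulr1.
Qed.

Lemma column_ofE m i :
  (corner_incl (column_module N) (column_of m) : column_space N) i
  = act N (kap (l i)) m.
Proof.
rewrite comp_lfunE corner_projK (linfun_linearE column_of_linear) column_actE.
under eq_bigr do rewrite ffunE -act_mulE.
rewrite -sum_lfunE -linear_sum /= kap_l_sum.
by rewrite -kap_corner -[RHS](congr1 (fun a => act N a m) (kap_corner _))
     !mulrA -[_ * e * e]mulrA corner_idem.
Qed.

Lemma column_ofK : cancel column_of corner_of_column.
Proof.
move=> m; rewrite corner_of_columnE; under eq_bigr do rewrite column_ofE -act_mulE.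
rewrite -sum_lfunE -linear_sum /=; under eq_bigr do rewrite -kap_mul re.
by rewrite -linear_sum rl /= kap_one act_oneE.
Qed.

Lemma corner_of_columnK : cancel corner_of_column column_of.
Proof.
move=> v; apply: (can_inj (@corner_inclK _)); apply/ffunP=> i.
rewrite column_ofE corner_of_columnE -[in RHS]act_corner_incl column_actE lfun_sumE.
by apply: eq_bigr=> j _; rewrite -act_mulE -kap_mul.
Qed.

Lemma corner_of_column_comm a v :
  corner_of_column (act (corner_module (column_module N)) a v)
  = act N a (corner_of_column v).
Proof.
apply: (can_inj column_ofK); rewrite corner_of_columnK.
apply: (can_inj (@corner_inclK _)); apply/ffunP=> i.
rewrite column_ofE corner_moduleE column_actE corner_of_columnE !lfun_sumE.
apply: eq_bigr=> j _; rewrite -!act_mulE -{2}[a]psiK -!kap_mul.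
by rewrite -[in RHS](mulrA (l i)) -[in RHS](mulrA (l i)) corner_psi.
Qed.

Definition corner_of_column_hom :
    modhom (corner_module (column_module N)) N :=
  @ModHom _ _ (corner_module (column_module N)) N _ corner_of_column_comm.

Lemma corner_of_column_homE (v : corner_space (column_module N)) :
  corner_of_column_hom v
  = \sum_i act N (kap (r i)) ((corner_incl (column_module N) v : column_space N) i).
Proof. exact: corner_of_columnE. Qed.

Lemma corner_of_column_isiso : modhom_isiso corner_of_column_hom.
Proof.
exact: (@modhom_isiso_can _ _ _ _ corner_of_column_hom column_of corner_of_columnK
  column_ofK).
Qed.

End Counit.

Lemma corner_of_column_natural M N (f : modhom M N) :
  modhom_comp (corner_of_column_hom N) (corner_hom (column_hom f))
  = modhom_comp f (corner_of_column_hom M).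
Proof.
apply: modhom_eq=> v; rewrite !modhom_compE !corner_of_column_homE lfun_sumE.
by apply: eq_bigr=> i _; rewrite corner_homE column_homE modhom_comm.
Qed.

Theorem corner_module_equivalent : module_equivalent B A.
Proof.
exists corner_functor, corner_tensor; split.
  split; [exact: corner_tensor_natural | exact: corner_tensor_isiso
    | exact: corner_tensor_assoc | exact: corner_tensor_unit].
exists column_functor; split.
  exists column_corner_hom; split; first exact: column_corner_natural.
  exact: column_corner_isiso.
exists corner_of_column_hom; split; first exact: corner_of_column_natural.
exact: corner_of_column_isiso.
Qed.

End ModuleEquivalence.

(** * Coordinates, pure tensors and slices *)

Section VectorCoordinates.
Variables (k : fieldType) (V : vectType k).
Implicit Types (u v : V).
Import VectorInternalTheory.

(** In coordinates, a linear identity between opaque vectors becomes a scalar identity that [field]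
    decides. *)
Definition vcoord u i := v2r u 0 i.

Lemma vcoordD u v i : vcoord (u + v) i = vcoord u i + vcoord v i.
Proof. by rewrite /vcoord linearD mxE. Qed.

Lemma vcoordN u i : vcoord (- u) i = - vcoord u i.
Proof. by rewrite /vcoord linearN mxE. Qed.

Lemma vcoordZ c u i : vcoord (c *: u) i = c * vcoord u i.
Proof. by rewrite /vcoord linearZ mxE. Qed.

Lemma vcoord0 i : vcoord 0 i = 0.
Proof. by rewrite /vcoord linear0 mxE. Qed.

Lemma vcoord_inj u v : (forall i, vcoord u i = vcoord v i) -> u = v.
Proof. by move=> uv; apply: (can_inj v2rK); apply/rowP. Qed.

Definition vcoordE := (vcoordD, vcoordN, vcoordZ, vcoord0).

End VectorCoordinates.

Ltac linear_identity := apply: vcoord_inj=> ?; rewrite !vcoordE; field.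

Section TensorPure.
Variables (k : fieldType) (U V : vectType k).
Implicit Types (u : U) (v : V).

Lemma tpureZl c u v : (c *: u) \ot v = c *: (u \ot v).
Proof.
have := tpureDl c u 0 v; rewrite addr0 => ->.
by have := tpureDl (-1) (0 : U) 0 v; rewrite scaler0 addr0 scaleN1r addNr => ->; rewrite addr0.
Qed.

Lemma tpureZr c u v : u \ot (c *: v) = c *: (u \ot v).
Proof.
have := tpureDr c u v 0; rewrite addr0 => ->.
by have := tpureDr (-1) u (0 : V) 0; rewrite scaler0 addr0 scaleN1r addNr => ->; rewrite addr0.
Qed.

Lemma tpure_addl u u' v : (u + u') \ot v = u \ot v + u' \ot v.
Proof. by rewrite -{1}[u]scale1r tpureDl scale1r. Qed.

Lemma tpure_addr u v v' : u \ot (v + v') = u \ot v + u \ot v'.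
Proof. by rewrite -{1}[v]scale1r tpureDr scale1r. Qed.

Lemma tpureNl u v : (- u) \ot v = - (u \ot v).
Proof. by rewrite -scaleN1r tpureZl scaleN1r. Qed.

Lemma tpureNr u v : u \ot (- v) = - (u \ot v).
Proof. by rewrite -scaleN1r tpureZr scaleN1r. Qed.

Lemma tpure0l v : (0 : U) \ot v = 0.
Proof. by rewrite -(scale0r 0) tpureZl scale0r. Qed.

Lemma tpure0r u : u \ot (0 : V) = 0.
Proof. by rewrite -(scale0r 0) tpureZr scale0r. Qed.

Lemma tpure_suml (I : finType) (u : I -> U) v :
  (\sum_i u i) \ot v = \sum_i u i \ot v.
Proof.
by elim/big_rec2: _ => [|i s t _ <-]; rewrite ?tpure0l ?tpure_addl.
Qed.

End TensorPure.

Definition tpureE := (tpure_addl, tpure_addr, tpureNl, tpureNr, tpureZl, tpureZr).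

Section Slice.
Variables (k : fieldType) (U : vectType k).
Implicit Types V W : vectType k.

(* The map f (x) id followed by the identification of k (x) V with V. *)
Definition slice V (f : 'Hom(U, k^o)) : 'Hom(tensor U V, V) :=
  tlift (fun u v => (f u : k) *: v).

Lemma sliceE V (f : 'Hom(U, k^o)) u (v : V) : slice V f (u \ot v) = (f u : k) *: v.
Proof.
rewrite /slice tliftE //; split=> w c a b /=; first by rewrite linearP scalerDl scalerA.
by rewrite scalerDr !scalerA mulrC.
Qed.

Lemma slice_tmap V W (f : 'Hom(U, k^o)) (g : 'Hom(V, W)) t :
  slice W f (tmap \1%VF g t) = g (slice V f t).
Proof.
elim/tensor_ind: t => [u v|c s t IHs IHt]; last by rewrite !lfun_combE IHs IHt.
by rewrite tmapE !sliceE id_lfunE linearZ.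
Qed.

Lemma slice_tassoc V W (f : 'Hom(U, k^o)) t :
  slice (tensor V W) f (tassoc U V W t) = tmap (slice V f) \1%VF t.
Proof.
elim/tensor_ind: t => [s w|c s t IHs IHt]; last by rewrite !lfun_combE IHs IHt.
rewrite tmapE id_lfunE.
elim/tensor_ind: s => [u v|c s t IHs IHt].
  by rewrite tassocE !sliceE tpureZl.
by rewrite tpureDl !lfun_combE IHs IHt tpureDl.
Qed.

End Slice.

(** Coassociativity: the coaction of a component of [b] is read off from the comultiplication of the
    first legs of [coact b]. *)
Lemma coact_slice (k : fieldType) (H : hopfAlgebra k) (B : comodAlgebra H)
    (f : 'Hom(H, k^o)) b :
  coact B (slice B f (coact B b))
  = tmap (slice H f \o comul H)%VF \1%VF (coact B b).
Proof.
rewrite -slice_tmap -coact_coassoc slice_tassoc tmap_comp.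
by rewrite comp_lfun1l.
Qed.

(** * The Kac-Paljutkin algebra *)

Lemma scale_inj (k : fieldType) (V : vectType k) (c d : k) (w : V) :
  w != 0 -> c *: w = d *: w -> c = d.
Proof.
move=> w0 /eqP; rewrite -subr_eq0 -scalerBl scaler_eq0 (negPf w0) orbF subr_eq0.
by move/eqP.
Qed.

(** * Realization of a corner as a coideal subalgebra *)

Section TripleProduct.
Variables (k : fieldType) (P Q R : falgType k).
Implicit Types s t : tensor P (tensor Q R).

(** [tmul] expects algebras as factors, while [tensor Q R] is only a vector space here; hence a
    separate product for three legs. *)
Definition tmul3 s t : tensor P (tensor Q R) :=
  tlift (fun a u => tlift (fun a' u' => (a * a') \ot tmul u u') t) s.

Lemma tmul3Dl c s s' t : tmul3 (c *: s + s') t = c *: tmul3 s t + tmul3 s' t.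
Proof. exact: lfun_combE. Qed.

Lemma tmul3Dr c s t t' : tmul3 s (c *: t + t') = c *: tmul3 s t + tmul3 s t'.
Proof. by apply: tlift_ext_linear=> a u; rewrite lfun_combE. Qed.

Lemma tmul3E a a' u u' : tmul3 (a \ot u) (a' \ot u') = (a * a') \ot tmul u u'.
Proof.
have bil c v : bilin (fun (a' : P) (u' : tensor Q R) => (c * a') \ot tmul v u').
  split=> [w d y z|w d y z] /=; first by rewrite mulrDr -scalerAr tpureDl.
  by rewrite tmulDr tpureDr.
rewrite /tmul3 tliftE ?tliftE //; split=> [w c y z|w c y z] /=.
  by apply: tlift_ext_linear=> b v; rewrite mulrDl -scalerAl tpureDl.
by apply: tlift_ext_linear=> b v; rewrite tmulDl tpureDr.
Qed.

Lemma tassoc_tmul (p q : tensor P Q) (b c : R) :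
  tassoc P Q R (tmul p q \ot (b * c))
  = tmul3 (tassoc P Q R (p \ot b)) (tassoc P Q R (q \ot c)).
Proof.
elim/tensor_ind: p => [h g|d p p' IHp IHp']; last first.
  by rewrite tmulDl !tpureDl !lfun_combE IHp IHp' tmul3Dl.
elim/tensor_ind: q => [h' g'|d q q' IHq IHq']; last first.
  by rewrite tmulDr !tpureDl !lfun_combE IHq IHq' tmul3Dr.
by rewrite tmulE !tassocE tmul3E tmulE.
Qed.

End TripleProduct.

Section TensorSubspaces.
Variables (k : fieldType).
Implicit Types U V W : vectType k.

Lemma tmap_limg U V W (f : 'Hom(V, W)) (t : tensor U V) :
  tmap \1%VF f t \in tensv fullv (limg f).
Proof.
elim/tensor_ind: t => [u v|c s t IHs IHt].
  by rewrite tmapE memv_tensv ?memvf // memv_img ?memvf.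
by rewrite lfun_combE rpredD ?rpredZ.
Qed.

(** With [f^-1] a generalized inverse, [1 - f^-1 f] maps into the kernel of [f]; applied to the
    second leg it fixes [t]. *)
Lemma tmap_lker U V W (f : 'Hom(V, W)) (t : tensor U V) :
  tmap \1%VF f t = 0 -> t \in tensv fullv (lker f).
Proof.
move=> ft; have -> : t = tmap \1%VF (\1 - (f^-1 \o f))%VF t.
  have L := linfun_linearE (tmap_linear_r (\1%VF : 'End(U)) t).
  rewrite -L linearB /= !L tmap_id -{1}[\1%VF : 'End(U)]comp_lfun1l -tmap_comp ft.
  by rewrite linear0 subr0.
have img : (limg (\1 - (f^-1 \o f))%VF <= lker f)%VS.
  apply/subvP=> _ /memv_imgP[v _ ->]; rewrite memv_ker add_lfunE opp_lfunE id_lfunE.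
  by rewrite comp_lfunE lfun_addE lfun_oppE limg_lfunVK ?subrr ?memv_img ?memvf.
have : (tensv (fullv : {vspace U}) (limg (\1 - (f^-1 \o f))%VF) <= tensv fullv (lker f))%VS.
  by apply: tensv_subP=> u v uU vf; rewrite memv_tensv // (subvP img).
by move/subvP; apply; apply: tmap_limg.
Qed.

Lemma tmul_tensv (A B : falgType k) (P P' : {vspace A}) (Q Q' : {vspace B}) s t :
  s \in tensv P Q -> t \in tensv P' Q' -> tmul s t \in tensv (P * P') (Q * Q').
Proof.
move=> sPQ tPQ'; pose Lt := linfun (fun s => tmul s t).
have LtE : Lt =1 fun s => tmul s t := linfun_linearE (tmul_linear_l t).
rewrite -LtE memv_preim; apply: subvP sPQ; apply: tensv_subP=> a b aP bQ.
rewrite -memv_preim LtE; pose Ls := linfun (tmul (a \ot b)).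
have LsE : Ls =1 tmul (a \ot b) := linfun_linearE (tmul_linear_r (a \ot b)).
rewrite -LsE memv_preim; apply: subvP tPQ'; apply: tensv_subP=> a' b' aP' bQ'.
by rewrite -memv_preim LsE tmulE memv_tensv // memv_mul.
Qed.

Lemma prodv3_subP (A : falgType k) (U V W Z : {vspace A}) :
  (forall u v w, u \in U -> v \in V -> w \in W -> u * v * w \in Z) ->
  (U * V * W <= Z)%VS.
Proof.
move=> UVW; apply/prodvP=> t w tUV wW.
have -> : t * w = amulr w t by rewrite lfunE.
rewrite memv_preim; apply: subvP tUV; apply/prodvP=> u v uU vV.
by rewrite -memv_preim lfunE; apply: UVW.
Qed.

End TensorSubspaces.

Section GradedProjection.
Variables (k : fieldType) (A : falgType k) (G : nat -> {vspace A}).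
Hypothesis G_graded : is_graded_algebra G.

(** The sum of the positive degrees is a two-sided ideal, so projecting along it is
    multiplicative. *)
Lemma graded_projection : exists pr : 'End(A),
  [/\ forall a, pr a \in G 0%N, forall a, a \in G 0%N -> pr a = a,
      forall n a, a \in G n.+1 -> pr a = 0
    & {morph pr : a b / a * b}].
Proof.
have [[dG [N GN]] _ GM] := G_graded.
pose P := (\sum_(i < N) G i.+1)%VS.
have full : (G 0%N + P)%VS = fullv by rewrite -(GN N.+1) // big_ord_recl.
have cap : (G 0%N :&: P = 0)%VS.
  apply/eqP; rewrite -subv0 -(directv_sumP (dG N.+1) ord0 isT) capvS //.
  by apply/subv_sumP=> i _; apply: (sumv_sup (lift ord0 i)).
(* From index [N] on, the earlier degrees already fill the space, and directness forces
   [G n.+1 = 0]. *)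
have GP n : (G n.+1 <= P)%VS.
  have [nN | Nn] := ltnP n N; first exact: (sumv_sup (Ordinal nN)).
  suff -> : G n.+1 = 0%VS by exact: sub0v.
  apply/eqP; rewrite -subv0 -(directv_sumP (dG n.+2) ord_max isT) subv_cap subvv /=.
  apply: subv_trans (subvf _) _; rewrite -(GN n.+1) ?(leq_trans Nn) //.
  apply/subv_sumP=> i _; apply: (sumv_sup (widen_ord (leqnSn _) i)) => //.
  by rewrite -val_eqE /= neq_ltn ltn_ord.
have PM : (G 0%N * P <= P)%VS /\ (P * fullv <= P)%VS.
  split.
    rewrite /P big_distrr /=; apply/subv_sumP=> i _.
    by apply: subv_trans (GM _ _) _; rewrite add0n GP.
  rewrite -(GN N) // /P !big_distrl /=; apply/subv_sumP=> i _.
  rewrite big_distrr /=; apply/subv_sumP=> j _.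
  by apply: subv_trans (GM _ _) _; rewrite addSn GP.
pose pr := daddv_pi (G 0%N) P.
have prG a : pr a \in G 0%N by exact: memv_pi.
have pr_id a : a \in G 0%N -> pr a = a by exact: daddv_pi_id.
have pr0 a : a \in P -> pr a = 0.
  move=> aP; have := daddv_pi_add cap (w := a); rewrite full memvf => /(_ isT).
  by rewrite (daddv_pi_id _ aP) 1?capvC // => /(canRL (addrK _)); rewrite subrr.
have prE a : exists2 a', a' \in P & a = pr a + a'.
  exists (daddv_pi P (G 0%N) a); first exact: memv_pi.
  by rewrite daddv_pi_add // full memvf.
exists pr; split=> // [n a aG | a b]; first by apply: pr0; apply: subvP aG.
have [a' a'P aE] := prE a; have [b' b'P bE] := prE b.
rewrite {1}aE mulrDl {1}bE mulrDr !lfun_addE.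
rewrite [pr (pr a * b')]pr0 ?(subvP PM.1) ?memv_mul //.
rewrite [pr (a' * b)]pr0 ?(subvP PM.2) ?memv_mul ?memvf // !addr0.
by rewrite [LHS]pr_id //; have /subvP := GM 0%N 0%N; apply; rewrite memv_mul.
Qed.

End GradedProjection.

Section CoidealRealization.
Variables (k : fieldType) (H : hopfAlgebra k) (G : nat -> {vspace H}).
Hypothesis G_graded : is_graded_algebra G.
Variables (B : comodAlgebra H) (GB : nat -> {vspace B}).
Hypothesis B_loewy : is_loewy_graded G GB.
Hypothesis B_exact : AM_exact B.
Variables (e Om : B) (S T : tensor H B).
Hypothesis S_deg0 : S \in tensv (G 0%N) (GB 0%N).
Hypothesis T_deg0 : T \in tensv (G 0%N) (GB 0%N).
Hypothesis e_deg0 : e \in GB 0%N.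
Hypothesis ee : e * e = e.
Hypothesis ST : tmul S T = 1 \ot e.
Hypothesis TS : tmul T S = coact B e.
Hypothesis eS : tmul (1 \ot e) S = S.
Hypothesis Te : tmul T (1 \ot e) = T.
Hypothesis S_cocycle : tassoc _ _ _ (tmap (comul H) \1%VF S)
  = tmap \1%VF (linfun (fun b => tmul S (coact B b))) S.
Hypothesis T_cocycle : tassoc _ _ _ (tmap (comul H) \1%VF T)
  = tmap \1%VF (linfun (fun b => tmul (coact B b) T)) T.
Hypothesis S_counit : tlift (fun h b => (counit H h : k) *: b) S = e.
Hypothesis Om_neq0 : Om != 0.
Hypothesis eOm : e * Om = Om.
Hypothesis Om_eigen : forall b, b \in GB 0%N -> exists c, e * b * Om = c *: Om.
Variables (n : nat) (r l : 'I_n -> B).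
Hypothesis re : forall i, r i * e = r i.
Hypothesis el : forall i, e * l i = l i.
Hypothesis lr : forall i j, l i * r j = (i == j)%:R *: e.
Hypothesis rl : \sum_i r i * l i = 1.

Lemma Se_absorb : tmul S (coact B e) = S.
Proof. by rewrite -TS tmulA ST eS. Qed.

Lemma eT_absorb : tmul (coact B e) T = T.
Proof. by rewrite -TS -tmulA ST Te. Qed.

(** The coaction of the corner, defined on all of [B]: its value depends only on [e b e], so the
    corner needs no type of its own. *)
Definition twisted_coact : 'Hom(B, tensor H B) :=
  linfun (fun b => tmul (tmul S (coact B b)) T).

Lemma twisted_coactE b : twisted_coact b = tmul (tmul S (coact B b)) T.
Proof.
by apply: linfun_linearE=> c u v /=; rewrite lfun_combE tmulDr tmulDl.
Qed.

Lemma twisted_coactM b c :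
  tmul (twisted_coact b) (twisted_coact c) = twisted_coact (b * e * c).
Proof.
rewrite !twisted_coactE -!tmulA [tmul T (tmul S _)]tmulA TS.
by rewrite !coact_mul -!tmulA.
Qed.

Lemma twisted_coact_e : twisted_coact e = 1 \ot e.
Proof. by rewrite twisted_coactE Se_absorb. Qed.

Lemma twisted_coact_eb b : twisted_coact (e * b) = twisted_coact b.
Proof. by rewrite !twisted_coactE coact_mul tmulA Se_absorb. Qed.

Lemma twisted_coact_be b : twisted_coact (b * e) = twisted_coact b.
Proof. by rewrite !twisted_coactE coact_mul -!tmulA eT_absorb. Qed.

Lemma e_twisted_coact b : tmul (1 \ot e) (twisted_coact b) = twisted_coact b.
Proof. by rewrite -twisted_coact_e twisted_coactM ee twisted_coact_eb. Qed.

Lemma twisted_coact_e_r b : tmul (twisted_coact b) (1 \ot e) = twisted_coact b.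
Proof. by rewrite -twisted_coact_e twisted_coactM -mulrA ee twisted_coact_be. Qed.

Lemma tassoc_comul_tmul s t :
  tassoc _ _ _ (tmap (comul H) \1%VF (tmul s t))
  = tmul3 (tassoc _ _ B (tmap (comul H) \1%VF s))
          (tassoc _ _ B (tmap (comul H) \1%VF t)).
Proof.
elim/tensor_ind: s => [h b|c s s' IHs IHs']; last first.
  by rewrite tmulDl !lfun_combE tmul3Dl IHs IHs'.
elim/tensor_ind: t => [h' b'|c t t' IHt IHt']; last first.
  by rewrite tmulDr !lfun_combE tmul3Dr IHt IHt'.
by rewrite tmulE !tmapE !id_lfunE comul_mul tassoc_tmul.
Qed.

(** Comultiplying the first leg is multiplicative, so it may be applied to [S], [coact b] and [T]
    separately. The cocycle identities and coassociativity then leave second legs whose product is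
    [S coact(b1 b2 b3) T]. *)
Lemma twisted_coassoc b :
  tassoc _ _ _ (tmap (comul H) \1%VF (twisted_coact b))
  = tmap \1%VF twisted_coact (twisted_coact b).
Proof.
pose Ls : 'Hom(B, tensor H B) := linfun (fun b => tmul S (coact B b)).
pose Rt : 'Hom(B, tensor H B) := linfun (fun b => tmul (coact B b) T).
have LsE c : Ls c = tmul S (coact B c).
  by apply: linfun_linearE=> d u v /=; rewrite lfun_combE tmulDr.
have RtE c : Rt c = tmul (coact B c) T.
  by apply: linfun_linearE=> d u v /=; rewrite lfun_combE tmulDl.
rewrite [in LHS]twisted_coactE !tassoc_comul_tmul S_cocycle T_cocycle coact_coassoc.
rewrite -/Ls -/Rt twisted_coactE.
(* [Ls], [Rt] and [twisted_coact] keep their own [S] and [T] folded, so only the outer factors are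
   decomposed. *)
elim/tensor_ind: S => [h1 b1|c s s' IHs IHs']; last first.
  by rewrite !(lfun_combE, tmulDl, tmul3Dl) IHs IHs'.
elim/tensor_ind: (coact B b) => [h2 b2|c s s' IHs IHs']; last first.
  by rewrite !(lfun_combE, tmulDl, tmulDr, tmul3Dl, tmul3Dr) IHs IHs'.
elim/tensor_ind: T => [h3 b3|c s s' IHs IHs']; last first.
  by rewrite !(lfun_combE, tmulDr, tmul3Dr) IHs IHs'.
rewrite !tmulE !tmapE !id_lfunE !tmul3E; congr (_ \ot _).
by rewrite LsE RtE twisted_coactE !coact_mul !tmulA.
Qed.

Section Realization.
Variable pr : 'End(B).
Hypothesis pr_deg0 : forall b, pr b \in GB 0%N.
Hypothesis pr_id : forall b, b \in GB 0%N -> pr b = b.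
Hypothesis pr_pos : forall i b, b \in GB i.+1 -> pr b = 0.
Hypothesis pr_mul : {morph pr : a b / a * b}.

(** [Om] spans a one-dimensional module over [e B(0) e]; [theta] is its character, extended by zero
    to positive degrees through [pr]. Reading the eigenvalue as the coordinate along [Om] makes it
    linear. *)
Lemma eigenvalue_function : exists theta : 'Hom(B, k^o),
  forall b, e * pr b * Om = (theta b : k) *: Om.
Proof.
pose f : 'Hom(B, k^o) := linfun (coord [tuple Om] 0 : B -> k^o).
exists (f \o amulr Om \o amull e \o pr)%VF => b.
have fE c : f (c *: Om) = c.
  have Om_free : free [tuple Om] by rewrite seq1_free.
  by rewrite lfunE /= linearZ /= -[Om in X in _ * X]/([tuple Om]`_(@ord0 0))
             coord_free // mulr1.
have [c cE] := Om_eigen (pr_deg0 b).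
by rewrite 3!comp_lfunE [amull e _]lfunE [amulr Om _]lfunE /= cE fE.
Qed.

Variable theta : 'Hom(B, k^o).
Hypothesis thetaE : forall b, e * pr b * Om = (theta b : k) *: Om.

Lemma theta_mul b c : theta (b * e * c) = (theta b * theta c : k).
Proof.
apply: (scale_inj Om_neq0).
rewrite -thetaE !pr_mul (pr_id e_deg0).
have -> : e * (pr b * e * pr c) * Om = e * pr b * (e * pr c * Om) by rewrite !mulrA.
by rewrite thetaE -scalerAr thetaE scalerA mulrC.
Qed.

Lemma theta_e : theta e = (1 : k).
Proof.
apply: (scale_inj Om_neq0).
by rewrite -thetaE (pr_id e_deg0) ee eOm scale1r.
Qed.

(* The map id (x) theta, followed by the identification of H (x) k with H. *)
Definition theta_slice : 'Hom(tensor H B, H) :=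
  tlift (fun h b => (theta b : k) *: h).

Lemma theta_sliceE h b : theta_slice (h \ot b) = (theta b : k) *: h.
Proof.
rewrite /theta_slice tliftE //; split=> w c a d /=.
  by rewrite scalerDr !scalerA mulrC.
by rewrite lfun_combE scalerDl scalerA.
Qed.

Lemma theta_slice_mul s t : theta_slice (tmul (tmul s (1 \ot e)) t)
  = theta_slice s * theta_slice t.
Proof.
elim/tensor_ind: s => [h b|c s s' IHs IHs']; last first.
  by rewrite !tmulDl !lfun_combE IHs IHs' mulrDl scalerAl.
elim/tensor_ind: t => [h' b'|c t t' IHt IHt']; last first.
  by rewrite !tmulDr !lfun_combE IHt IHt' mulrDr scalerAr.
by rewrite !tmulE !theta_sliceE theta_mul mulr1 -scalerAl -scalerAr scalerA.
Qed.

Lemma comul_theta_slice t :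
  comul H (theta_slice t)
  = tmap \1%VF theta_slice (tassoc _ _ _ (tmap (comul H) \1%VF t)).
Proof.
elim/tensor_ind: t => [h b|c t t' IHt IHt']; last by rewrite !lfun_combE IHt IHt'.
rewrite theta_sliceE tmapE id_lfunE lfun_scaleE.
elim/tensor_ind: (comul H h) => [g g'|c s s' IHs IHs'].
  by rewrite tassocE tmapE theta_sliceE id_lfunE tpureZr.
rewrite tpureDl !lfun_combE -IHs -IHs' scalerDr !scalerA.
by rewrite mulrC.
Qed.

Definition realize : 'Hom(B, H) := (theta_slice \o twisted_coact)%VF.

Lemma realizeE b : realize b = theta_slice (twisted_coact b).
Proof. exact: comp_lfunE. Qed.

Lemma realize_mul b c : realize (b * e * c) = realize b * realize c.
Proof. by rewrite !realizeE -twisted_coactM -{1}twisted_coact_e_r theta_slice_mul. Qed.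

Lemma realize_e : realize e = 1.
Proof. by rewrite realizeE twisted_coact_e theta_sliceE theta_e scale1r. Qed.

Lemma realize_eb b : realize (e * b) = realize b.
Proof. by rewrite !realizeE twisted_coact_eb. Qed.

Lemma realize_be b : realize (b * e) = realize b.
Proof. by rewrite !realizeE twisted_coact_be. Qed.

(** Coassociativity of the twisted coaction: [realize] intertwines it with the comultiplication, so
    its image is a left coideal. *)
Lemma comul_realize b : comul H (realize b) = tmap \1%VF realize (twisted_coact b).
Proof.
rewrite realizeE comul_theta_slice twisted_coassoc tmap_comp comp_lfun1l.
by [].
Qed.

(** Since [realize b] depends only on [e b e], compressing its kernel gives exactly its kernel on
    the corner. *)
Definition corner_ker : {vspace B} := ((amulr e \o amull e)%VF @: lker realize)%VS.

Lemma corner_kerP b : b \in lker realize -> e * b * e \in corner_ker.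
Proof.
by move=> bk; have := memv_img (amulr e \o amull e)%VF bk; rewrite comp_lfunE !lfunE.
Qed.

Lemma tmul_corner_ker (t : tensor H B) : t \in tensv fullv (lker realize) ->
  tmul (tmul (1 \ot e) t) (1 \ot e) \in tensv fullv corner_ker.
Proof.
pose F := linfun (fun t : tensor H B => tmul (tmul (1 \ot e) t) (1 \ot e)).
have FE : F =1 fun t => tmul (tmul (1 \ot e) t) (1 \ot e).
  by apply: linfun_linearE=> c u v /=; rewrite tmulDr tmulDl.
move=> tk; rewrite -FE memv_preim; apply: subvP tk; apply: tensv_subP=> h b _ bk.
rewrite -memv_preim FE !tmulE mul1r mulr1 memv_tensv ?memvf //.
exact: corner_kerP.
Qed.

(* The two-sided ideal generated by the kernel of b |-> realize b on eBe. *)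
Definition ker_ideal : {vspace B} := (fullv * corner_ker * fullv)%VS.

Lemma tmul_ker_ideal (s t u : tensor H B) : t \in tensv fullv corner_ker ->
  tmul (tmul s t) u \in tensv fullv ker_ideal.
Proof.
move=> tk; elim/tensor_ind: s => [h b|c s s' IHs IHs']; last first.
  by rewrite !tmulDl rpredD ?rpredZ.
elim/tensor_ind: u => [h' b'|c u u' IHu IHu']; last first.
  by rewrite !tmulDr rpredD ?rpredZ.
pose F := linfun (fun t : tensor H B => tmul (tmul (h \ot b) t) (h' \ot b')).
have FE : F =1 fun t => tmul (tmul (h \ot b) t) (h' \ot b').
  by apply: linfun_linearE=> c v w /=; rewrite tmulDr tmulDl.
rewrite -FE memv_preim; apply: subvP tk; apply: tensv_subP=> g c _ ck.
by rewrite -memv_preim FE !tmulE memv_tensv ?memvf // !memv_mul ?memvf.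
Qed.

Lemma coact_corner b : coact B (e * b * e) = tmul (tmul T (twisted_coact b)) S.
Proof.
by rewrite twisted_coactE !coact_mul -TS -!tmulA.
Qed.

(** By [comul_realize], realizing the second leg of the twisted coaction of [a] gives 0, so that leg
    lies in the kernel; the factors [1 (x) e] then compress it. *)
Lemma twisted_coact_ker a : a \in lker realize ->
  twisted_coact a \in tensv fullv corner_ker.
Proof.
rewrite memv_ker => /eqP a0; rewrite -e_twisted_coact -twisted_coact_e_r tmulA.
by apply/tmul_corner_ker/tmap_lker; rewrite -comul_realize a0 linear0.
Qed.

Lemma corner_ker_elem c : c \in corner_ker ->
  exists2 a, a \in lker realize & c = e * a * e.
Proof. by case/memv_imgP=> a ak ->; exists a; rewrite ?comp_lfunE ?lfunE. Qed.

(** Passing from the twisted coaction back to that of [B] introduces [T] on the left and [S] on the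
    right. A two-sided ideal absorbs both, although exactness only speaks of right ideals. *)
Lemma ker_ideal_coact : (coact B @: ker_ideal <= tensv fullv ker_ideal)%VS.
Proof.
apply/subvP=> _ /memv_imgP[u uI ->]; rewrite memv_preim; apply: subvP uI.
apply: prodv3_subP=> b _ c _ /corner_ker_elem[a ak ->] _.
rewrite -memv_preim 2!coact_mul coact_corner !tmulA -tmulA.
by apply: tmul_ker_ideal; apply: twisted_coact_ker.
Qed.

(** [realize] is multiplicative across [e], hence kills [B e a e B]. As [realize e = 1], the ideal
    is proper. *)
Lemma ker_ideal_sub : (ker_ideal <= lker realize)%VS.
Proof.
apply: prodv3_subP=> b _ c _ /corner_ker_elem[a ak ->] _; rewrite memv_ker.
have -> : b * (e * a * e) * c = b * e * (a * e * c) by rewrite !mulrA.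
by rewrite !realize_mul; move: ak; rewrite memv_ker => /eqP->; rewrite mul0r mulr0.
Qed.

Lemma corner_realize0 b : realize b = 0 -> e * b * e = 0.
Proof.
move=> b0; have [|I0|If] := B_exact.2 ker_ideal _ ker_ideal_coact.
- by rewrite /ker_ideal -prodvA prodvSr // subvf.
- apply/eqP; rewrite -memv0 -I0 -[e * b * e]mul1r -[1 * _]mulr1.
  by rewrite !memv_mul ?memvf ?corner_kerP // memv_ker b0.
have : e \in lker realize by rewrite (subvP ker_ideal_sub) // If memvf.
by rewrite memv_ker realize_e oner_eq0.
Qed.

Lemma realize_inj b c : realize b = realize c -> e * b * e = e * c * e.
Proof.
move=> bc; apply/eqP; rewrite -subr_eq0 -mulrBl -mulrBr corner_realize0 //.
by rewrite linearB /= bc subrr.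
Qed.

Lemma realization_is_aspace : is_aspace (limg realize).
Proof.
apply/andP; split.
  by apply: has_algid1; rewrite -realize_e memv_img ?memvf.
apply/prodvP=> _ _ /memv_imgP[b _ ->] /memv_imgP[c _ ->].
by rewrite -realize_mul memv_img ?memvf.
Qed.

Definition realization : {aspace H} := ASpace realization_is_aspace.

Lemma realization_coideal : left_coideal_subalgebra realization.
Proof.
split; first by rewrite -realize_e memv_img ?memvf.
apply/subvP=> _ /memv_imgP[_ /memv_imgP[b _ ->] ->].
by rewrite comul_realize tmap_limg.
Qed.

Notation A := (coideal_comodAlgebra realization_coideal).

Lemma realization_inj (a b : A) : vsval a = vsval b -> a = b.
Proof. exact: val_inj. Qed.

Definition to_realization : 'Hom(B, A) := (linfun (vsproj realization) \o realize)%VF.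

(** [realize^-1] is an arbitrary linear section; by [realize_inj] its choice disappears after
    compression to [e b e]. *)
Definition of_realization_ext : 'Hom(H, B) := (amulr e \o amull e \o realize^-1)%VF.

Definition of_realization : 'Hom(A, B) := (of_realization_ext \o linfun vsval)%VF.

Lemma to_realizationE b : vsval (to_realization b) = realize b.
Proof. by rewrite comp_lfunE lfunE /= vsprojK // memv_img ?memvf. Qed.

Lemma of_realization_extE b : of_realization_ext (realize b) = e * b * e.
Proof.
rewrite 2!comp_lfunE [amull e _]lfunE [amulr e _]lfunE /=.
by apply: realize_inj; rewrite limg_lfunVK ?memv_img ?memvf.
Qed.

Lemma of_realization_val (a : A) : of_realization a = of_realization_ext (vsval a).
Proof. by rewrite comp_lfunE [linfun vsval a]lfunE. Qed.

Lemma of_realizationE b : of_realization (to_realization b) = e * b * e.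
Proof. by rewrite of_realization_val to_realizationE of_realization_extE. Qed.

Lemma realizationP (a : A) : exists b, a = to_realization b.
Proof.
have /memv_imgP[b _ aE] := subvsP (a : subvs_of realization).
by exists b; apply: realization_inj; rewrite to_realizationE.
Qed.

Lemma of_realizationK : cancel of_realization to_realization.
Proof.
move=> a; have [b ->] := realizationP a; apply: realization_inj.
by rewrite of_realizationE !to_realizationE realize_be realize_eb.
Qed.

Lemma to_realization_mul b c :
  to_realization (b * e * c) = to_realization b * to_realization c.
Proof. by apply: realization_inj; rewrite /= !to_realizationE realize_mul. Qed.

Lemma of_realization_mul : {morph of_realization : a b / a * b}.
Proof.
move=> a a'; have [b ->] := realizationP a; have [c ->] := realizationP a'.
by rewrite -to_realization_mul !of_realizationE !mulrA -[_ * e * e]mulrA ee.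
Qed.

Lemma of_realization_one : of_realization 1 = e.
Proof.
have -> : 1 = to_realization e :> A.
  apply: realization_inj; rewrite to_realizationE realize_e.
  exact: (vsval_one realization_coideal).
by rewrite of_realizationE !ee.
Qed.

Lemma of_realization_coact a : tmul (tmul S (coact B (of_realization a))) T
  = tmap \1%VF of_realization (coact A a).
Proof.
have [b ->] := realizationP a; rewrite of_realizationE -twisted_coactE.
rewrite twisted_coact_be twisted_coact_eb.
rewrite -[\1%VF : 'End(H)]comp_lfun1l -tmap_comp.
have -> := coideal_coactE realization_coideal (to_realization b).
rewrite to_realizationE comul_realize tmap_comp comp_lfun1l.
have -> : (of_realization_ext \o realize)%VF = (amulr e \o amull e)%VF.
  apply/lfunP=> c; rewrite comp_lfunE of_realization_extE [RHS]comp_lfunE.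
  by rewrite [amull e _]lfunE [amulr e _]lfunE.
rewrite -{1}e_twisted_coact -{1}twisted_coact_e_r tmulA.
elim/tensor_ind: (twisted_coact b) => [h c|d s t IHs IHt].
  rewrite !tmulE mul1r mulr1 tmapE id_lfunE comp_lfunE [amull e _]lfunE.
  by rewrite [amulr e _]lfunE.
by rewrite tmulDr tmulDl lfun_combE IHs IHt.
Qed.

Lemma realization_equivalent : module_equivalent B A.
Proof.
exact: (corner_module_equivalent of_realization_mul of_realization_one
  of_realizationK of_realizationE re el lr rl ST TS eS of_realization_coact
  S_cocycle S_counit).
Qed.

(** [S] and [T] have degree 0 in both legs and [theta] vanishes in positive degrees, so only the
    part of [coact b] in [G i (x) GB 0] survives. *)
Lemma realize_degree i b : b \in GB i -> realize b \in G i.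
Proof.
move=> bG; have [_ _ coactG] := B_loewy; have [_ _ GM] := G_graded.
have [[_ _ GBM] _ _] := B_loewy.
rewrite realizeE twisted_coactE.
have : coact B b \in (\sum_(j < i.+1) tensv (G j) (GB (i - j)%N))%VS.
  by apply: (subvP (coactG i)); rewrite memv_img.
move/memv_sumP=> [t tG ->].
have Fsum : tmul (tmul S (\sum_(j < i.+1) t j)) T
    = \sum_(j < i.+1) tmul (tmul S (t j)) T.
  elim/big_rec2: _ => [|j s s' _ <-].
    by rewrite tmul0r tmul0l.
  by rewrite tmul_addr tmul_addl.
rewrite Fsum linear_sum; apply: rpred_sum => j _.
have := tmul_tensv (tmul_tensv S_deg0 (tG j isT)) T_deg0.
move: (tmul _ _) => s sG; rewrite memv_preim; apply: subvP sG.
apply: tensv_subP=> h c hG cG; rewrite -memv_preim theta_sliceE.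
have {}hG : h \in G j.
  apply: subvP hG; apply: subv_trans (prodvSl _ (GM _ _)) _.
  by apply: subv_trans (GM _ _) _; rewrite add0n addn0.
have {}cG : c \in GB (i - j)%N.
  apply: subvP cG; apply: subv_trans (prodvSl _ (GBM _ _)) _.
  by apply: subv_trans (GBM _ _) _; rewrite add0n addn0.
have [ij | ij] := eqVneq (i - j)%N 0%N.
  have -> : i = j by apply/eqP; rewrite eqn_leq -subn_eq0 ij eqxx -ltnS ltn_ord.
  exact: rpredZ.
suff -> : theta c = 0 by rewrite scale0r mem0v.
apply: (scale_inj Om_neq0); rewrite scale0r -thetaE (@pr_pos (i - j).-1).
  by rewrite mulr0 mul0r.
by rewrite prednK // lt0n.
Qed.

Lemma realization_homogeneous : is_homogeneous G realization.
Proof.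
have [[dG _] _ _] := G_graded; have [[[_ [N GBN]] _ _] _ _] := B_loewy.
split=> [m|].
  apply/directv_sum_independent=> us usG us0.
  have /directv_sum_independent ind := dG m; apply: (ind us) => // i _.
  by have /memv_capP[] := usG i isT.
exists N => m Nm; apply/eqP; rewrite eqEsubv; apply/andP; split.
  by apply/subv_sumP=> i _; apply: capvSl.
apply/subvP=> _ /memv_imgP[b _ ->].
have : b \in (\sum_(i < m) GB i)%VS by rewrite GBN ?memvf.
case/memv_sumP=> t tG ->; rewrite linear_sum; apply: memv_sumr => i _.
by rewrite memv_cap memv_img ?memvf // realize_degree ?tG.
Qed.

End Realization.

Theorem corner_realization : exists (A : {aspace H})
    (A_coideal : left_coideal_subalgebra A),
  is_homogeneous G A /\ module_equivalent B (coideal_comodAlgebra A_coideal).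
Proof.
have [GB_graded _ _] := B_loewy.
have [pr [pr_deg0 pr_id pr_pos pr_mul]] := graded_projection GB_graded.
have [theta thetaE] := eigenvalue_function pr_deg0.
exists (realization pr_id pr_mul thetaE).
exists (realization_coideal pr_id pr_mul thetaE).
split; first exact: realization_homogeneous.
exact: realization_equivalent.
Qed.

End CoidealRealization.

(** * The Kac-Paljutkin algebra in a basis adapted to its coalgebra structure *)

Section KacPaljutkin.
Variables (k : fieldType) (two : 2%:R != 0 :> k).
Variables (H : hopfAlgebra k) (K : {vspace H}) (x y z : H).
Hypothesis KE : (K = <<1 & [:: x; y; z]>>)%VS.
Hypothesis dimK : \dim K = 8%N.
Hypothesis xx : x * x = 1.
Hypothesis yy : y * y = 1.
Hypothesis yx : y * x = x * y.
Hypothesis zx : z * x = y * z.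
Hypothesis zy : z * y = x * z.
Hypothesis zz : z * z = 2%:R^-1 *: (1 + x + y - x * y).
Hypothesis comul_x : comul H x = x \ot x.
Hypothesis comul_y : comul H y = y \ot y.
Hypothesis comul_z : comul H z
  = 2%:R^-1 *: (((1 + y) * z) \ot z + ((1 - y) * z) \ot (x * z)).
Hypothesis counit_x : counit H x = 1.
Hypothesis counit_y : counit H y = 1.
Hypothesis counit_z : counit H z = 1.

(* The matrix ((kp_pos, kp_neg), (x kp_neg, x kp_pos)) is a comultiplicative
   basis of the 4-dimensional simple subcoalgebra. *)
Definition kp_pos : H := 2%:R^-1 *: (z + y * z).
Definition kp_neg : H := 2%:R^-1 *: (z - y * z).
Notation p := kp_pos.
Notation m := kp_neg.

Lemma xxA w : x * (x * w) = w. Proof. by rewrite mulrA xx mul1r. Qed.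
Lemma yyA w : y * (y * w) = w. Proof. by rewrite mulrA yy mul1r. Qed.
Lemma yxA w : y * (x * w) = x * (y * w). Proof. by rewrite !mulrA yx. Qed.
Lemma zxA w : z * (x * w) = y * (z * w). Proof. by rewrite !mulrA zx. Qed.
Lemma zyA w : z * (y * w) = x * (z * w). Proof. by rewrite !mulrA zy. Qed.

Let expand := (mulrDl, mulrDr, mulrN, mulNr, mul1r, mulr1, scalerDr, scalerN,
  =^~ scalerAl, =^~ scalerAr, scalerA).
(** Relations oriented for rewriting, with variants for right-associated products: [x] moves left
    and [z] moves right, towards words x^a y^b z^c. *)
Let words := (xx, yy, yx, zx, zy, zz, xxA, yyA, yxA, zxA, zyA).
Ltac kp := rewrite /kp_pos /kp_neg; do 6! rewrite -?mulrA ?expand ?words; linear_identity.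

Lemma y_pos : y * p = p. Proof. by kp. Qed.
Lemma y_neg : y * m = - m. Proof. by kp. Qed.
Lemma pos_x : p * x = p. Proof. by kp. Qed.
Lemma neg_x : m * x = - m. Proof. by kp. Qed.
Lemma pos_y : p * y = x * p. Proof. by kp. Qed.
Lemma neg_y : m * y = x * m. Proof. by kp. Qed.
Lemma z_pos : z * p = 2%:R^-1 *: (1 + x). Proof. by kp. Qed.
Lemma z_neg : z * m = 2%:R^-1 *: (y - x * y). Proof. by kp. Qed.

Lemma pos_mul w : p * w = 2%:R^-1 *: (z * w + y * (z * w)).
Proof. by rewrite -scalerAl mulrDl mulrA. Qed.

Lemma neg_mul w : m * w = 2%:R^-1 *: (z * w - y * (z * w)).
Proof. by rewrite -scalerAl mulrBl mulrA. Qed.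

Notation q := (2%:R^-1 * 2%:R^-1 : k).
Lemma pos_pos : p * p = q *: (1 + x + y + x * y).
Proof. by rewrite pos_mul z_pos !expand !words ?expand; linear_identity. Qed.
Lemma pos_neg : p * m = q *: (1 - x + y - x * y).
Proof. by rewrite pos_mul z_neg !expand !words ?expand; linear_identity. Qed.
Lemma neg_pos : m * p = q *: (1 + x - y - x * y).
Proof. by rewrite neg_mul z_pos !expand !words ?expand; linear_identity. Qed.
Lemma neg_neg : m * m = - q *: (1 - x - y + x * y).
Proof. by rewrite neg_mul z_neg !expand !words ?expand; linear_identity. Qed.

Lemma comul_xy : comul H (x * y) = (x * y) \ot (x * y).
Proof. by rewrite comul_mul comul_x comul_y tmulE. Qed.

Lemma comul_zE : comul H z = p \ot z + m \ot (x * z).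
Proof.
by rewrite comul_z scalerDr -!tpureZl /kp_pos /kp_neg mulrDl mulrBl mul1r.
Qed.

Lemma comul_pos : comul H p = p \ot p + m \ot (x * m).
Proof.
rewrite {1}/kp_pos linearZ linearD /= comul_mul comul_y comul_zE.
rewrite !tmul_expandE y_pos y_neg /kp_pos /kp_neg. rewrite !tpureE !(mulrDr, mulrN, =^~ scalerAr) yxA !tpureE.
by linear_identity.
Qed.

Lemma comul_neg : comul H m = p \ot m + m \ot (x * p).
Proof.
rewrite {1}/kp_neg linearZ linearB /= comul_mul comul_y comul_zE.
rewrite !tmul_expandE y_pos y_neg /kp_pos /kp_neg. rewrite !tpureE !(mulrDr, mulrN, =^~ scalerAr) yxA !tpureE.
by linear_identity.
Qed.

Lemma comul_x_neg : comul H (x * m) = (x * m) \ot p + (x * p) \ot (x * m).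
Proof.
by rewrite comul_mul comul_x comul_neg !tmul_expandE xxA addrC.
Qed.

Lemma comul_x_pos : comul H (x * p) = (x * p) \ot (x * p) + (x * m) \ot m.
Proof. by rewrite comul_mul comul_x comul_pos !tmul_expandE xxA. Qed.

Lemma counit_pos : counit H p = 1.
Proof.
rewrite /kp_pos linearZ linearD /= counit_mul counit_y counit_z mulr1.
by rewrite -[1 + 1]/(2%:R) [_ *: _]mulVf.
Qed.

Lemma counit_neg : counit H m = 0.
Proof.
rewrite /kp_neg linearZ linearB /= counit_mul counit_y counit_z mulr1.
by rewrite subrr scaler0.
Qed.

(** The four group-likes come first, then the 2 x 2 comultiplicative matrix row by row. Positions 0
    to 7 are the indices of [kp_dual] and [kp_component] below. *)
Definition kp_words : 8.-tuple H := [tuple 1; x; y; x * y; p; m; x * m; x * p].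

(** The span of the words contains 1 and is stable under left multiplication by the generators,
    hence contains the algebra they generate. *)
Lemma kp_span : (K <= <<kp_words>>)%VS.
Proof.
have kw w : w \in kp_words -> w \in <<kp_words>>%VS by move/memv_span.
rewrite KE; apply: agenv_sub_modl.
  by rewrite -[1%VS]/(<[1]>)%VS -memvE kw // !inE eqxx.
rewrite prodvDl subv_add; apply/andP; split; first by rewrite prod1v.
have act u w : u \in [:: x; y; z] -> w \in kp_words -> u * w \in <<kp_words>>%VS.
  have zxp : z * (x * p) = 2%:R^-1 *: (y + x * y) by kp.
  have zxm : z * (x * m) = 2%:R^-1 *: (1 - x) by kp.
  have z1 : z = p + m by kp.
  have zx' : z * x = p - m by kp.
  have zy' : z * y = x * p + x * m by kp.
  have zxy : z * (x * y) = x * p - x * m by kp.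
  rewrite inE -!in_cons => ux wW.
  have : [|| w == 1, w == x, w == y, w == x * y, w == p, w == m, w == x * m
           | w == x * p] by move: wW; rewrite !inE.
  have {ux} : [|| u == x, u == y | u == z] by move: ux; rewrite !inE.
  by case/or3P=> /eqP->; do ![case/orP]; move=> /eqP->;
    rewrite ?mulr1 ?(mulr1, z_pos, z_neg, zxp, zxm, zx', zy', zxy, xx, yy, yx, xxA, yxA, y_pos, y_neg, mulrN) ?[z in z \in _]z1;
    do ?[by apply/kw; rewrite !inE ?eqxx ?orbT | rewrite rpredN
        | apply: rpredZ | apply: rpredD | apply: rpredB].
apply/prodvP=> u v uX vW.
have uW w : w \in kp_words -> u * w \in <<kp_words>>%VS.
  move=> wW; have: (amulr w @: <<[:: x; y; z]>> <= <<kp_words>>)%VS.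
    rewrite limg_span; apply/span_subvP=> _ /mapP[t tX ->].
    by rewrite lfunE; apply: act.
  by move/subvP=> /(_ _ (memv_img (amulr w) uX)); rewrite lfunE.
have: (amull u @: <<kp_words>> <= <<kp_words>>)%VS.
  by rewrite limg_span; apply/span_subvP=> _ /mapP[t tX ->]; rewrite lfunE; apply: uW.
by move/subvP=> /(_ _ (memv_img (amull u) vW)); rewrite lfunE.
Qed.

(** Independence by counting: eight words span a space containing [K], which has dimension 8. *)
Lemma kp_free : free kp_words.
Proof.
rewrite /free eqn_leq dim_span /= -dimK; apply: dimvS; exact: kp_span.
Qed.

Lemma kp_spanE : K = <<kp_words>>%VS.
Proof.
by apply/eqP; rewrite eqEdim kp_span dimK dim_span.
Qed.

Definition kp_dual (i : 'I_8) : 'Hom(H, k^o) := linfun (coord kp_words i : H -> k^o).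

Lemma kp_dual_words (i j : 'I_8) : kp_dual i (nth 0 kp_words j) = (i == j)%:R :> k.
Proof. by rewrite lfunE /= coord_free ?kp_free // eq_sym. Qed.

Lemma kp_dual1 (i : 'I_8) : kp_dual i 1 = (i == 0%N :> nat)%:R :> k.
Proof. exact: (kp_dual_words i (@Ordinal 8 0 isT)). Qed.
Lemma kp_dual_x (i : 'I_8) : kp_dual i x = (i == 1%N :> nat)%:R :> k.
Proof. exact: (kp_dual_words i (@Ordinal 8 1 isT)). Qed.
Lemma kp_dual_y (i : 'I_8) : kp_dual i y = (i == 2%N :> nat)%:R :> k.
Proof. exact: (kp_dual_words i (@Ordinal 8 2 isT)). Qed.
Lemma kp_dual_xy (i : 'I_8) : kp_dual i (x * y) = (i == 3%N :> nat)%:R :> k.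
Proof. exact: (kp_dual_words i (@Ordinal 8 3 isT)). Qed.
Lemma kp_dual_pos (i : 'I_8) : kp_dual i p = (i == 4%N :> nat)%:R :> k.
Proof. exact: (kp_dual_words i (@Ordinal 8 4 isT)). Qed.
Lemma kp_dual_neg (i : 'I_8) : kp_dual i m = (i == 5%N :> nat)%:R :> k.
Proof. exact: (kp_dual_words i (@Ordinal 8 5 isT)). Qed.
Lemma kp_dual_x_neg (i : 'I_8) : kp_dual i (x * m) = (i == 6%N :> nat)%:R :> k.
Proof. exact: (kp_dual_words i (@Ordinal 8 6 isT)). Qed.
Lemma kp_dual_x_pos (i : 'I_8) : kp_dual i (x * p) = (i == 7%N :> nat)%:R :> k.
Proof. exact: (kp_dual_words i (@Ordinal 8 7 isT)). Qed.

Definition kp_dualE := (kp_dual1, kp_dual_x, kp_dual_y, kp_dual_xy, kp_dual_pos,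
  kp_dual_neg, kp_dual_x_neg, kp_dual_x_pos).

(** * Homogeneous components and their products *)

Section Comodule.
Variable B : comodAlgebra H.
Implicit Types (a b u v w : B).

(** The dual basis acting on [B]. It is informative only when the coaction has first legs in [K]:
    indices 0 to 3 then project onto group-like components, 4 to 7 act as matrix units on the
    V-part. *)
Definition kp_component i : 'End(B) := (slice B (kp_dual i) \o coact B)%VF.

Lemma kp_component_coact i b : kp_component i b = slice B (kp_dual i) (coact B b).
Proof. exact: comp_lfunE. Qed.

Lemma kp_coact_expand b : coact B b \in tensv K fullv ->
  coact B b = 1 \ot kp_component (@Ordinal 8 0 isT) b
    + x \ot kp_component (@Ordinal 8 1 isT) b
    + y \ot kp_component (@Ordinal 8 2 isT) b
    + (x * y) \ot kp_component (@Ordinal 8 3 isT) b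
    + p \ot kp_component (@Ordinal 8 4 isT) b
    + m \ot kp_component (@Ordinal 8 5 isT) b
    + (x * m) \ot kp_component (@Ordinal 8 6 isT) b
    + (x * p) \ot kp_component (@Ordinal 8 7 isT) b.
Proof.
rewrite !kp_component_coact.
pose pr h : H := \sum_i (coord kp_words i h) *: kp_words`_i.
have prL : linear pr.
  move=> c g h; rewrite /pr scaler_sumr -big_split; apply: eq_bigr=> i _ /=.
  by rewrite linearP scalerDl scalerA.
move: (coact B b) => t tK.
have tE : tmap (linfun pr) \1%VF t = \sum_(i < 8) kp_words`_i \ot slice B (kp_dual i) t.
  elim/tensor_ind: (t) => [h v|c s s' IHs IHs'].
    rewrite tmapE id_lfunE (linfun_linearE prL) tpure_suml; apply: eq_bigr=> i _.
    by rewrite sliceE tpureZl tpureZr lfunE.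
  rewrite !lfun_combE IHs IHs' scaler_sumr -big_split; apply: eq_bigr=> i _.
  by rewrite lfun_combE tpureDr.
have : t \in lker (tmap (linfun pr) \1%VF - \1%VF).
  apply: subvP tK; apply: tensv_subP=> h v hK _; rewrite memv_ker add_lfunE.
  rewrite opp_lfunE id_lfunE tmapE id_lfunE (linfun_linearE prL) /pr.
  by rewrite -coord_span ?subrr // -kp_spanE.
rewrite memv_ker add_lfunE opp_lfunE id_lfunE subr_eq0 => /eqP {1}<-; rewrite tE.
rewrite !big_ord_recr big_ord0 /= add0r.
by do !congr (_ + _); congr (_ \ot _); congr (fun_of_lfun (slice B (kp_dual _)) t);
  apply: val_inj.
Qed.

Definition homog (g : H) u := coact B u = g \ot u.
(* w, w' is the image of the standard basis of the 2-dimensional simple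
   comodule under a comodule map, hence is (0, 0) or linearly independent. *)
Definition kp_pair w w' :=
  coact B w = p \ot w + m \ot w' /\ coact B w' = (x * m) \ot w + (x * p) \ot w'.

Notation cmp i := (kp_component (@Ordinal 8 i isT)).

Lemma coact_component i b : coact B b \in tensv K fullv ->
  coact B (kp_component i b)
  = slice H (kp_dual i) (comul H 1) \ot cmp 0 b
    + slice H (kp_dual i) (comul H x) \ot cmp 1 b
    + slice H (kp_dual i) (comul H y) \ot cmp 2 b
    + slice H (kp_dual i) (comul H (x * y)) \ot cmp 3 b
    + slice H (kp_dual i) (comul H p) \ot cmp 4 b
    + slice H (kp_dual i) (comul H m) \ot cmp 5 b
    + slice H (kp_dual i) (comul H (x * m)) \ot cmp 6 b
    + slice H (kp_dual i) (comul H (x * p)) \ot cmp 7 b.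
Proof.
move/kp_coact_expand=> bE; rewrite [in LHS]kp_component_coact coact_slice bE.
by rewrite !lfun_addE !tmapE !comp_lfunE !id_lfunE.
Qed.

Let comulE := (comul_one, comul_x, comul_y, comul_xy, comul_pos, comul_neg,
  comul_x_neg, comul_x_pos).
Ltac component_coact := rewrite coact_component // ?comulE ?linearD /= !sliceE
  !kp_dualE /= !(scale0r, scale1r, addr0, add0r, tpure0l).

Section Components.
Variables (b : B) (bK : coact B b \in tensv K fullv).

Lemma homog_component0 : homog 1 (cmp 0 b).
Proof. by rewrite /homog; component_coact. Qed.

Lemma homog_component1 : homog x (cmp 1 b).
Proof. by rewrite /homog; component_coact. Qed.

Lemma homog_component2 : homog y (cmp 2 b).
Proof. by rewrite /homog; component_coact. Qed.

Lemma homog_component3 : homog (x * y) (cmp 3 b).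
Proof. by rewrite /homog; component_coact. Qed.

Lemma pair_component4 : kp_pair (cmp 4 b) (cmp 5 b).
Proof. by split; component_coact. Qed.

Lemma pair_component6 : kp_pair (cmp 6 b) (cmp 7 b).
Proof. by split; component_coact. Qed.

(** The counit is 1 on the group-likes and on the diagonal entries [p], [x p], and 0 on [m], [x m];
    so components 5 and 6 drop out. *)
Lemma component_sum :
  b = cmp 0 b + cmp 1 b + cmp 2 b + cmp 3 b + cmp 4 b + cmp 7 b.
Proof.
transitivity (slice B (counit H) (coact B b)); first by rewrite -[LHS]coact_counit.
rewrite kp_coact_expand // !lfun_addE !sliceE !counit_mul counit_one.
rewrite counit_x counit_y counit_pos counit_neg !mulr1 !mulr0 !scale1r !scale0r.
by rewrite !addr0.
Qed.

End Components.

Lemma homog_component i g u : homog g u -> kp_component i u = (kp_dual i g : k) *: u.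
Proof. by move=> gu; rewrite kp_component_coact gu sliceE. Qed.

Lemma pair_componentl i w w' : kp_pair w w' ->
  kp_component i w = (i == 4%N :> nat)%:R *: w + (i == 5%N :> nat)%:R *: w'.
Proof. by case=> wE _; rewrite kp_component_coact wE linearD /= !sliceE !kp_dualE. Qed.

Lemma pair_componentr i w w' : kp_pair w w' ->
  kp_component i w' = (i == 6%N :> nat)%:R *: w + (i == 7%N :> nat)%:R *: w'.
Proof. by case=> _ wE; rewrite kp_component_coact wE linearD /= !sliceE !kp_dualE. Qed.

Lemma pair_componentlN i w w' : kp_pair (- w) w' ->
  kp_component i w = (i == 4%N :> nat)%:R *: w - (i == 5%N :> nat)%:R *: w'.
Proof.
move=> wP; rewrite -{1}[w]opprK lfun_oppE (pair_componentl _ wP).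
by rewrite scalerN opprD opprK.
Qed.

Lemma pair_componentrN i w w' : kp_pair w (- w') ->
  kp_component i w' = - (i == 6%N :> nat)%:R *: w + (i == 7%N :> nat)%:R *: w'.
Proof.
move=> wP; rewrite -{1}[w']opprK lfun_oppE (pair_componentr _ wP).
by rewrite scalerN opprD opprK scaleNr.
Qed.

Lemma homogM g h u v : homog g u -> homog h v -> homog (g * h) (u * v).
Proof. by rewrite /homog coact_mul => -> ->; rewrite tmulE. Qed.

Lemma homogZ g c u : homog g u -> homog g (c *: u).
Proof. by rewrite /homog linearZ /= => ->; rewrite tpureZr. Qed.

Lemma homog1 : homog 1 1.
Proof. exact: coact_one. Qed.

Lemma pair_comb c w w' v v' : kp_pair w w' -> kp_pair v v' ->
  kp_pair (c *: w + v) (c *: w' + v').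
Proof.
by move=> [w1 w2] [v1 v2]; split; rewrite lfun_combE ?w1 ?w2 ?v1 ?v2
  !tpureDr scalerDr addrACA.
Qed.

Lemma pairZ c w w' : kp_pair w w' -> kp_pair (c *: w) (c *: w').
Proof.
by move=> [w1 w2]; split; rewrite linearZ /= ?w1 ?w2 !tpureZr scalerDr.
Qed.

(** Tensoring V with a group-like on either side gives V again; this lemma and the following ones
    write the isomorphism in the standard basis. Their signs and swaps cause every anticommutation
    used later. *)
Lemma pair_mul_x u w w' : homog x u -> kp_pair w w' -> kp_pair (w * u) (- (w' * u)).
Proof.
move=> uE [w1 w2]; split; rewrite ?linearN /= coact_mul uE ?w1 ?w2 !tmul_expandE
  -?mulrA pos_x neg_x ?mulrN !tpureE //.
by rewrite opprD opprK.
Qed.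

Lemma pair_x_mul u w w' : homog x u -> kp_pair w w' -> kp_pair (u * w') (u * w).
Proof.
by move=> uE [w1 w2]; split; rewrite coact_mul uE ?w1 ?w2 !tmul_expandE ?xxA // addrC.
Qed.

Lemma pair_mul_y u w w' : homog y u -> kp_pair w w' -> kp_pair (w' * u) (w * u).
Proof.
by move=> uE [w1 w2]; split; rewrite coact_mul uE ?w1 ?w2 !tmul_expandE
  -?mulrA pos_y neg_y ?xxA // addrC.
Qed.

Lemma pair_y_mul u w w' : homog y u -> kp_pair w w' -> kp_pair (u * w) (- (u * w')).
Proof.
move=> uE [w1 w2]; split; rewrite ?linearN /= coact_mul uE ?w1 ?w2 !tmul_expandE
  ?yxA y_pos y_neg ?mulrN !tpureE //.
by rewrite opprD opprK.
Qed.

Lemma pair_mul_xy u w w' : homog (x * y) u -> kp_pair w w' -> kp_pair (- (w' * u)) (w * u).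
Proof.
move=> uE [w1 w2]; split; rewrite ?linearN /= coact_mul uE ?w1 ?w2 !tmul_expandE
  -?mulrA !(mulrA p x) !(mulrA m x) pos_x neg_x ?mulNr ?pos_y ?neg_y ?mulrN ?xxA
  !tpureE ?opprD ?opprK //; exact: addrC.
Qed.

Lemma pair_xy_mul u w w' : homog (x * y) u -> kp_pair w w' -> kp_pair (- (u * w')) (u * w).
Proof.
move=> uE [w1 w2]; split; rewrite ?linearN /= coact_mul uE ?w1 ?w2 !tmul_expandE
  -?mulrA ?yxA ?xxA y_pos y_neg ?mulrN !tpureE ?opprD ?opprK //; exact: addrC.
Qed.

Lemma pair_mul_1 u w w' : homog 1 u -> kp_pair w w' -> kp_pair (w * u) (w' * u).
Proof.
by move=> uE [w1 w2]; split; rewrite coact_mul uE ?w1 ?w2 !tmul_expandE !mulr1.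
Qed.

Section PairProducts.
Variables (w w' v v' : B).

(* The homogeneous components, up to the factor 4, of the product w v. *)
Definition pair_prod1 := w * v + w * v' + w' * v - w' * v'.
Definition pair_prod_x := w * v - w * v' + w' * v + w' * v'.
Definition pair_prod_y := w * v + w * v' - w' * v + w' * v'.
Definition pair_prod_xy := w * v - w * v' - w' * v - w' * v'.

Hypotheses (wP : kp_pair w w') (vP : kp_pair v v').

Let w1 : coact B w = _ := proj1 wP.
Let w2 : coact B w' = _ := proj2 wP.
Let v1 : coact B v = _ := proj1 vP.
Let v2 : coact B v' = _ := proj2 vP.

Ltac pair_product := rewrite /pair_prod1 /pair_prod_x /pair_prod_y /pair_prod_xy;
  rewrite coact_mul ?w1 ?w2 ?v1 ?v2 !tmul_expandE;
  rewrite -?mulrA ?[p * (x * _)]mulrA ?[m * (x * _)]mulrA ?pos_x ?neg_x ?mulNr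
    ?pos_pos ?pos_neg ?neg_pos ?neg_neg ?mulrN -?scalerAr ?mulrDr ?mulrN ?mulr1 ?xx ?xxA
    ?tpureE;
  linear_identity.

(** V (x) V is the sum of the four one-dimensional comodules; the signs come from the products of
    [p] and [m]. *)
Lemma coact_pair_mul11 : coact B (w * v) = (2%:R^-1 * 2%:R^-1) *:
  (1 \ot pair_prod1 + x \ot pair_prod_x + y \ot pair_prod_y
   + (x * y) \ot pair_prod_xy).
Proof. by pair_product. Qed.

Lemma coact_pair_mul12 : coact B (w * v') = (2%:R^-1 * 2%:R^-1) *:
  (1 \ot pair_prod1 - x \ot pair_prod_x + y \ot pair_prod_y
   - (x * y) \ot pair_prod_xy).
Proof. by pair_product. Qed.

Lemma coact_pair_mul21 : coact B (w' * v) = (2%:R^-1 * 2%:R^-1) *: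
  (1 \ot pair_prod1 + x \ot pair_prod_x - y \ot pair_prod_y
   - (x * y) \ot pair_prod_xy).
Proof. by pair_product. Qed.

Lemma coact_pair_mul22 : coact B (w' * v') = (2%:R^-1 * 2%:R^-1) *:
  (- (1 \ot pair_prod1) + x \ot pair_prod_x + y \ot pair_prod_y
   - (x * y) \ot pair_prod_xy).
Proof. by pair_product. Qed.

Lemma homog_pair_prod1 : homog 1 pair_prod1.
Proof.
rewrite /homog {1}/pair_prod1 !lfun_linE.
by rewrite coact_pair_mul11 coact_pair_mul12 coact_pair_mul21 coact_pair_mul22;
  linear_identity.
Qed.

Lemma homog_pair_prod_x : homog x pair_prod_x.
Proof.
rewrite /homog {1}/pair_prod_x !lfun_linE.
by rewrite coact_pair_mul11 coact_pair_mul12 coact_pair_mul21 coact_pair_mul22;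
  linear_identity.
Qed.

Lemma homog_pair_prod_y : homog y pair_prod_y.
Proof.
rewrite /homog {1}/pair_prod_y !lfun_linE.
by rewrite coact_pair_mul11 coact_pair_mul12 coact_pair_mul21 coact_pair_mul22;
  linear_identity.
Qed.

Lemma homog_pair_prod_xy : homog (x * y) pair_prod_xy.
Proof.
rewrite /homog {1}/pair_prod_xy !lfun_linE.
by rewrite coact_pair_mul11 coact_pair_mul12 coact_pair_mul21 coact_pair_mul22;
  linear_identity.
Qed.

End PairProducts.

(** V (x) V contains no copy of V, so only the group-like components of [b] contribute. Degrees 1
    and [x] keep the positions in a pair, while [y] and [x y] exchange them. *)
Lemma mul_component4 b w w' : coact B b \in tensv K fullv -> kp_pair w w' ->
  cmp 4 (w * b) = w * cmp 0 b + w * cmp 1 b /\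
  cmp 4 (w' * b) = w' * cmp 2 b + w' * cmp 3 b.
Proof.
move=> bK wP.
have w0 := pair_mul_1 (homog_component0 bK) wP.
have wx := pair_mul_x (homog_component1 bK) wP.
have wy := pair_mul_y (homog_component2 bK) wP.
have wxy := pair_mul_xy (homog_component3 bK) wP.
have p4 := pair_component4 bK; have p6 := pair_component6 bK.
split.
  rewrite {1}(component_sum bK) !mulrDr !lfun_addE.
  rewrite (pair_componentl _ w0) (pair_componentl _ wx) (pair_componentr _ wy).
  rewrite (pair_componentr _ wxy).
  rewrite [cmp 4 (w * cmp 4 b)]kp_component_coact (coact_pair_mul11 wP p4).
  rewrite [cmp 4 (w * cmp 7 b)]kp_component_coact (coact_pair_mul12 wP p6).
  rewrite !lfun_linE !sliceE !kp_dualE /=.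
  by rewrite !scale1r !scale0r; linear_identity.
rewrite {1}(component_sum bK) !mulrDr !lfun_addE.
rewrite (pair_componentr _ w0) (pair_componentl _ wy).
rewrite (pair_componentrN _ wx) (pair_componentlN _ wxy).
rewrite [cmp 4 (w' * cmp 4 b)]kp_component_coact (coact_pair_mul21 wP p4).
rewrite [cmp 4 (w' * cmp 7 b)]kp_component_coact (coact_pair_mul22 wP p6).
rewrite !lfun_linE !sliceE !kp_dualE /=.
by rewrite !scale1r !scale0r; linear_identity.
Qed.

Lemma mul_component0 b w w' : coact B b \in tensv K fullv -> kp_pair w w' ->
  cmp 0 (w * b) = (2%:R^-1 * 2%:R^-1) *:
    (pair_prod1 w w' (cmp 4 b) (cmp 5 b) + pair_prod1 w w' (cmp 6 b) (cmp 7 b)) /\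
  cmp 0 (w' * b) = (2%:R^-1 * 2%:R^-1) *:
    (pair_prod1 w w' (cmp 4 b) (cmp 5 b) - pair_prod1 w w' (cmp 6 b) (cmp 7 b)).
Proof.
move=> bK wP.
have w0 := pair_mul_1 (homog_component0 bK) wP.
have wx := pair_mul_x (homog_component1 bK) wP.
have wy := pair_mul_y (homog_component2 bK) wP.
have wxy := pair_mul_xy (homog_component3 bK) wP.
have p4 := pair_component4 bK; have p6 := pair_component6 bK.
split.
  rewrite {1}(component_sum bK) !mulrDr !lfun_addE.
  rewrite (pair_componentl _ w0) (pair_componentl _ wx) (pair_componentr _ wy).
  rewrite (pair_componentr _ wxy).
  rewrite [cmp 0 (w * cmp 4 b)]kp_component_coact (coact_pair_mul11 wP p4).
  rewrite [cmp 0 (w * cmp 7 b)]kp_component_coact (coact_pair_mul12 wP p6).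
  rewrite !lfun_linE !sliceE !kp_dualE /=.
  by rewrite !scale1r !scale0r; linear_identity.
rewrite {1}(component_sum bK) !mulrDr !lfun_addE.
rewrite (pair_componentr _ w0) (pair_componentl _ wy).
rewrite (pair_componentrN _ wx) (pair_componentlN _ wxy).
rewrite [cmp 0 (w' * cmp 4 b)]kp_component_coact (coact_pair_mul21 wP p4).
rewrite [cmp 0 (w' * cmp 7 b)]kp_component_coact (coact_pair_mul22 wP p6).
rewrite !lfun_linE !sliceE !kp_dualE /=.
by rewrite !scale1r !scale0r; linear_identity.
Qed.

(** * Simple comodule algebras over the Kac-Paljutkin algebra *)

Section Classification.
Variable B0 : {vspace B}.
Hypothesis B0P : forall b, (b \in B0) = (coact B b \in tensv K fullv).
Hypothesis B0M : forall b c, b \in B0 -> c \in B0 -> b * c \in B0.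
Hypothesis coinv : forall u, homog 1 u -> exists c, u = c *: 1.
Hypothesis homog_unit : forall g u, homog g u -> u != 0 -> exists a, u * a = 1.
Hypothesis pair_unit : forall w w', kp_pair w w' -> w != 0 ->
  exists a a', [/\ a \in B0, a' \in B0 & w * a + w' * a' = 1].
Hypothesis pair_mem : forall w w', kp_pair w w' -> w \in B0.
Hypothesis sqrt_ex : forall c : k, exists d, d * d = c.

(** * The multiplicity space of V and normalized group-like components *)

Lemma pair_snd w w' : kp_pair w w' -> w' = cmp 5 w.
Proof. by move/pair_componentl->; rewrite scale0r add0r scale1r. Qed.

Lemma pair_inj w v v' : kp_pair w v -> kp_pair w v' -> v = v'.
Proof. by move=> /pair_snd-> /pair_snd->. Qed.

Lemma pair_fst w w' : kp_pair w w' -> w = cmp 4 w.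
Proof. by move/pair_componentl->; rewrite scale0r addr0 scale1r. Qed.

Lemma pair_fst_snd w w' : kp_pair w w' -> w = cmp 6 w'.
Proof. by move/pair_componentr->; rewrite scale0r addr0 scale1r. Qed.

Lemma pair_snd_eq0 w : kp_pair w 0 -> w = 0.
Proof. by move/pair_fst_snd->; exact: linear0. Qed.

(** Irreducibility of the multiplicity space: write [v = w (a v) + w' (a' v)] using [pair_unit] and
    take component 4, which fixes [v] and by [mul_component4] retains only group-like components. *)
Lemma pair_generate w w' v v' : kp_pair w w' -> w != 0 -> kp_pair v v' ->
  exists c a1 a2 a3, [/\ homog x a1, homog y a2, homog (x * y) a3
    & v = c *: w + w * a1 + w' * a2 + w' * a3].
Proof.
move=> wP w0 vP; have [a [a' [aB a'B E]]] := pair_unit wP w0.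
have vB := pair_mem vP.
have avK : coact B (a * v) \in tensv K fullv by rewrite -B0P B0M.
have a'vK : coact B (a' * v) \in tensv K fullv by rewrite -B0P B0M.
have [E1 _] := mul_component4 avK wP; have [_ E2] := mul_component4 a'vK wP.
have [c cE] := coinv (homog_component0 avK).
exists c, (cmp 1 (a * v)), (cmp 2 (a' * v)), (cmp 3 (a' * v)); split.
- exact: homog_component1.
- exact: homog_component2.
- exact: homog_component3.
rewrite {1}(pair_fst vP) -[v in LHS]mul1r -E mulrDl -!mulrA lfun_addE E1 E2 cE.
by rewrite -scalerAr mulr1 !addrA.
Qed.

(** Taking trivial components in [w a + w' a' = 1] expresses 1 through values of [pair_prod1], so
    these cannot all vanish. *)
Lemma pair_nondegenerate w w' : kp_pair w w' -> w != 0 ->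
  exists v v', kp_pair v v' /\ pair_prod1 w w' v v' != 0.
Proof.
move=> wP w0; have [a [a' [aB a'B E]]] := pair_unit wP w0.
rewrite !B0P in aB a'B.
have [E1 _] := mul_component0 aB wP; have [_ E2] := mul_component0 a'B wP.
have E0 : cmp 0 (1 : B) = 1 by rewrite (homog_component _ homog1) kp_dualE scale1r.
have [Z1|] := eqVneq (pair_prod1 w w' (cmp 4 a) (cmp 5 a)) 0; last first.
  by move=> nz; exists (cmp 4 a), (cmp 5 a); split; first exact: pair_component4.
have [Z2|] := eqVneq (pair_prod1 w w' (cmp 6 a) (cmp 7 a)) 0; last first.
  by move=> nz; exists (cmp 6 a), (cmp 7 a); split; first exact: pair_component6.
have [Z3|] := eqVneq (pair_prod1 w w' (cmp 4 a') (cmp 5 a')) 0; last first.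
  by move=> nz; exists (cmp 4 a'), (cmp 5 a'); split; first exact: pair_component4.
have [Z4|] := eqVneq (pair_prod1 w w' (cmp 6 a') (cmp 7 a')) 0; last first.
  by move=> nz; exists (cmp 6 a'), (cmp 7 a'); split; first exact: pair_component6.
have /eqP := E0; rewrite -E lfun_addE E1 E2 Z1 Z2 Z3 Z4.
by rewrite subrr addr0 scaler0 addr0 E eq_sym oner_eq0.
Qed.

(** [u u] is coinvariant, hence scalar, and nonzero since [u] has a right inverse; a square root
    rescales it to 1. *)
Lemma homog_normalize g u : g * g = 1 -> homog g u -> u != 0 ->
  exists X : B, homog g X /\ X * X = 1.
Proof.
move=> gg uP u0; have [c cE] : exists c, u * u = c *: 1.
  by apply: coinv; rewrite -gg; apply: homogM.
have c0 : c != 0.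
  apply/eqP=> c0; have [a aE] := homog_unit uP u0; case/negP: u0.
  by rewrite -[u]mulr1 -aE mulrA cE c0 scale0r mul0r.
have [d dE] := sqrt_ex c; have d0 : d != 0.
  by apply: contraNneq c0 => d0; rewrite -dE d0 mul0r.
exists (d^-1 *: u); split; first exact: homogZ.
rewrite -scalerAl -scalerAr cE !scalerA -dE mulrA -[_ * d^-1 * d]mulrA.
by rewrite mulVf // mulr1 mulVf // scale1r.
Qed.

Lemma homog_multiple g (X u : B) : g * g = 1 -> homog g X -> X * X = 1 -> homog g u ->
  exists c, u = c *: X.
Proof.
move=> gg XP XX uP; have [c cE] : exists c, u * X = c *: 1.
  by apply: coinv; rewrite -gg; apply: homogM.
by exists c; rewrite -[u]mulr1 -XX mulrA cE -scalerAl mul1r.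
Qed.

Lemma xyxy : x * y * (x * y) = 1.
Proof. by rewrite -mulrA [y * _]mulrA yx !mulrA xx mul1r yy. Qed.

(** [X Y] and [Y X] have the same degree, so [Y X = c X Y]; moving [Y] past [X] twice gives
    [c^2 = 1]. *)
Lemma homog_xy_commute (X Y : B) : homog x X -> homog y Y -> X * X = 1 -> Y * Y = 1 ->
  Y * X = X * Y \/ Y * X = - (X * Y).
Proof.
move=> XP YP XX YY; have [c cE] : exists c, Y * X * (Y * X) = c *: 1.
  by apply: coinv; have := homogM (homogM YP XP) (homogM YP XP); rewrite yx xyxy.
have E : Y * X = c *: (X * Y).
  have inv : Y * X * (X * Y) = 1 by rewrite -mulrA [X * (X * Y)]mulrA XX mul1r.
  by rewrite -[LHS]mulr1 -inv mulrA cE -scalerAl mul1r.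
have : c * c = 1.
  have : Y = (c * c) *: Y.
    rewrite -{1}[Y]mulr1 -{1}XX mulrA E -scalerAl -mulrA E.
    by rewrite -scalerAr scalerA mulrA XX mul1r.
  move=> /(congr1 (fun t => t * Y)); rewrite -scalerAl YY => /eqP.
  rewrite -subr_eq0 -{1}[1]scale1r -scalerBl scaler_eq0 oner_eq0 orbF.
  by rewrite subr_eq0 => /eqP.
move/eqP; rewrite -expr2 sqrf_eq1 => /orP[]/eqP cs; rewrite E cs.
  by left; rewrite scale1r.
by right; rewrite scaleN1r.
Qed.

Lemma neg_eq0 u : u = - u -> u = 0.
Proof.
move=> uN; have /eqP : 2%:R *: u = 0 by rewrite scaler_nat mulr2n {2}uN subrr.
by rewrite scaler_eq0 (negPf two) => /eqP.
Qed.

Lemma sqr_eq1 (c : k) : c * c = 1 -> c = 1 \/ c = -1.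
Proof. by move/eqP; rewrite -expr2 sqrf_eq1 => /orP[]/eqP->; [left | right]. Qed.

Lemma left_cancel X u : X * X = 1 -> X * u = 0 -> u = 0.
Proof. by move=> XX Xu; rewrite -[u]mul1r -XX -mulrA Xu mulr0. Qed.

(** Right multiplication by [X] is an involution: [w + w X] is fixed by it, and if it vanishes then
    [w] has eigenvalue -1. *)
Lemma pair_eigen_x (X : B) w w' : homog x X -> X * X = 1 -> kp_pair w w' -> w != 0 ->
  exists v v' e, [/\ kp_pair v v', v != 0, e * e = 1, v * X = e *: v
    & v' * X = - (e *: v')].
Proof.
move=> XP XX wP w0.
have snd v v' e : kp_pair v v' -> v * X = e *: v -> v' * X = - (e *: v').
  move=> vP vX; apply/eqP; rewrite -eqr_oppLR; apply/eqP.
  by apply: pair_inj (pairZ e vP); rewrite -vX; apply: pair_mul_x.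
have [wX | wX] := eqVneq (w + w * X) 0.
  exists w, w', (-1); rewrite mulrNN mulr1; have wX' : w * X = (-1) *: w.
    by apply/eqP; rewrite scaleN1r -addr_eq0 addrC wX.
  by split=> //; exact: (snd _ _ _ wP wX').
exists (w + w * X), (w' - w' * X), 1; rewrite mulr1.
have vP : kp_pair (w + w * X) (w' - w' * X).
  by have := pair_comb 1 wP (pair_mul_x XP wP); rewrite !scale1r.
have vX : (w + w * X) * X = 1 *: (w + w * X).
  by rewrite mulrDl -mulrA XX mulr1 scale1r addrC.
by split=> //; exact: (snd _ _ _ vP vX).
Qed.

(** Here the involution is [w] to [w' Y]. The last clause records how [v] arises, so that an
    eigenvalue for [X] can be carried over to it in [pair_x_y]. *)
Lemma pair_eigen_y (Y : B) w w' : homog y Y -> Y * Y = 1 -> kp_pair w w' -> w != 0 ->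
  exists v v' e, [/\ kp_pair v v', v != 0, e * e = 1, v' * Y = e *: v
    & v = w \/ v = w + w' * Y].
Proof.
move=> YP YY wP w0; have [wY | wY] := eqVneq (w + w' * Y) 0.
  exists w, w', (-1); rewrite mulrNN mulr1; split=> //; last by left.
  by apply/eqP; rewrite scaleN1r -addr_eq0 addrC wY.
exists (w + w' * Y), (w' + w * Y), 1; rewrite mulr1; split=> //; last by right.
  by have := pair_comb 1 wP (pair_mul_y YP wP); rewrite !scale1r.
by rewrite mulrDl -mulrA YY mulr1 scale1r addrC.
Qed.

(** The product [X w' X] is [e X w'] in one bracketing and [- e X w'] in the other, so [w' = 0]. *)
Lemma pair_eigen_x_false (X : B) w w' e c : homog x X -> X * X = 1 -> kp_pair w w' ->
  w != 0 -> e * e = 1 -> w * X = e *: w -> w' * X = - (e *: w') ->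
  X * w' = c *: w -> False.
Proof.
move=> XP XX wP w0 ee wX w'X Xw'.
have : X * w' * X = - (X * w' * X).
  rewrite -{2}mulrA w'X mulrN opprK -scalerAr {1}Xw' -scalerAl wX scalerA mulrC.
  by rewrite -scalerA -Xw'.
move/neg_eq0; rewrite -mulrA w'X mulrN -scalerAr => /eqP.
rewrite oppr_eq0 scaler_eq0 => /orP[/eqP e0 | /eqP].
  by move/eqP: ee; rewrite e0 mul0r eq_sym oner_eq0.
move/(left_cancel XX) => w'0; case/eqP: w0; apply: pair_snd_eq0.
by rewrite w'0 in wP.
Qed.

Definition no_homog g := forall u : B, homog g u -> u = 0.

Lemma homog_dichotomy g : g * g = 1 ->
  no_homog g \/ exists X : B, homog g X /\ X * X = 1.
Proof.
move=> gg; have [|] := classic (exists2 u : B, homog g u & u != 0).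
  by case=> u uP u0; right; apply: homog_normalize uP u0.
by move=> no; left=> u uP; apply/eqP/negPn/negP=> u0; apply: no; exists u.
Qed.

(* L w = X w' and R w = w X anticommute, so an eigenvector w of R is not one of
   L; by pair_generate this forces a component Y.  If X and Y anticommuted, w
   could moreover be an eigenvector of right multiplication by Y, so that w
   alone would generate all pairs. *)
Lemma pair_x_y (X : B) w w' : homog x X -> X * X = 1 -> kp_pair w w' -> w != 0 ->
  exists2 Y : B, homog y Y & Y * Y = 1 /\ Y * X = X * Y.
Proof.
move=> XP XX wP w0.
have [v [v' [e [vP v0 ee vX v'X]]]] := pair_eigen_x XP XX wP w0.
have [c [a1 [a2 [a3 [h1 h2 h3 E]]]]] := pair_generate vP v0 (pair_x_mul XP vP).
have [c1 E1] := homog_multiple xx XP XX h1.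
have [noy | [Y [YP YY]]] := homog_dichotomy yy.
  have a20 := noy _ h2; have a30 : a3 = 0.
    apply: (left_cancel XX); apply: noy; rewrite -[y]mul1r -xx -mulrA.
    exact: homogM.
  exfalso; apply: (pair_eigen_x_false (c := c + c1 * e) XP XX vP v0 ee vX v'X).
  by rewrite E a20 a30 !mulr0 !addr0 E1 -scalerAr vX scalerA -scalerDl.
have [YX | YX] := homog_xy_commute XP YP XX YY; first by exists Y.
exfalso.
have [t [t' [d [tP t0 dd t'Y tE]]]] := pair_eigen_y YP YY vP v0.
(* Two signs cancel: [X] has eigenvalue [- e] on [v'] and anticommutes with [Y], so [v' Y] again has
   eigenvalue [e]. *)
have tX : t * X = e *: t.
  case: tE => -> //; rewrite mulrDl vX -mulrA YX mulrN mulrA v'X mulNr opprK.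
  by rewrite scalerDr scalerAl.
have t'X : t' * X = - (e *: t').
  apply/eqP; rewrite -eqr_oppLR; apply/eqP; apply: pair_inj (pairZ e tP).
  by rewrite -tX; apply: pair_mul_x.
have [c' [b1 [b2 [b3 [k1 k2 k3 F]]]]] := pair_generate tP t0 (pair_x_mul XP tP).
have [c1' F1] := homog_multiple xx XP XX k1.
have [c2' F2] := homog_multiple yy YP YY k2.
have [c3' F3] : exists c, X * b3 = c *: Y.
  apply: (homog_multiple yy YP YY); rewrite -[y]mul1r -xx -mulrA; exact: homogM.
have F3' : b3 = c3' *: (X * Y).
  by rewrite -[LHS]mul1r -XX -mulrA F3 -scalerAr.
(* Each of [t], [t X], [t' Y] and [t' X Y] is a multiple of [t]; the scalar collects their
   contributions to [X t']. *)
apply: (pair_eigen_x_false (c := c' + c1' * e + c2' * d - c3' * e * d) XP XX tP t0 ee tX t'X).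
rewrite F F1 F2 F3' -!scalerAr tX t'Y mulrA t'X mulNr -scalerAl t'Y !scalerN !scalerA.
by rewrite !scalerDl scaleNr.
Qed.

(** * Lines of [B] stabilized by B(0) *)

Definition stabilizes_line Om b := exists c, b * Om = c *: Om.

Definition has_eigenvector :=
  exists2 Om : B, Om != 0 & forall b, b \in B0 -> stabilizes_line Om b.

Lemma stabilizes_lineD Om a b :
  stabilizes_line Om a -> stabilizes_line Om b -> stabilizes_line Om (a + b).
Proof. by move=> [c cE] [d dE]; exists (c + d); rewrite mulrDl cE dE scalerDl. Qed.

Lemma stabilizes_lineZ Om c b : stabilizes_line Om b -> stabilizes_line Om (c *: b).
Proof. by move=> [d dE]; exists (c * d); rewrite -scalerAl dE scalerA. Qed.

Lemma stabilizes_lineM Om a b :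
  stabilizes_line Om a -> stabilizes_line Om b -> stabilizes_line Om (a * b).
Proof.
by move=> [c cE] [d dE]; exists (c * d); rewrite -mulrA dE -scalerAr cE scalerA mulrC.
Qed.

Lemma stabilizes_line_B0 Om :
  (forall u, homog x u -> stabilizes_line Om u) ->
  (forall u, homog y u -> stabilizes_line Om u) ->
  (forall u, homog (x * y) u -> stabilizes_line Om u) ->
  (forall v v', kp_pair v v' -> stabilizes_line Om v /\ stabilizes_line Om v') ->
  forall b, b \in B0 -> stabilizes_line Om b.
Proof.
move=> hx hy hxy hp b; rewrite B0P => bK; rewrite {1}(component_sum bK).
have [c cE] := coinv (homog_component0 bK).
do ?[apply: stabilizes_lineD].
- by exists c; rewrite cE -scalerAl mul1r.
- exact/hx/homog_component1.
- exact/hy/homog_component2.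
- exact/hxy/homog_component3.
- by have [] := hp _ _ (pair_component4 bK).
by have [] := hp _ _ (pair_component6 bK).
Qed.

(** Each eigenvector built below is a nonzero multiple of 1 plus terms without trivial component, so
    component 0 certifies that it is nonzero. *)
Lemma component_neq0 Om c i : kp_component i Om = c *: 1 -> c != 0 -> Om != 0.
Proof.
move=> E c0; apply: contraNneq c0 => Om0; move/eqP: E.
by rewrite Om0 linear0 eq_sym scaler_eq0 oner_eq0 orbF.
Qed.

(* The eigenvector w of w |-> w' Y is chosen so that w, w X span all pairs. *)
Section CaseX.
Variables (X Y w w' : B).
Hypotheses (XP : homog x X) (XX : X * X = 1) (YP : homog y Y) (YY : Y * Y = 1).
Hypotheses (YX : Y * X = X * Y) (wP : kp_pair w w') (w0 : w != 0).
Hypothesis w'Y : w' * Y = w.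

Let wY : w * Y = w'. Proof. by rewrite -w'Y -mulrA YY mulr1. Qed.

Lemma case_x_multiple_xy u : homog (x * y) u -> exists c, u = c *: (X * Y).
Proof.
apply: (homog_multiple xyxy (homogM XP YP)).
by rewrite -mulrA [Y * _]mulrA YX !mulrA XX mul1r YY.
Qed.

(** As [w' Y = w] and [Y X = X Y], the four generators of [pair_generate] collapse to [w] and
    [w X]. *)
Lemma case_x_pairs v v' : kp_pair v v' ->
  exists c d, v = c *: w + d *: (w * X) /\ v' = c *: w' - d *: (w' * X).
Proof.
move=> vP; have [c [a1 [a2 [a3 [h1 h2 h3 E]]]]] := pair_generate wP w0 vP.
have [c1 E1] := homog_multiple xx XP XX h1.
have [c2 E2] := homog_multiple yy YP YY h2.
have [c3 E3] := case_x_multiple_xy h3.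
exists (c + c2), (c1 + c3).
have vE : v = (c + c2) *: w + (c1 + c3) *: (w * X).
  rewrite E E1 E2 E3 -!scalerAr -YX [w' * (Y * X)]mulrA w'Y.
  by linear_identity.
split=> //; rewrite -scalerN; apply: pair_inj vP _; rewrite vE.
exact: pair_comb wP (pairZ _ (pair_mul_x XP wP)).
Qed.

(** Write [X w' = c w + d w X] by [case_x_pairs]. Obtaining [X w'] as [X w Y] instead reverses the
    sign of the second term, so it vanishes; then [X X = 1] gives [c^2 = 1]. *)
Lemma case_x_sign : exists2 c, c * c = 1 & X * w' = c *: w /\ X * w = c *: w'.
Proof.
have [c [d [E E']]] := case_x_pairs (pair_x_mul XP wP).
have dwX : d *: (w * X) = 0.
  apply: neg_eq0; apply: (addrI (c *: w)); rewrite -E -wY mulrA E' mulrDl mulNr.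
  by rewrite -!scalerAl w'Y -mulrA -YX mulrA w'Y.
have E1 : X * w' = c *: w by rewrite E dwX addr0.
have E2 : X * w = c *: w' by rewrite -w'Y mulrA E1 -scalerAl wY.
exists c => //; apply: (scale_inj w0).
by rewrite scale1r -scalerA -E1 scalerAr -E2 mulrA XX mul1r.
Qed.

End CaseX.

Section CaseXNormalized.
Variables (X Y w w' : B).
Hypotheses (XP : homog x X) (XX : X * X = 1) (YP : homog y Y) (YY : Y * Y = 1).
Hypotheses (YX : Y * X = X * Y) (wP : kp_pair w w') (w0 : w != 0).
Hypotheses (w'Y : w' * Y = w) (Xw : X * w = w').

Let wY : w * Y = w'. Proof. by rewrite -w'Y -mulrA YY mulr1. Qed.
Let Xw' : X * w' = w. Proof. by rewrite -Xw mulrA XX mul1r. Qed.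
Let D := w * w.

Let XXA u : X * (X * u) = u. Proof. by rewrite mulrA XX mul1r. Qed.
Let YYA u : Y * (Y * u) = u. Proof. by rewrite mulrA YY mul1r. Qed.
Let YXA u : Y * (X * u) = X * (Y * u). Proof. by rewrite mulrA YX -mulrA. Qed.

Let ww' : w * w' = D * Y. Proof. by rewrite -wY mulrA. Qed.
Let w'w : w' * w = X * D. Proof. by rewrite -Xw -mulrA. Qed.
Let w'w' : w' * w' = X * D * Y. Proof. by rewrite -{1}Xw -mulrA ww' mulrA. Qed.

Lemma case_x_square_span : exists c0 c1 c2 c3 : k,
  D = c0 *: 1 + c1 *: X + c2 *: Y + c3 *: (X * Y).
Proof.
have [a aE] := coinv (homog_pair_prod1 wP wP).
have [b bE] := homog_multiple xx XP XX (homog_pair_prod_x wP wP).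
have [c cE] := homog_multiple yy YP YY (homog_pair_prod_y wP wP).
have [d dE] := case_x_multiple_xy XP XX YP YY YX (homog_pair_prod_xy wP wP).
pose r : k := 2%:R^-1 * 2%:R^-1.
exists (r * a), (r * b), (r * c), (r * d); rewrite -!scalerA -aE -bE -cE -dE.
rewrite /pair_prod1 /pair_prod_x /pair_prod_y /pair_prod_xy /D /r.
by linear_identity.
Qed.

Let DY : D * Y = Y * D.
Proof.
have [a [b [c [d ->]]]] := case_x_square_span.
by rewrite !mulrDl !mulrDr -!scalerAl -!scalerAr !mulr1 !mul1r -!mulrA YX YXA.
Qed.

Let Z := 1 + X + Y - X * Y.

(** [pair_prod1 w w' w w'] is [Z D] and also a scalar; since [Z Z = 4], multiplying by [Z] isolates
    [D]. *)
Lemma case_x_square : exists c : k, D = c *: Z.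
Proof.
have [a aE] := coinv (homog_pair_prod1 wP wP).
exists (2%:R^-1 * 2%:R^-1 * a); rewrite -scalerA.
have -> : a *: Z = Z * (a *: 1) by rewrite -scalerAr mulr1.
rewrite -aE /pair_prod1 ww' w'w w'w' -[w * w]/D -[X * D * Y]mulrA DY /Z.
rewrite !(mulrDl, mulrDr, mulrN, mulNr, mul1r, mulr1) -!mulrA.
by rewrite !(YX, YY, XX, XXA, YYA, YXA); linear_identity.
Qed.

Lemma case_x_square_neq0 : D != 0.
Proof.
apply/eqP=> D0; have [v [v' [vP]]] := pair_nondegenerate wP w0.
have [c [d [-> ->]]] := case_x_pairs XP XX YP YY YX wP w0 w'Y vP.
rewrite /pair_prod1 !(mulrDr, mulrN) -!scalerAr !mulrA ww' w'w w'w' -[w * w]/D D0.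
by rewrite !(mulr0, mul0r, scaler0, oppr0, addr0) eqxx.
Qed.

(** In [Y w = c w + d w X], writing [w = w' Y] on the left reverses the sign of [c w], which
    therefore vanishes. Multiplying by [w] on the right gives [Y D = d Y D], so [d = 1]. *)
Lemma case_x_Yw : Y * w = w * X.
Proof.
have [c [d [E E']]] := case_x_pairs XP XX YP YY YX wP w0 w'Y (pair_y_mul YP wP).
have cw : c *: w = 0.
  apply: neg_eq0; apply: (addIr (d *: (w * X))); rewrite -E -{1}w'Y mulrA.
  rewrite -[_ * w']opprK E' opprB mulrBl -!scalerAl w'Y -mulrA -YX mulrA w'Y.
  by rewrite addrC.
move: E; rewrite cw add0r => E.
suff d1 : d = 1 by rewrite E d1 scale1r.
have YD0 : Y * D != 0.
  by apply: contraNneq case_x_square_neq0 => /(left_cancel YY)->.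
apply: (scale_inj YD0); rewrite scale1r -[in LHS]DY /D -mulrA wY -Xw.
by rewrite mulrA scalerAl -E -mulrA.
Qed.

Lemma case_x_eigenvector : has_eigenvector.
Proof.
(* On the image of [(1 + X)(1 + Y)] both [X] and [Y] act as 1, so [Z] acts as 2 and [w w] as [2 a0];
   [c] is an eigenvalue of [w] there. *)
have [a0 DE] := case_x_square; have [c cE] := sqrt_ex (2%:R * a0).
have c0 : c != 0.
  apply: contraNneq case_x_square_neq0 => c0; move/eqP: cE.
  rewrite c0 mul0r eq_sym mulf_eq0 (negPf two) /= DE => /eqP->.
  by rewrite scale0r.
have Yw := case_x_Yw.
pose Om := (1 + X) * (1 + Y) * (c *: 1 + w).
have XOm : X * Om = Om by rewrite /Om !mulrA [X * (1 + X)]mulrDr mulr1 XX [X + 1]addrC.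
have YOm : Y * Om = Om.
  have YX1 : Y * (1 + X) = (1 + X) * Y by rewrite mulrDr mulrDl mulr1 mul1r YX.
  by rewrite /Om !mulrA YX1 -[_ * Y * _]mulrA [Y * (1 + Y)]mulrDr mulr1 YY [Y + 1]addrC.
have wOm : w * Om = c *: Om.
  (* [w X = Y w] and [w Y = X w]: passing [w] exchanges [X] and [Y], and the product is symmetric in
     them. *)
  have wXY : w * ((1 + X) * (1 + Y)) = (1 + X) * (1 + Y) * w.
    rewrite !(mulrDl, mulrDr) !mul1r !mulr1 -!mulrA Yw [w * (X * Y)]mulrA -Yw.
    by rewrite -mulrA wY -Xw YXA; linear_identity.
  have DOm : (1 + X) * (1 + Y) * D = (c * c) *: ((1 + X) * (1 + Y)).
    rewrite cE DE -scalerAr mulrC -scalerA; congr (_ *: _); rewrite /Z.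
    rewrite !(mulrDl, mulrDr, mulrN, mulNr, mul1r, mulr1) -!mulrA.
    by rewrite !(YX, YY, XX, XXA, YYA, YXA); linear_identity.
  rewrite /Om mulrA wXY; move: ((1 + X) * (1 + Y)) DOm => P DOm.
  rewrite -mulrA !mulrDr -/D DOm -!scalerAr !mulr1 scalerDr scalerA.
  exact: addrC.
have stX : stabilizes_line Om X by exists 1; rewrite scale1r.
have stY : stabilizes_line Om Y by exists 1; rewrite scale1r.
have stw : stabilizes_line Om w by exists c.
have stw' : stabilizes_line Om w' by rewrite -Xw; apply: stabilizes_lineM.
exists Om.
  apply: (component_neq0 (i := @Ordinal 8 0 isT) (c := c) _ c0).
  have -> : Om = c *: 1 + c *: X + c *: Y + c *: (X * Y) + w + w' + Y * w + X * (Y * w).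
    rewrite /Om !(mulrDl, mulrDr) !mul1r !mulr1 -!scalerAr !mulr1 -!mulrA Xw.
    by linear_identity.
  have YwP := pair_y_mul YP wP.
  have XYwP := pair_x_mul XP YwP.
  rewrite mulrN in XYwP.
  rewrite !lfun_addE (homog_component _ (homogZ c homog1)).
  rewrite (homog_component _ (homogZ c XP)) (homog_component _ (homogZ c YP)).
  rewrite (homog_component _ (homogZ c (homogM XP YP))).
  rewrite (pair_componentl _ wP) (pair_componentr _ wP) (pair_componentl _ YwP).
  rewrite (pair_componentr _ XYwP) !kp_dualE /=.
  by rewrite !scale0r !addr0 scale1r.
apply: stabilizes_line_B0.
- by move=> u /(homog_multiple xx XP XX)[d ->]; apply: stabilizes_lineZ.
- by move=> u /(homog_multiple yy YP YY)[d ->]; apply: stabilizes_lineZ.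
- move=> u /(case_x_multiple_xy XP XX YP YY YX)[d ->].
  by apply/stabilizes_lineZ/stabilizes_lineM.
move=> v v' /(case_x_pairs XP XX YP YY YX wP w0 w'Y)[d [f [-> ->]]].
split; first by do ![apply: stabilizes_lineD | apply: stabilizes_lineZ
  | apply: stabilizes_lineM].
rewrite -scaleNr; by do ![apply: stabilizes_lineD | apply: stabilizes_lineZ
  | apply: stabilizes_lineM].
Qed.

End CaseXNormalized.

Lemma pair_x_eigenvector (X : B) w w' : homog x X -> X * X = 1 -> kp_pair w w' ->
  w != 0 -> has_eigenvector.
Proof.
move=> XP XX wP w0; have [Y YP [YY YX]] := pair_x_y XP XX wP w0.
have [v [v' [e [vP v0 ee v'Y _]]]] := pair_eigen_y YP YY wP w0.
pose Y1 := e *: Y; have Y1P : homog y Y1 by apply: homogZ.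
have Y1Y1 : Y1 * Y1 = 1 by rewrite -scalerAl -scalerAr YY scalerA ee scale1r.
have Y1X : Y1 * X = X * Y1 by rewrite -scalerAl -scalerAr YX.
have v'Y1 : v' * Y1 = v by rewrite -scalerAr v'Y scalerA ee scale1r.
have [c cc [_ Xv]] := case_x_sign XP XX Y1P Y1Y1 Y1X vP v0 v'Y1.
pose X1 := c *: X.
apply: (@case_x_eigenvector X1 Y1 v v') => //; first exact: homogZ.
- by rewrite -scalerAl -scalerAr XX scalerA cc scale1r.
- by rewrite /X1 -[LHS]scalerAr Y1X scalerAl.
by rewrite -scalerAl Xv scalerA cc scale1r.
Qed.

(** * Copies of V in the absence of a component of degree [x] *)

Lemma scale_unit_inj (e : k) u v : e * e = 1 -> e *: u = e *: v -> u = v.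
Proof.
by move=> ee /(congr1 (fun t => e *: t)); rewrite !scalerA ee !scale1r.
Qed.

(** Without degree [x], [pair_generate] forces [Y v = d v], hence [Y v' = - d v']. But [v] is a
    multiple of [v' Y], so [Y v = - Y v]. *)
Lemma pair_y_false (Y : B) w w' : no_homog x -> homog y Y -> Y * Y = 1 ->
  kp_pair w w' -> w != 0 -> False.
Proof.
move=> nox YP YY wP w0; have [v [v' [e [vP v0 ee v'Y _]]]] := pair_eigen_y YP YY wP w0.
have [c [a1 [a2 [a3 [h1 h2 h3 E]]]]] := pair_generate vP v0 (pair_y_mul YP vP).
have a10 := nox _ h1; have [c2 E2] := homog_multiple yy YP YY h2.
have a30 : a3 = 0.
  apply: (left_cancel YY); apply: nox; rewrite -[x]mul1r -yy -mulrA yx.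
  exact: homogM.
pose d := c + c2 * e.
have Yv : Y * v = d *: v.
  by rewrite E a10 a30 !mulr0 !addr0 E2 -scalerAr v'Y scalerA -scalerDl.
have Yv' : Y * v' = - (d *: v').
  apply/eqP; rewrite -eqr_oppLR; apply/eqP.
  by apply: pair_inj (pairZ d vP); rewrite -Yv; apply: pair_y_mul.
have : Y * v = - (Y * v).
  apply: (scale_unit_inj ee); rewrite scalerN [LHS]scalerAr -v'Y mulrA Yv' mulNr.
  by rewrite -scalerAl v'Y scalerA mulrC -scalerA -Yv.
by move/neg_eq0/(left_cancel YY)=> v00; rewrite v00 eqxx in v0.
Qed.

(** The operator [w] to [- w' U] on first members has square -1, so its eigenvalues are the square
    roots of -1. *)
Lemma pair_xy_eigen (U : B) w w' : homog (x * y) U -> U * U = 1 -> kp_pair w w' ->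
  w != 0 -> exists v v' j, [/\ kp_pair v v', v != 0, j * j = -1 & v' = - (j *: (v * U))].
Proof.
move=> UP UU wP w0; have [i ii] := sqrt_ex (-1).
have snd v v' j : kp_pair v v' -> j * j = -1 -> v' * U = - (j *: v) ->
    v' = - (j *: (v * U)).
  by move=> vP jj v'U; rewrite -[LHS]mulr1 -UU mulrA v'U mulNr -scalerAl.
have wU := pair_mul_xy UP wP.
have [wi | wi] := eqVneq (w + i *: (w' * U)) 0.
  exists w, w', (- i); rewrite mulrNN; split=> //; apply: snd => //.
    by rewrite mulrNN.
  apply: (@scale_unit_inj (i * i)); first by rewrite ii mulrNN mulr1.
  rewrite -scalerA; have -> : i *: (w' * U) = - w.
    by apply/eqP; rewrite -addr_eq0 addrC wi.
  by rewrite scaleNr opprK ii scaleN1r scalerN.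
exists (w + i *: (w' * U)), (w' - i *: (w * U)), i.
have vP : kp_pair (w + i *: (w' * U)) (w' - i *: (w * U)).
  by have := pair_comb (- i) wU wP; rewrite scaleNr scalerN opprK scaleNr ![_ + w]addrC
    ![_ + w']addrC.
split=> //; apply: snd => //.
rewrite mulrBl -scalerAl -mulrA UU mulr1 scalerDr scalerA ii scaleN1r.
by rewrite opprD opprK addrC.
Qed.

Lemma pair_xy_eigenvector (U : B) w w' : no_homog x -> no_homog y ->
  homog (x * y) U -> U * U = 1 -> kp_pair w w' -> w != 0 -> has_eigenvector.
Proof.
move=> nox noy UP UU wP0 w00.
have [v [v' [j [vP v0 jj v'E]]]] := pair_xy_eigen UP UU wP0 w00.
have v'U : v' * U = - (j *: v).
  by rewrite v'E mulNr -scalerAl -mulrA UU mulr1.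
have gen t t' : kp_pair t t' -> exists c, t = c *: v /\ t' = c *: v'.
  move=> tP; have [c [a1 [a2 [a3 [h1 h2 h3 E]]]]] := pair_generate vP v0 tP.
  have [c3 E3] := homog_multiple xyxy UP UU h3.
  exists (c - c3 * j).
  have tE : t = (c - c3 * j) *: v.
    rewrite E (nox _ h1) (noy _ h2) !mulr0 !addr0 E3 -scalerAr v'U scalerN.
    by rewrite scalerA -scalerBl.
  by split=> //; apply: pair_inj tP _; rewrite tE; apply: pairZ.
have [c [Uv' Uv]] := gen _ _ (pair_xy_mul UP vP).
have v'0 : v' != 0 by apply: contraNneq v0 => v'0; apply/eqP/pair_snd_eq0; rewrite -v'0.
have cc : c * c = -1.
  apply: (scale_inj v'0); rewrite -scalerA -Uv [LHS]scalerAr -Uv' mulrN mulrA UU.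
  by rewrite mul1r scaleN1r.
have [c0 q0E] := coinv (homog_pair_prod1 vP vP).
have c00 : c0 != 0.
  apply/eqP=> c00; have [t [t' [tP]]] := pair_nondegenerate vP v0.
  have [d [-> ->]] := gen _ _ tP.
  have -> : pair_prod1 v v' (d *: v) (d *: v') = d *: pair_prod1 v v' v v'.
    by rewrite /pair_prod1 -!scalerAr !scalerDr scalerN.
  by rewrite q0E c00 scale0r scaler0 eqxx.
have UvE : U * v = (- (c * j)) *: (v * U).
  by rewrite Uv v'E scalerN scalerA scaleNr.
have : - (c * j) * - (c * j) = 1 by rewrite mulrNN mulrACA cc jj mulrNN mulr1.
(* If [U v = - v U], the terms of [pair_prod1 v v' v v'] cancel, against [c0 != 0]; so [U] and [v]
   commute. *)
case/sqr_eq1=> sgn; rewrite sgn ?scale1r ?scaleN1r in UvE; last first.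
  case/eqP: c00; apply: (@scale_inj k B _ _ 1); first exact: oner_neq0.
  rewrite -q0E scale0r /pair_prod1 v'E !(mulrN, mulNr) -!scalerAl -!scalerAr.
  rewrite -!mulrA ![U * (v * _)]mulrA UvE !mulNr -!mulrA UU mulr1 !mulrN.
  by rewrite [v * (v * U)]mulrA !scalerA jj; linear_identity.
pose D := v * v; have vvU : v * (U * v) = D * U by rewrite UvE mulrA.
have UDE : U * D = D * U by rewrite /D mulrA UvE -mulrA vvU.
pose a0 := 2%:R^-1 * 2%:R^-1 * c0.
(* The scalar [c0] equals [2 D (1 - j U)], and [(1 - j U)(1 + j U) = 1 - j^2 = 2]. *)
have DE : D = a0 *: (1 + j *: U).
  have -> : a0 *: (1 + j *: U)
      = (2%:R^-1 * 2%:R^-1) *: (pair_prod1 v v' v v' * (1 + j *: U)).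
    by rewrite q0E -scalerAl mul1r [RHS]scalerA.
  have -> : pair_prod1 v v' v v' = 2%:R *: D - (2%:R * j) *: (D * U).
    rewrite /pair_prod1 v'E !(mulrN, mulNr) -!scalerAl -!scalerAr.
    have UvA t : U * (v * t) = v * (U * t) by rewrite mulrA UvE mulrA.
    rewrite -!mulrA UvA UvE UU mulr1 mulrA -/D.
    by rewrite !scalerA jj; linear_identity.
  rewrite mulrDr mulr1 mulrBl -!scalerAl -!scalerAr -[D * U * U]mulrA UU mulr1 [_ *: (_ *: D)]scalerA.
  have -> : 2%:R * j * j = - 2%:R by rewrite -mulrA jj mulrN1.
  by linear_identity.
have j1 : 1 + j != 0.
  apply/eqP=> j1; have jN : j = -1 by apply/eqP; rewrite -addr_eq0 addrC j1.
  move: jj; rewrite jN mulrNN mulr1 => /eqP.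
  by rewrite -subr_eq0 opprK (negPf two).
have a00 : a0 != 0 by rewrite !mulf_neq0 ?invr_neq0.
(* On the image of [1 + U] the square of [v] is [a0 (1 + j)], so [d] is an eigenvalue of [v]
   there. *)
have [d dE] := sqrt_ex (a0 * (1 + j)).
have d0 : d != 0.
  by apply: contraNneq (mulf_neq0 a00 j1) => d0; rewrite -dE d0 mul0r.
pose Om := (1 + U) * (d *: 1 + v).
have UOm : U * Om = Om by rewrite /Om mulrA [U * (1 + U)]mulrDr mulr1 UU [U + 1]addrC.
have vOm : v * Om = d *: Om.
  have vU : v * (1 + U) = (1 + U) * v by rewrite mulrDr mulrDl mulr1 mul1r UvE.
  have UD : (1 + U) * D = (d * d) *: (1 + U).
    rewrite dE DE -scalerAr -[RHS]scalerA; congr (_ *: _).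
    by rewrite mulrDl mul1r mulrDr mulr1 -scalerAr UU; linear_identity.
  rewrite /Om mulrA vU; move: (1 + U) UD => P UD.
  rewrite -mulrA !mulrDr -/D UD -!scalerAr !mulr1 scalerDr scalerA.
  exact: addrC.
have stU : stabilizes_line Om U by exists 1; rewrite scale1r.
have stv : stabilizes_line Om v by exists d.
have stv' : stabilizes_line Om v'.
  rewrite v'E -scaleNr; exact/stabilizes_lineZ/stabilizes_lineM.
exists Om.
  apply: (component_neq0 (i := @Ordinal 8 0 isT) (c := d) _ d0).
  have -> : Om = d *: 1 + d *: U + v + U * v.
    by rewrite /Om mulrDl !mulrDr !mul1r -scalerAr mulr1; linear_identity.
  rewrite !lfun_addE (homog_component _ (homogZ d homog1)).
  rewrite (homog_component _ (homogZ d UP)) (pair_componentl _ vP).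
  rewrite (pair_componentr _ (pair_xy_mul UP vP)) !kp_dualE /=.
  by rewrite !scale0r !addr0 scale1r.
apply: stabilizes_line_B0.
- by move=> u /nox->; exists 0; rewrite mul0r scale0r.
- by move=> u /noy->; exists 0; rewrite mul0r scale0r.
- by move=> u /(homog_multiple xyxy UP UU)[f ->]; apply: stabilizes_lineZ.
by move=> t t' /gen[f [-> ->]]; split; apply: stabilizes_lineZ.
Qed.

(** Vanishing of the three nontrivial products gives [w w = w w'], a scalar. It is nonzero by
    nondegeneracy, so associativity of [w w w'] yields [w = w'], impossible for a standard basis. *)
Lemma pair_trivial_false w w' : no_homog x -> no_homog y -> no_homog (x * y) ->
  kp_pair w w' -> w != 0 -> False.
Proof.
move=> nox noy noxy wP w0.
have gen t t' : kp_pair t t' -> exists c, t = c *: w /\ t' = c *: w'.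
  move=> tP; have [c [a1 [a2 [a3 [h1 h2 h3 E]]]]] := pair_generate wP w0 tP.
  exists c; have tE : t = c *: w.
    by rewrite E (nox _ h1) (noy _ h2) (noxy _ h3) !mulr0 !addr0.
  by split=> //; apply: pair_inj tP _; rewrite tE; apply: pairZ.
have [c0 q0E] := coinv (homog_pair_prod1 wP wP).
have q1E := nox _ (homog_pair_prod_x wP wP).
have q2E := noy _ (homog_pair_prod_y wP wP).
have q3E := noxy _ (homog_pair_prod_xy wP wP).
have [t [t' [tP]]] := pair_nondegenerate wP w0.
have [d [-> ->]] := gen _ _ tP; case/negP.
suff c00 : c0 = 0.
  have -> : pair_prod1 w w' (d *: w) (d *: w') = d *: pair_prod1 w w' w w'.
    by rewrite /pair_prod1 -!scalerAr !scalerDr scalerN.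
  by rewrite q0E c00 scale0r scaler0.
pose r : k := 2%:R^-1 * 2%:R^-1.
have ww : w * w = (r * c0) *: 1.
  rewrite -scalerA -q0E -[pair_prod1 _ _ _ _]addr0 -q1E -[_ + _]addr0 -q2E.
  rewrite -[_ + _]addr0 -q3E.
  by rewrite /pair_prod1 /pair_prod_x /pair_prod_y /pair_prod_xy /r; linear_identity.
have ww' : w * w' = (r * c0) *: 1.
  rewrite -scalerA -q0E -[pair_prod1 _ _ _ _]subr0 -q1E -[_ - _]addr0 -q2E.
  rewrite -[_ + _]subr0 -q3E.
  by rewrite /pair_prod1 /pair_prod_x /pair_prod_y /pair_prod_xy /r; linear_identity.
have [//|c00] := eqVneq c0 0; exfalso.
have qc : r * c0 != 0 by rewrite !mulf_neq0 ?invr_neq0.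
have : (r * c0) *: w = (r * c0) *: w'.
  have : w * w * w' = w * (w * w') by rewrite mulrA.
  by rewrite ww ww' -scalerAl -scalerAr mul1r mulr1.
move/(congr1 (fun t => (r * c0)^-1 *: t)); rewrite !scalerA mulVf // !scale1r => ww'E.
case/eqP: w0; rewrite (pair_fst wP) ww'E (pair_componentr _ wP).
by rewrite /= !scale0r addr0.
Qed.

(** B(0) has at most one normalized element per group-like. If these commute, a product of factors
    [1 + X] is fixed by all of them; otherwise [X] and [Y] anticommute. *)
Lemma group_eigenvector : (forall w w', kp_pair w w' -> w = 0) ->
  has_eigenvector \/
  exists X Y : B, [/\ [/\ homog x X, homog y Y, X * X = 1, Y * Y = 1 & Y * X = - (X * Y)]
    & forall b, b \in B0 -> exists c0 c1 c2 c3 : k,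
        b = c0 *: 1 + c1 *: X + c2 *: Y + c3 *: (X * Y)].
Proof.
move=> nop.
have st_pair Om v v' : kp_pair v v' -> stabilizes_line Om v /\ stabilizes_line Om v'.
  move=> vP; have v0 := nop _ _ vP.
  have v'0 : v' = 0 by rewrite (pair_snd vP) v0 linear0.
  by rewrite v0 v'0; split; exists 0; rewrite mul0r scale0r.
have st0 Om g u : no_homog g -> homog g u -> stabilizes_line Om u.
  by move=> no /no->; exists 0; rewrite mul0r scale0r.
have st1 Om g (X u : B) : g * g = 1 -> homog g X -> X * X = 1 -> X * Om = Om ->
    homog g u -> stabilizes_line Om u.
  move=> gg XP XX XOm /(homog_multiple gg XP XX)[c ->].
  by apply: stabilizes_lineZ; exists 1; rewrite scale1r.
have one (X : B) : X * X = 1 -> X * (1 + X) = 1 + X.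
  by move=> XX; rewrite mulrDr mulr1 XX addrC.
have nz g (X : B) : (kp_dual (@Ordinal 8 0 isT) g : k) = 0 -> homog g X -> 1 + X != 0.
  move=> g0 XP.
  apply: (component_neq0 (i := @Ordinal 8 0 isT) (c := 1) _ (oner_neq0 _)).
  rewrite lfun_addE (homog_component _ homog1) (homog_component _ XP) g0.
  by rewrite kp_dual1 scale0r addr0.
have [nox | [X [XP XX]]] := homog_dichotomy xx;
  have [noy | [Y [YP YY]]] := homog_dichotomy yy.
- left; have [noxy | [U [UP UU]]] := homog_dichotomy xyxy.
    exists 1; first exact: oner_neq0.
    by apply: stabilizes_line_B0; [by move=> u; apply: st0 | by move=> u; apply: st0
      | by move=> u; apply: st0 | exact: st_pair].
  exists (1 + U); first by apply: nz UP; rewrite kp_dual_xy.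
  apply: stabilizes_line_B0; [by move=> u; apply: st0 | by move=> u; apply: st0 | |
    exact: st_pair].
  by move=> u; apply: st1 xyxy UP UU (one _ UU).
- left; have noxy : no_homog (x * y).
    move=> u uP; apply: (left_cancel YY); apply: nox; rewrite -[x]mul1r -yy -mulrA yx.
    exact: homogM.
  exists (1 + Y); first by apply: nz YP; rewrite kp_dual_y.
  apply: stabilizes_line_B0; [by move=> u; apply: st0 | | by move=> u; apply: st0 |
    exact: st_pair].
  by move=> u; apply: st1 yy YP YY (one _ YY).
- left; have noxy : no_homog (x * y).
    move=> u uP; apply: (left_cancel XX); apply: noy; rewrite -[y]mul1r -xx -mulrA.
    exact: homogM.
  exists (1 + X); first by apply: nz XP; rewrite kp_dual_x.
  apply: stabilizes_line_B0; [ | by move=> u; apply: st0 | by move=> u; apply: st0 |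
    exact: st_pair].
  by move=> u; apply: st1 xx XP XX (one _ XX).
have [YX | YX] := homog_xy_commute XP YP XX YY; last first.
  right; exists X, Y; split=> // b; rewrite B0P => bK; rewrite {1}(component_sum bK).
  have [c0 ->] := coinv (homog_component0 bK).
  have [c1 ->] := homog_multiple xx XP XX (homog_component1 bK).
  have [c2 ->] := homog_multiple yy YP YY (homog_component2 bK).
  have [c3 ->] : exists c, cmp 3 b = c *: (X * Y).
    have [c cE] : exists c, cmp 3 b * (Y * X) = c *: 1.
      apply: coinv; have := homogM (homog_component3 bK) (homogM YP XP).
      by rewrite yx xyxy.
    have inv : Y * X * (X * Y) = 1 by rewrite -mulrA [X * (X * Y)]mulrA XX mul1r.
    by exists c; rewrite -[LHS]mulr1 -inv [LHS]mulrA cE -scalerAl mul1r.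
  exists c0, c1, c2, c3; rewrite (nop _ _ (pair_component4 bK)).
  by rewrite (pair_snd (pair_component6 bK)) (nop _ _ (pair_component6 bK)) linear0 !addr0.
left; exists ((1 + X) * (1 + Y)).
  apply: (component_neq0 (i := @Ordinal 8 0 isT) (c := 1) _ (oner_neq0 _)).
  rewrite mulrDl !mulrDr !mulr1 mul1r !lfun_addE (homog_component _ homog1).
  rewrite (homog_component _ XP) (homog_component _ YP).
  by rewrite (homog_component _ (homogM XP YP)) !kp_dualE /= !scale0r !addr0.
have XOm : X * ((1 + X) * (1 + Y)) = (1 + X) * (1 + Y) by rewrite mulrA one.
have YOm : Y * ((1 + X) * (1 + Y)) = (1 + X) * (1 + Y).
  have YX1 : Y * (1 + X) = (1 + X) * Y by rewrite mulrDr mulrDl mulr1 mul1r YX.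
  by rewrite mulrA YX1 -mulrA one.
apply: stabilizes_line_B0; last exact: st_pair.
- by move=> u; apply: st1 xx XP XX XOm.
- by move=> u; apply: st1 yy YP YY YOm.
move=> u; apply: (st1 _ _ (X * Y)); [exact: xyxy | exact: homogM | | ].
  by rewrite -mulrA [Y * _]mulrA YX !mulrA XX mul1r YY.
by rewrite -mulrA YOm XOm.
Qed.

Theorem kp_comodule_algebra_cases :
  has_eigenvector \/
  exists X Y : B, [/\ [/\ homog x X, homog y Y, X * X = 1, Y * Y = 1 & Y * X = - (X * Y)]
    & forall b, b \in B0 -> exists c0 c1 c2 c3 : k,
        b = c0 *: 1 + c1 *: X + c2 *: Y + c3 *: (X * Y)].
Proof.
have [[w [w' [wP w0]]] | nop] := classic (exists w w', kp_pair w w' /\ w != 0).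
  left; have [nox | [X [XP XX]]] := homog_dichotomy xx; last first.
    exact: (pair_x_eigenvector XP XX wP w0).
  have [noy | [Y [YP YY]]] := homog_dichotomy yy; last first.
    by have := pair_y_false nox YP YY wP w0.
  have [noxy | [U [UP UU]]] := homog_dichotomy xyxy.
    by have := pair_trivial_false nox noy noxy wP w0.
  exact: (pair_xy_eigenvector nox noy UP UU wP w0).
apply: group_eigenvector => w w' wP; apply/eqP/negPn/negP=> w0.
by apply: nop; exists w, w'.
Qed.

End Classification.

(** * The matrix algebra spanned by 1, X, Y, XY *)

Section MatrixCase.
Variables X Y : B.
Hypotheses (XP : homog x X) (YP : homog y Y) (XX : X * X = 1) (YY : Y * Y = 1).
Hypothesis YX : Y * X = - (X * Y).

(** Since [X] exchanges the eigenspaces of [Y], the elements [e], [f], [g] and [1 - e] are the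
    matrix units e11, e21, e12, e22. *)
Definition mx_idem : B := 2%:R^-1 *: (1 + Y).
Notation e := mx_idem.
Notation f := (X * mx_idem).
Notation g := (mx_idem * X).

Lemma mx_idemY : e * Y = e.
Proof. by rewrite -scalerAl mulrDl mul1r YY addrC. Qed.

Lemma mx_Y_idem : Y * e = e.
Proof. by rewrite -scalerAr mulrDr mulr1 YY addrC. Qed.

Lemma mx_idem_idem : e * e = e.
Proof.
rewrite {2}/mx_idem -scalerAr mulrDr mulr1 mx_idemY.
by linear_identity.
Qed.

Lemma mx_Xf : X * f = e.
Proof. by rewrite mulrA XX mul1r. Qed.

Lemma mx_gX : g * X = e.
Proof. by rewrite -mulrA XX mulr1. Qed.

Lemma mx_gE : g = X - f.
Proof.
rewrite /mx_idem -scalerAl -scalerAr mulrDl mulrDr mul1r mulr1 YX.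
by linear_identity.
Qed.

Lemma mx_ge : g * e = 0.
Proof. by rewrite mx_gE mulrBl -mulrA mx_idem_idem subrr. Qed.

Lemma mx_ef : e * f = 0.
Proof. by rewrite mulrA mx_ge. Qed.

Lemma mx_gf : g * f = e.
Proof. by rewrite -mulrA mx_Xf mx_idem_idem. Qed.

Lemma mx_fg : f * g = 1 - e.
Proof. by rewrite -mulrA [e * _]mulrA mx_idem_idem mx_gE mulrBr XX mx_Xf. Qed.

Lemma mx_fe : f * e = f.
Proof. by rewrite -mulrA mx_idem_idem. Qed.

Lemma mx_eg : e * g = g.
Proof. by rewrite mulrA mx_idem_idem. Qed.

Lemma coact_mx_idem : coact B e = 2%:R^-1 *: (1 \ot 1 + y \ot Y).
Proof. by rewrite /mx_idem lfun_scaleE lfun_addE coact_one YP. Qed.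

(** In closed form (1 + x) z / 2 and (1 - x) y z / 2, the antipodes of [p] and [x m]: the
    coefficients needed to invert [mx_T]. *)
Definition mx_even : H := 2%:R^-1 *: (p + m + x * p + x * m).
Definition mx_odd : H := 2%:R^-1 *: (p - m - x * p + x * m).
Notation u := mx_even.
Notation v := mx_odd.

(* e, X e is the standard basis of the 2-dimensional comodule B(0) e, and mx_T is
   the coaction of e in it. *)
Definition mx_S : tensor H B := u \ot e + v \ot g.
Definition mx_T : tensor H B := p \ot e + m \ot f.

Lemma mx_even_pos : u * p + v * m = 1.
Proof.
rewrite /mx_even /mx_odd -!scalerAl !mulrDl !mulNr -!mulrA.
rewrite pos_pos pos_neg neg_pos neg_neg -!scalerAr !mulrDr !mulrN !mulr1 xx xxA.
by linear_identity.
Qed.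

Lemma mx_pos_even : p * u = 2%:R^-1 *: (1 + y).
Proof.
rewrite /mx_even -scalerAr !mulrDr ![p * (x * _)]mulrA pos_x pos_pos pos_neg.
by linear_identity.
Qed.

Lemma mx_pos_odd : p * v = 0.
Proof.
rewrite /mx_odd -scalerAr !mulrDr !mulrN ![p * (x * _)]mulrA pos_x.
by linear_identity.
Qed.

Lemma mx_neg_even : m * u = 0.
Proof.
rewrite /mx_even -scalerAr !mulrDr ![m * (x * _)]mulrA neg_x !mulNr.
by linear_identity.
Qed.

Lemma mx_neg_odd : m * v = 2%:R^-1 *: (1 - y).
Proof.
rewrite /mx_odd -scalerAr !mulrDr !mulrN ![m * (x * _)]mulrA neg_x !mulNr neg_pos neg_neg.
by linear_identity.
Qed.

Lemma mx_ST : tmul mx_S mx_T = 1 \ot e.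
Proof.
rewrite /mx_S /mx_T !tmul_expandE mx_idem_idem mx_ef mx_ge mx_gf !tpure0r.
by rewrite addr0 add0r -tpure_addl mx_even_pos.
Qed.

Lemma mx_TS : tmul mx_T mx_S = coact B e.
Proof.
rewrite /mx_S /mx_T !tmul_expandE mx_idem_idem mx_eg mx_fe mx_fg.
rewrite mx_pos_even mx_pos_odd mx_neg_even mx_neg_odd coact_mx_idem !tpure0l.
rewrite addr0 add0r /mx_idem !tpureE.
by linear_identity.
Qed.

Lemma mx_eS : tmul (1 \ot e) mx_S = mx_S.
Proof. by rewrite /mx_S !tmul_expandE !mul1r mx_idem_idem mx_eg. Qed.

Lemma mx_Te : tmul mx_T (1 \ot e) = mx_T.
Proof. by rewrite /mx_T !tmul_expandE !mulr1 mx_idem_idem mx_fe. Qed.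

Lemma mx_even_x : u * x = 2%:R^-1 *: (p - m + x * p - x * m).
Proof. by rewrite /mx_even -scalerAl !mulrDl -!mulrA pos_x neg_x mulrN. Qed.

Lemma mx_odd_x : v * x = 2%:R^-1 *: (p + m - x * p - x * m).
Proof. by rewrite /mx_odd -scalerAl !mulrDl !mulNr -!mulrA pos_x neg_x mulrN opprK. Qed.

Lemma tensor_halves (U V : vectType k) (a b : U) (c d : V) :
  (2%:R^-1 *: (a + b)) \ot (2%:R^-1 *: (c + d))
    + (2%:R^-1 *: (a - b)) \ot (2%:R^-1 *: (c - d))
  = 2%:R^-1 *: (a \ot c + b \ot d).
Proof. by rewrite !tpureE; linear_identity. Qed.

(** All factors are half-sums or half-differences of the same vectors, so [tensor_halves] removes
    the cross terms. *)
Lemma comul_mx_even : comul H u = u \ot u + v \ot (v * x).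
Proof.
have uE : u = 2%:R^-1 *: ((p + x * m) + (m + x * p)).
  by rewrite /mx_even; linear_identity.
have uE' : u = 2%:R^-1 *: ((p + m) + (x * p + x * m)).
  by rewrite /mx_even; linear_identity.
have vE : v = 2%:R^-1 *: ((p + x * m) - (m + x * p)).
  by rewrite /mx_odd; linear_identity.
have vxE : v * x = 2%:R^-1 *: ((p + m) - (x * p + x * m)).
  by rewrite mx_odd_x; linear_identity.
rewrite {2}uE {2}uE' vxE vE tensor_halves uE' lfun_scaleE !lfun_addE.
rewrite comul_pos comul_neg comul_x_neg comul_x_pos; congr (_ *: _).
by rewrite !tpureE; linear_identity.
Qed.

Lemma comul_mx_odd : comul H v = u \ot v + v \ot (u * x).
Proof.
have uE : u = 2%:R^-1 *: ((p + x * m) + (m + x * p)).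
  by rewrite /mx_even; linear_identity.
have vE : v = 2%:R^-1 *: ((p + x * m) - (m + x * p)).
  by rewrite /mx_odd; linear_identity.
have vE' : v = 2%:R^-1 *: ((p - m) + (x * m - x * p)).
  by rewrite /mx_odd; linear_identity.
have uxE : u * x = 2%:R^-1 *: ((p - m) - (x * m - x * p)).
  by rewrite mx_even_x; linear_identity.
rewrite uE {2}vE' {2}vE -uE uxE uE tensor_halves vE' lfun_scaleE !lfun_addE !lfun_oppE.
rewrite comul_pos comul_neg comul_x_neg comul_x_pos; congr (_ *: _).
by rewrite !tpureE; linear_identity.
Qed.

(** Left multiplication by [mx_S] after the coaction fixes [mx_S] at [e] and has two terms at [g];
    comparing coefficients leaves the comultiplications of [u] and [v]. *)
Lemma mx_S_cocycle : tassoc _ _ _ (tmap (comul H) \1%VF mx_S)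
  = tmap \1%VF (linfun (fun b => tmul mx_S (coact B b))) mx_S.
Proof.
pose L : 'Hom(B, tensor H B) := linfun (fun b => tmul mx_S (coact B b)).
have LE b : L b = tmul mx_S (coact B b).
  by apply: linfun_linearE=> c a a' /=; rewrite lfun_combE tmulDr.
have Le : L e = mx_S by rewrite LE -mx_TS tmulA mx_ST mx_eS.
have Lg : L g = (u * x) \ot g + (v * x) \ot e.
  by rewrite LE coact_mul tmulA -LE Le XP /mx_S !tmul_expandE mx_gX.
rewrite -/L /mx_S !lfun_addE !tmapE !id_lfunE Le Lg comul_mx_even comul_mx_odd.
rewrite !tpure_addl !lfun_addE !tassocE /mx_S !tpure_addr.
by linear_identity.
Qed.

Lemma mx_T_cocycle : tassoc _ _ _ (tmap (comul H) \1%VF mx_T)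
  = tmap \1%VF (linfun (fun b => tmul (coact B b) mx_T)) mx_T.
Proof.
pose L : 'Hom(B, tensor H B) := linfun (fun b => tmul (coact B b) mx_T).
have LE b : L b = tmul (coact B b) mx_T.
  by apply: linfun_linearE=> c a a' /=; rewrite lfun_combE tmulDl.
have Le : L e = mx_T by rewrite LE -mx_TS -tmulA mx_ST mx_Te.
have Lf : L f = (x * p) \ot f + (x * m) \ot e.
  by rewrite LE coact_mul -tmulA -LE Le XP /mx_T !tmul_expandE mx_Xf.
rewrite -/L /mx_T !lfun_addE !tmapE !id_lfunE Le Lf comul_pos comul_neg.
rewrite !tpure_addl !lfun_addE !tassocE /mx_T !tpure_addr.
by linear_identity.
Qed.

Lemma mx_S_counit : tlift (fun h b => (counit H h : k) *: b) mx_S = e.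
Proof.
rewrite -[LHS]/(slice B (counit H) mx_S) /mx_S lfun_addE !sliceE /mx_even /mx_odd.
rewrite !lfun_scaleE !lfun_addE !lfun_oppE !counit_mul counit_x counit_pos counit_neg.
rewrite mulr0 mulr1 !addr0 subr0 subrr scaler0 scale0r addr0.
by rewrite -[1 + 1]/(2%:R) [_ *: _ : k^o]mulVf // scale1r.
Qed.

Lemma mx_idem_neq0 : e != 0.
Proof.
rewrite scaler_eq0 invr_eq0 (negPf two) /=; apply/eqP=> Y1.
have YN : Y = -1 by apply/eqP; rewrite -addr_eq0 addrC Y1.
move: YX; rewrite YN mulrN1 mulN1r opprK => /esym/neg_eq0 X0.
by have /eqP := XX; rewrite {1}X0 mul0r eq_sym oner_eq0.
Qed.

(** [e] has rank one, so [e B(0) e] is [k e]: the corner acquires a character, with [e] itself as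
    eigenvector. *)
Lemma mx_eigen (c0 c1 c2 c3 : k) :
  e * (c0 *: 1 + c1 *: X + c2 *: Y + c3 *: (X * Y)) * e = (c0 + c2) *: e.
Proof.
move: mx_idem mx_idem_idem mx_ge mx_idemY mx_Y_idem => E EE gE EY YE.
rewrite !(mulrDr, mulrDl) -!scalerAr -!scalerAl mulr1 gE EY EE.
rewrite [E * (X * Y)]mulrA -[E * X * Y * E]mulrA YE gE !scaler0 !addr0.
by rewrite scalerDl.
Qed.

End MatrixCase.

(** * Loewy-graded comodule algebras *)

Section Loewy.
Variables (G : nat -> {vspace H}) (GB : nat -> {vspace B}).
Hypothesis G_graded : is_graded_algebra G.
Hypothesis G0 : G 0%N = K.
Hypothesis B_loewy : is_loewy_graded G GB.
Hypothesis B_exact : AM_exact B.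
Hypothesis sqrt_ex : forall c : k, exists d, d * d = c.

Lemma mem_kp_x : x \in K.
Proof. by rewrite KE; apply: seqv_sub_adjoin; rewrite !inE eqxx. Qed.

Lemma mem_kp_y : y \in K.
Proof. by rewrite KE; apply: seqv_sub_adjoin; rewrite !inE eqxx orbT. Qed.

Lemma mem_kp_z : z \in K.
Proof. by rewrite KE; apply: seqv_sub_adjoin; rewrite !inE eqxx !orbT. Qed.

Lemma mem_kpM (g h : H) : g \in K -> h \in K -> g * h \in K.
Proof. by rewrite KE => gK hK; have := memv_mul gK hK; rewrite agenvM. Qed.

Lemma mem_kp_pos : p \in K.
Proof. by rewrite rpredZ ?rpredD ?mem_kpM ?mem_kp_y ?mem_kp_z. Qed.

Lemma mem_kp_neg : m \in K.
Proof. by rewrite rpredZ ?rpredB ?mem_kpM ?mem_kp_y ?mem_kp_z. Qed.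

Lemma deg0P b : (b \in GB 0%N) = (coact B b \in tensv K fullv).
Proof.
have [_ /(_ 0%N) E _] := B_loewy; move: E.
by rewrite !big_ord1 G0 => <-; rewrite memv_preim.
Qed.

Lemma deg0M b c : b \in GB 0%N -> c \in GB 0%N -> b * c \in GB 0%N.
Proof.
by have [[_ _ GM] _ _] := B_loewy => b0 c0; have /subvP := GM 0%N 0%N; apply; rewrite memv_mul.
Qed.

Lemma homog_deg0 g (w : B) : g \in K -> homog g w -> w \in GB 0%N.
Proof. by move=> gK wE; rewrite deg0P wE memv_tensv ?memvf. Qed.

Lemma pair_deg0 (w w' : B) : kp_pair w w' -> w \in GB 0%N /\ w' \in GB 0%N.
Proof.
move=> [wE w'E]; rewrite !deg0P wE w'E.
by rewrite !rpredD ?memv_tensv ?memvf ?mem_kpM ?mem_kp_x ?mem_kp_pos ?mem_kp_neg.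
Qed.

Lemma coinvariant_scalar (w : B) : homog 1 w -> exists c, w = c *: 1.
Proof.
move=> wE; apply/vlineP.
have -> : <[1 : B]>%VS = coinvariants B.
  apply/eqP; rewrite eqEdim B_exact.1 dim_vline oner_eq0 andbT -memvE.
  by apply/coinvariantsP; rewrite coact_one.
exact/coinvariantsP.
Qed.

(** A subcomodule generates a costable right ideal, so exactness leaves only the whole algebra. *)
Lemma costable_generators (s : seq B) : (exists2 w, w \in s & w != 0) ->
  (forall w, w \in s -> coact B w \in tensv fullv <<s>>) ->
  (<<s>> * fullv)%VS = fullv.
Proof.
move=> [w ws w0] scoact; have [| |J0|//] := B_exact.2 (<<s>> * fullv)%VS.
- by rewrite -prodvA prodvSr // subvf.
- apply/subvP=> _ /memv_imgP[b bJ ->]; rewrite memv_preim; apply: subvP bJ.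
  apply/prodvP=> v c vs _; rewrite -memv_preim coact_mul.
  have vE : coact B v \in tensv fullv <<s>>.
    by rewrite memv_preim; apply: subvP vs; apply/span_subvP=> t ts;
      rewrite -memv_preim scoact.
  have := tmul_tensv vE (_ : coact B c \in tensv fullv fullv).
  have full : coact B c \in tensv fullv fullv.
    elim/tensor_ind: (coact B c) => [h a|d t t' IHt IHt'].
      by rewrite memv_tensv ?memvf.
    by rewrite rpredD ?rpredZ.
  by move/(_ full); apply: subvP; apply: tensv_subP=> h a _ aJ; rewrite memv_tensv ?memvf.
case/negP: w0; rewrite -memv0 -J0 -[w]mulr1 memv_mul ?memvf //.
exact: memv_span.
Qed.

Lemma mul_limg (b c : B) : b * c \in limg (amull b).
Proof. by apply/memv_imgP; exists c; rewrite ?memvf ?lfunE. Qed.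

Lemma homog_right_unit g (w : B) : homog g w -> w != 0 -> exists a, w * a = 1.
Proof.
move=> wE w0; have full : (<<[:: w]>> * fullv)%VS = fullv.
  apply: costable_generators; first by exists w; rewrite ?inE.
  by move=> t; rewrite inE => /eqP->; rewrite wE memv_tensv ?memvf ?memv_span ?inE.
have sub : (<<[:: w]>> * fullv <= limg (amull w))%VS.
  rewrite span_seq1; apply/prodvP=> _ b /vlineP[c ->] _.
  by rewrite -scalerAl scalerAr mul_limg.
have /memv_imgP[a _ E] : 1 \in limg (amull w) by rewrite (subvP sub) // full memvf.
by exists a; rewrite E lfunE.
Qed.

(** Exactness gives a solution in [B]; the projection to degree 0 is multiplicative and fixes [w],
    [w'] and 1, so it moves the solution into B(0). *)
Lemma pair_right_unit (w w' : B) : kp_pair w w' -> w != 0 ->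
  exists a a', [/\ a \in GB 0%N, a' \in GB 0%N & w * a + w' * a' = 1].
Proof.
move=> wP w0; have [wE w'E] := wP; have [wB w'B] := pair_deg0 wP.
have ws : w \in <<[:: w; w']>>%VS by rewrite memv_span ?inE ?eqxx.
have w's : w' \in <<[:: w; w']>>%VS by rewrite memv_span ?inE ?eqxx ?orbT.
have full : (<<[:: w; w']>> * fullv)%VS = fullv.
  apply: costable_generators; first by exists w; rewrite ?inE ?eqxx.
  by move=> t; rewrite !inE => /orP[]/eqP->; rewrite ?wE ?w'E rpredD ?memv_tensv ?memvf.
have sub : (<<[:: w; w']>> * fullv <= limg (amull w) + limg (amull w'))%VS.
  rewrite span_cons span_seq1 prodvDl; apply: addvS; apply/prodvP=> _ b /vlineP[c ->] _.
    by rewrite -scalerAl scalerAr mul_limg.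
  by rewrite -scalerAl scalerAr mul_limg.
have [GB_graded _ _] := B_loewy; have [_ one0 _] := GB_graded.
have [pr [pr0 pr_id _ prM]] := graded_projection GB_graded.
have : 1 \in (limg (amull w) + limg (amull w'))%VS by rewrite (subvP sub) // full memvf.
case/memv_addP=> _ /memv_imgP[a _ ->] [_ /memv_imgP[a' _ ->] E].
exists (pr a), (pr a'); split=> //; rewrite !lfunE /= in E.
by rewrite -(pr_id _ one0) E lfun_addE !prM (pr_id _ wB) (pr_id _ w'B).
Qed.

Theorem kp_coideal_realization : exists (A : {aspace H})
    (A_coideal : left_coideal_subalgebra A),
  is_homogeneous G A /\ module_equivalent B (coideal_comodAlgebra A_coideal).
Proof.
have [_ one0 _] := G_graded; have [[_ Bone0 _] _ _] := B_loewy.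
have := kp_comodule_algebra_cases deg0P deg0M coinvariant_scalar homog_right_unit
  pair_right_unit (fun w w' wP => proj1 (pair_deg0 wP)) sqrt_ex.
case=> [[Om Om0 OmE] | [X [Y [[XP YP XX YY YX] span_XY]]]].
  (* With [e = 1] and trivial twist the corner is [B] itself, with its own coaction. *)
  apply: (@corner_realization _ _ _ G_graded _ _ B_loewy B_exact 1 Om (1 \ot 1) (1 \ot 1)
    _ _ _ _ _ _ _ _ _ _ _ _ _ _ 1%N (fun=> 1) (fun=> 1)).
  all: rewrite ?memv_tensv ?mul1r ?tmul1l ?coact_one //.
  - rewrite !tmapE !id_lfunE comul_one tassocE linfun_linearE.
      by rewrite tmul1l coact_one.
    by move=> c v w /=; rewrite lfun_combE tmulDr.
  - rewrite !tmapE !id_lfunE comul_one tassocE linfun_linearE.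
      by rewrite tmul1r coact_one.
    by move=> c v w /=; rewrite lfun_combE tmulDl.
  - by rewrite -[LHS]/(slice B (counit H) (1 \ot 1)) sliceE counit_one scale1r.
  - by move=> b b0; have [c cE] := OmE b b0; exists c; rewrite mul1r.
  - by move=> i j; rewrite !ord1 eqxx scale1r.
  by rewrite big_ord1.
pose e := mx_idem Y.
have YB : Y \in GB 0%N by apply: homog_deg0 YP; exact: mem_kp_y.
have XB : X \in GB 0%N by apply: homog_deg0 XP; exact: mem_kp_x.
have eB : e \in GB 0%N by rewrite rpredZ ?rpredD.
have evenK : mx_even \in G 0%N.
  by rewrite G0 rpredZ ?rpredD ?mem_kpM ?mem_kp_x ?mem_kp_pos ?mem_kp_neg.
have oddK : mx_odd \in G 0%N.
  by rewrite G0 rpredZ ?rpredD ?rpredN ?mem_kpM ?mem_kp_x ?mem_kp_pos ?mem_kp_neg.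
(* The first column e11, e21 and the first row e11, e12 of the matrix units. *)
pose r (i : 'I_2) := if i == ord0 then e else X * e.
pose l (i : 'I_2) := if i == ord0 then e else e * X.
apply: (@corner_realization _ _ _ G_graded _ _ B_loewy B_exact e e (mx_S X Y) (mx_T X Y)
    _ _ _ _ _ _ _ _ _ _ _ _ _ _ 2%N r l) => //.
- by rewrite rpredD ?memv_tensv ?deg0M.
- by rewrite rpredD ?memv_tensv ?deg0M ?G0 ?mem_kp_pos ?mem_kp_neg.
- exact: mx_idem_idem.
- exact: mx_ST.
- exact: mx_TS.
- exact: mx_eS.
- exact: mx_Te.
- exact: mx_S_cocycle.
- exact: mx_T_cocycle.
- exact: mx_S_counit.
- exact: (mx_idem_neq0 XX YX).
- exact: mx_idem_idem.
- move=> b /span_XY[c0 [c1 [c2 [c3 ->]]]]; exists (c0 + c2); exact: mx_eigen.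
- by move=> i; rewrite /r; case: ifP => _; [apply: mx_idem_idem | apply: mx_fe].
- by move=> i; rewrite /l; case: ifP => _; [apply: mx_idem_idem | apply: mx_eg].
- move=> [[|[|i]] //= ip] [[|[|j]] //= jp]; rewrite /r /l -!val_eqE /= ?scale1r ?scale0r.
  + exact: mx_idem_idem.
  + exact: mx_ef.
  + exact: mx_ge.
  exact: mx_gf.
by rewrite big_ord_recl big_ord1 /r /l -!val_eqE /= /e mx_idem_idem // mx_fg // addrC subrK.
Qed.

End Loewy.

End Comodule.
End KacPaljutkin.

Lemma closed_field_sqrt (k : closedFieldType) (c : k) : exists d, d * d = c.
Proof.
have [d dE] := solve_monicpoly (fun i => if i == 0%N then c else 0) (isT : (0 < 2)%N).
exists d; move: dE; rewrite expr2 => ->.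
by rewrite big_ord_recl big_ord1 /= expr0 mulr1 mul0r addr0.
Qed.

Theorem proposition5p25
  (k : closedFieldType) (char_k : [pchar k] =i pred0)
  (H : hopfAlgebra k) (G : nat -> {vspace H})
  (H_graded : is_coradically_graded G)
  (H0_kp : is_kac_paljutkin (G 0%N))
  (B : comodAlgebra H) (GB : nat -> {vspace B})
  (B_loewy : is_loewy_graded G GB)
  (B_exact : AM_exact B) :
  exists (A : {aspace H}) (A_coideal : left_coideal_subalgebra A),
    is_homogeneous G A /\
    module_equivalent B (coideal_comodAlgebra A_coideal).
Proof.
have two : 2%:R != 0 :> k.
  by apply/negP=> two0; have := char_k 2%N; rewrite inE /= two0.
have [[G_graded _ _ _] _] := H_graded.
have [x [y [z [[KE dimK] [xx yy xy] [yz xz zz] [xG yG zE] [ez _]]]]] := H0_kp.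
have counit_grouplike g : grouplike g -> counit H g = 1.
  move=> [g0 gE]; apply: (@scale_inj k H (counit H g) 1 g g0); rewrite scale1r -[RHS]counit_left gE.
  by rewrite -[RHS]/(slice H (counit H) (g \ot g)) sliceE.
apply: (@kp_coideal_realization k two H (G 0%N) x y z) => //.
- exact: xG.2.
- exact: yG.2.
- exact: counit_grouplike.
- exact: counit_grouplike.
- exact: B_loewy.
exact: closed_field_sqrt.
Qed.
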